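(* Let $\Gamma\backslash G$ be any Heisenberg manifold of dimension $n=2m+1$ with left-invariant metric and spin structure $\varepsilon:\Gamma\to\{\pm1\}$, let $Z$ be a unit vector in the center of $\mathfrak g$, and let $\alpha\in\mathfrak g^*$ with $\alpha(Z)\neq0$ be such that the irreducible representation $\pi_\alpha$ occurs in $L^2_\varepsilon(\Gamma\backslash G)$. Then the infinite-dimensional subspace $\mathcal H_\alpha\cong\overline{\mathcal H_\alpha}\otimes\Sigma_n$ decomposes as a direct sum of finite-dimensional subspaces that are invariant by the spin Dirac operator $D$. In particular, for $\mathbf p\in(\mathbb{Z}_{\ge0})^m$ the Dirac operator acts on the finite-dimensional invariant subspace $$\mathcal U_{\mathbf p}=\mathrm{span}\{\overline u_{\mathbf p,\ell}:\ell\in\{-1,1\}^m\}$$ by the formula $$D\overline u_{\mathbf p,\ell}=-\sum_{j=1}^m2i\sqrt{\pi d_jp_j}\,\ell_1\ell_2\cdots\ell_j\,\overline u_{\mathbf p,\ell^j}+\left(-2\pi\alpha(Z)\ell_1\cdots\ell_m-\frac14\sum_{j=1}^m d_j\,\ell_1\cdots\widehat{\ell_j}\cdots\ell_m\right)\overline u_{\mathbf p,\ell},$$ where $\widehat{\ell_j}$ means that the factor is omitted.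
   Context: Setting. $G$ is the simply connected Heisenberg group of dimension $2m+1$ (two-step nilpotent with one-dimensional center), $\mathfrak g$ its Lie algebra with an inner product, $\mathfrak z$ the center of $\mathfrak g$, $\Gamma$ a cocompact discrete subgroup. $\Sigma_n\cong\mathbb{C}^{2^m}$ is an irreducible spinor module; Clifford multiplication $\diamond$ satisfies $v\diamond v\diamond=-|v|^2$. $L^2_\varepsilon(\Gamma\backslash G)=\{f\in L^2_{\mathrm{loc}}(G):f(\gamma x)=\varepsilon(\gamma)f(x)\ \forall\gamma\in\Gamma,x\in G\}$ with the right-translation action $\rho_\varepsilon$ of $G$; spinors are $L^2_\varepsilon(\Gamma\backslash G)\otimes\Sigma_n$ via the left-invariant framing, and $$D=\sum_i(E_i\diamond)\rho_{\varepsilon*}(E_i)+\frac14\sum_{b<i\le2m}\langle Z,[X_b,X_i]\rangle(Z\diamond X_b\diamond X_i\diamond),$$ with $\{E_i\}=\{Z,X_1,\dots,X_{2m}\}$ a left-invariant orthonormal frame. $\overline{\mathcal H_\alpha}$ is an irreducible $\rho_\varepsilon$-subspace of $L^2_\varepsilon(\Gamma\backslash G)$ of type $\pi_\alpha$ (the representation attached by Kirillov theory to the coadjoint orbit of $\alpha$, with inducing character $\exp X\mapsto e^{2\pi i\alpha(X)}$). Adapted basis and model. Choose an orthonormal basis $\{U_1,\dots,U_m,V_1,\dots,V_m\}$ of $\mathfrak z^\perp$ with $\alpha([U_i,V_i])=d_i>0$, $\alpha([U_i,V_j])=0$ for $i\neq j$, $\alpha([U_i,U_j])=\alpha([V_i,V_j])=0$.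 There is a unitary identification $\overline{\mathcal H_\alpha}\cong L^2(\mathbb{R}^m)$ under which $\rho_{\varepsilon*}(U_j)=\partial/\partial t_j$, $\rho_{\varepsilon*}(V_j)=2\pi id_jt_j$, $\rho_{\varepsilon*}(Z)=2\pi i\alpha(Z)$. Matrices. With $\sigma_1=\begin{pmatrix}0&1\\1&0\end{pmatrix}$, $\sigma_2=\begin{pmatrix}0&i\\-i&0\end{pmatrix}$, $\mathbf1'=\begin{pmatrix}1&0\\0&-1\end{pmatrix}$, $\mathbf1$ the identity, $\Sigma_n=(\mathbb{C}^2)^{\otimes m}$, Clifford multiplication is realized by $(U_j\diamond)=i\,\mathbf1'\otimes\cdots\otimes\mathbf1'\otimes\sigma_1\otimes\mathbf1\otimes\cdots\otimes\mathbf1$, $(V_j\diamond)=i\,\mathbf1'\otimes\cdots\otimes\mathbf1'\otimes\sigma_2\otimes\mathbf1\otimes\cdots\otimes\mathbf1$ ($j-1$ leading factors $\mathbf1'$), $(Z\diamond)=i\,\mathbf1'\otimes\cdots\otimes\mathbf1'$. Basis functions. $e_1=(1,0)^T$, $e_{-1}=(0,1)^T$, $v_\ell=e_{\ell_1}\otimes\cdots\otimes e_{\ell_m}$; $\ell^j$ is $\ell$ with $\ell_j$ replaced by $-\ell_j$. $h_p(t)=e^{t^2/2}(d/dt)^pe^{-t^2}$ for $p\ge0$, $h_p=0$ for $p<0$; $u_{\mathbf p,\ell}(t)=\prod_{j=1}^mh_{p_j}(\sqrt{2\pi d_j}\,t_j)v_\ell$. With $(\mathbf E_\ell)_a=0$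 if $\ell_a=1$ and $-1$ if $\ell_a=-1$, $\overline u_{\mathbf p,\ell}=\left(\prod_{\ell_j=-1}\sqrt{2p_j}\right)u_{\mathbf p+\mathbf E_\ell,\ell}$.
   Formalization: In the last diagonal term of the formula, d_j is replaced by d_j/α(Z): since α([U_j,V_j]) = d_j, one has ⟨Z,[U_j,V_j]⟩ = d_j/α(Z), so the printed term is wrong unless α(Z) = 1 (e.g. m = 1, α(Z) = 2 gives −d_1/8, not −d_1/4). *)

(* Defs.v *)
From HB Require Import structures.
From mathcomp Require Import all_boot all_order all_algebra.
From mathcomp Require Import all_classical all_reals all_analysis.
From mathcomp Require Import complex.

Set Implicit Arguments.
Unset Strict Implicit.
Unset Printing Implicit Defensive.

Import Order.TTheory GRing.Theory Num.Theory.
Import numFieldNormedType.Exports.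

Local Open Scope classical_set_scope.
Local Open Scope ring_scope.
Local Open Scope complex_scope.

(** * Lebesgue measure on R^n and square-integrable complex functions *)

Notation Rn R n := (n.-tuple (measurableTypeR R)).

Section LebesgueRn.
Variable R : realType.

Definition consRn n (z : Rn R n * measurableTypeR R) : Rn R n.+1 :=
  [tuple of z.2 :: z.1].

Lemma measurable_consRn n : measurable_fun setT (@consRn n).
Proof. exact: measurable_cons. Qed.

Definition lebesgueRnS n (mu : {measure set (Rn R n) -> \bar R}) :
    {measure set (Rn R n.+1) -> \bar R} :=
  measure_function_pushforward__canonical__measure_function_Measure
    (mu \x (@lebesgue_measure R))%E (@measurable_consRn n).

Fixpoint lebesgueRn n : {measure set (Rn R n) -> \bar R} :=
  match n with
  | 0 => \d_ ([tuple] : Rn R 0)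
  | n'.+1 => lebesgueRnS (lebesgueRn n')
  end.

End LebesgueRn.

Section ComplexL2.
Context (R : realType) d (T : measurableType d).
Variable mu : {measure set T -> \bar R}.
Implicit Types (D : set T) (f g : T -> R[i]).

Definition sqmod (z : R[i]) : R := complex.Re z ^+ 2 + complex.Im z ^+ 2.

Definition measurableC f :=
  measurable_fun setT (fun x => complex.Re (f x) : measurableTypeR R) /\
  measurable_fun setT (fun x => complex.Im (f x) : measurableTypeR R).

Definition sq_integrable D f := mu.-integrable D (fun x => (sqmod (f x))%:E).

Definition integralC D f : R[i] :=
  (\int[mu]_(x in D) complex.Re (f x)) +i* (\int[mu]_(x in D) complex.Im (f x)).

Definition dotL2 D f g : R[i] := integralC D (fun x => f x * (g x)^*).

End ComplexL2.

(** * Heisenberg Lie algebras with an inner product, and their groups *)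

Section Heisenberg.
Variables (R : realType) (m : nat).

Definition lie := 'rV[R]_(m + m).+1.

Record heisenberg := Heisenberg {
  br : lie -> lie -> lie;
  ip : lie -> lie -> R;
  br_linearl : forall a x y z, br (a *: x + y) z = a *: br x z + br y z;
  br_alt : forall x, br x x = 0;
  br_jacobi : forall x y z, br x (br y z) + br y (br z x) + br z (br x y) = 0;
  br_2step : forall x y z, br (br x y) z = 0;
  br_nonabelian : exists x y, br x y <> 0;
  br_center1 : exists2 z0, z0 != 0 &
    forall x, (forall y, br x y = 0) <-> exists a, x = a *: z0;
  ip_linearl : forall a x y z, ip (a *: x + y) z = a * ip x z + ip y z;
  ip_sym : forall x y, ip x y = ip y x;
  ip_pos : forall x, x != 0 -> 0 < ip x x
}.

Variable h : heisenberg.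

Definition lie_center : set lie := [set x | forall y, br h x y = 0].

(* The simply connected group G is identified with its Lie algebra by the
   exponential map, the product being given by Baker-Campbell-Hausdorff:
   the unit is 0, the inverse of x is - x, and exp (s X) is s *: X. *)
Definition mulG (x y : lie) : lie := x + y + 2^-1 *: br h x y.

Definition cocompact_discrete_subgroup (Gam : set lie) :=
  [/\ [/\ Gam 0,
          forall x y, Gam x -> Gam y -> Gam (mulG x y) &
          forall x, Gam x -> Gam (- x)],
      \forall x \near (0 : lie), Gam x -> x = 0 &
      exists2 K : set lie, compact K &
        forall x, exists g k, [/\ Gam g, K k & x = mulG g k]].

(* On a Heisenberg manifold with a left-invariant framing, the spin structures
   are the homomorphisms from the fundamental group to {1, -1}. *)
Definition spin_structure (Gam : set lie) (eps : lie -> R[i]) :=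
  (forall g, Gam g -> eps g = 1 \/ eps g = -1) /\
  (forall g g', Gam g -> Gam g' -> eps (mulG g g') = eps g * eps g').

(* For Z a unit vector of the center, the entries of U, V form an orthonormal
   basis of the orthogonal complement of the center.  As the center is the line
   of Z, [U_j, V_j] = (d_j / alpha(Z)) Z, so <Z, [U_j, V_j]> = d_j / alpha(Z). *)
Definition adapted_basis (Z : lie) (alpha : {scalar lie})
    (U V : 'I_m -> lie) (d : 'I_m -> R) :=
  [/\ [/\ forall i j, ip h (U i) (U j) = (i == j)%:R,
          forall i j, ip h (V i) (V j) = (i == j)%:R,
          forall i j, ip h (U i) (V j) = 0 &
          forall i, ip h Z (U i) = 0 /\ ip h Z (V i) = 0],
      forall i, 0 < d i,
      forall i, alpha (br h (U i) (V i)) = d i,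
      forall i j, i != j -> alpha (br h (U i) (V j)) = 0 &
      forall i j, alpha (br h (U i) (U j)) = 0 /\
                  alpha (br h (V i) (V j)) = 0].

End Heisenberg.

Section SpinorsOnHeisenbergManifold.
Variables (R : realType) (m : nat) (h : heisenberg R m).
Variables (Z : lie R m) (U V : 'I_m -> lie R m).
Variables (Gam F : set (lie R m)) (eps : lie R m -> R[i]).

Local Notation C := R[i].
Local Notation G := (lie R m).
Local Notation coordG := (Rn R (m + m).+1).
Local Notation volR := (lebesgueRn R (m + m).+1).

Definition frameX (i : 'I_(m + m)) : G :=
  match fintype.split i with inl j => U j | inr j => V j end.

(* The Riemannian volume (a Haar measure) of G is Lebesgue measure in the
   coordinates given by the orthonormal basis Z, X_1, ..., X_2m. *)
Definition chart (x : coordG) : G :=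
  tnth x ord0 *: Z + \sum_(i < m + m) tnth x (lift ord0 i) *: frameX i.

Definition aeG (P : G -> Prop) := {ae volR, forall x, P (chart x)}.

(* F plays the role of the quotient of G by Gam: the L^2 inner product on the
   quotient is the integral over F, and does not depend on F. *)
Definition fundamental_domain :=
  measurable (chart @^-1` F) /\
  forall x, exists! g, Gam g /\ F (mulG h g x).

Definition L2eps (f : G -> C) :=
  [/\ measurableC (f \o chart),
      forall g x, Gam g -> f (mulG h g x) = eps g * f x &
      forall K : set G, compact K ->
        sq_integrable volR (chart @^-1` K) (f \o chart)].

Definition dotG (f g : G -> C) : C :=
  dotL2 volR (chart @^-1` F) (f \o chart) (g \o chart).

Definition sqnormG (f : G -> C) : R := complex.Re (dotG f f).

Definition rho (x : G) (f : G -> C) : G -> C := fun y => f (mulG h y x).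

(* Graph of the (unbounded) operator rho_*(X): the derivative in L^2, at s = 0,
   of s |-> rho (exp (s X)) f.  It determines g up to a null set. *)
Definition rho_star (X : G) (f g : G -> C) :=
  [/\ L2eps f, L2eps g &
      sqnormG (fun y => (rho (s *: X) f y - f y) / s%:C - g y)
        @[s --> (0 : R)^'] --> (0 : R)].

Definition closed_invariant_subspace (H : set (G -> C)) :=
  [/\ [/\ H `<=` L2eps, H (fun=> 0) &
          forall (c : C) f g, H f -> H g -> H (fun y => c * f y + g y)],
      forall f g, H f -> L2eps g -> aeG (fun y => f y = g y) -> H g,
      forall f, L2eps f ->
        (forall e : R, 0 < e ->
           exists2 g, H g & sqnormG (fun y => f y - g y) < e) -> H f &
      forall x f, H f -> H (rho x f)].

Definition irreducible_subspace (H : set (G -> C)) :=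
  [/\ closed_invariant_subspace H,
      exists2 f, H f & ~ aeG (fun y => f y = 0) &
      forall K : set (G -> C), closed_invariant_subspace K -> K `<=` H ->
        (forall f, K f -> aeG (fun y => f y = 0)) \/ H `<=` K].

(** ** The representation pi_alpha on L^2(R^m) *)

Local Notation lebm := (lebesgueRn R m).

Definition L2Rm (f : Rn R m -> C) :=
  measurableC f /\ sq_integrable lebm setT f.

Definition expi (t : R) : C := cos t +i* sin t.

(* The representation induced from the character exp Y |-> e^{2 pi i alpha(Y)}
   of the polarizing subgroup exp (span {V_1, ..., V_m, Z}), a function on G
   being restricted to the points exp (\sum_j t_j U_j).  One has
     exp (\sum_j t_j U_j) x = exp Y exp (\sum_j (t_j + a_j) U_j)
   with a_j = <x, U_j>, b_j = <x, V_j> and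
     Y = \sum_j b_j V_j + <x, Z> Z
         + [\sum_j (t_j + a_j / 2) U_j, \sum_j b_j V_j].
   The coadjoint orbit of alpha consists of all the functionals which agree
   with alpha on the center; the representative used is the one that vanishes
   on the V_j, so that the first sum does not contribute and pi_{alpha *} maps
   U_j, V_j, Z to d/dt_j, 2 pi i d_j t_j, 2 pi i alpha(Z). *)
Definition pi_alpha (alpha : {scalar lie R m}) (x : G) (f : Rn R m -> C) :
    Rn R m -> C :=
  fun t =>
    expi (2 * pi * alpha (ip h x Z *: Z +
           br h (\sum_(j < m) (tnth t j + ip h x (U j) / 2) *: U j)
                (\sum_(j < m) ip h x (V j) *: V j))) *
    f [tuple tnth t j + ip h x (U j) | j < m].

(* T identifies L^2(R^m) with H unitarily and intertwines pi_alpha with rho;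
   equality in L^2 is equality almost everywhere. *)
Definition unitary_identification (alpha : {scalar lie R m})
    (H : set (G -> C)) (T : (Rn R m -> C) -> (G -> C)) :=
  [/\ [/\ forall f, L2Rm f -> H (T f),
          forall f g, L2Rm f -> L2Rm g -> {ae lebm, forall t, f t = g t} ->
            aeG (fun y => T f y = T g y) &
          forall (c : C) f g, L2Rm f -> L2Rm g ->
            aeG (fun y => T (fun t => c * f t + g t) y = c * T f y + T g y)],
      forall f g, L2Rm f -> L2Rm g -> dotG (T f) (T g) = dotL2 lebm setT f g,
      forall phi, H phi -> exists2 f, L2Rm f & aeG (fun y => T f y = phi y) &
      forall x f, L2Rm f ->
        aeG (fun y => rho x (T f) y = T (pi_alpha alpha x f) y)].

(** ** The spinor module (C^2)^{\otimes m} and Clifford multiplication *)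

(* Indices of the standard basis of (C^2)^{\otimes m}.  They also encode the
   elements l of {-1,1}^m: 0 stands for the sign 1, and 1 for the sign -1. *)
Definition tidx := {ffun 'I_m -> 'I_2}.
Definition spinor := tidx -> C.
Definition spin_op := tidx -> tidx -> C.

Definition spin_act (M : spin_op) (s : spinor) : spinor :=
  fun k => \sum_(l : tidx) M k l * s l.

Definition mx2 (a b c d : C) : 'M[C]_2 :=
  \matrix_(i < 2, j < 2) nth 0 (nth [::] [:: [:: a; b]; [:: c; d]] i) j.

Definition sigma1 := mx2 0 1 1 0.
Definition sigma2 := mx2 0 'i%C (- 'i%C) 0.
Definition one' := mx2 1 0 0 (-1).

Definition tensor (A : 'I_m -> 'M[C]_2) : spin_op :=
  fun k l => \prod_(j < m) A j (k j) (l j).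

Definition cliff_at (S : 'M[C]_2) (j : 'I_m) : spin_op := fun k l =>
  'i%C * tensor (fun a => if (a < j)%N then one'
                        else if a == j then S else 1%:M) k l.

Definition cliffU := cliff_at sigma1.
Definition cliffV := cliff_at sigma2.
Definition cliffZ : spin_op := fun k l => 'i%C * tensor (fun=> one') k l.

Definition cliffX (i : 'I_(m + m)) : spin_op :=
  match fintype.split i with inl j => cliffU j | inr j => cliffV j end.

(** ** Spinor fields and the Dirac operator *)

Definition spinor_field := G -> spinor.

Definition component (psi : spinor_field) (k : tidx) : G -> C := fun y => psi y k.
Definition L2spin (psi : spinor_field) := forall k, L2eps (component psi k).
Definition ae_eq_spin (psi phi : spinor_field) := forall k, aeG (fun y => psi y k = phi y k).
Definition dot_spin (psi phi : spinor_field) : C :=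
  \sum_(k : tidx) dotG (component psi k) (component phi k).
Definition sqnorm_spin (psi : spinor_field) : R := complex.Re (dot_spin psi psi).

Definition nabla (X : G) (psi phi : spinor_field) :=
  forall k, rho_star X (component psi k) (component phi k).

(* Graph of D, with phi determined by psi up to a null set. *)
Definition spin_dirac (psi phi : spinor_field) :=
  exists (WZ : spinor_field) (W : 'I_(m + m) -> spinor_field),
    [/\ nabla Z psi WZ, forall i, nabla (frameX i) psi (W i), L2spin phi &
        ae_eq_spin phi (fun y k =>
          spin_act cliffZ (WZ y) k + \sum_(i < m + m) spin_act (cliffX i) (W i y) k
          + 4^-1 * \sum_(i < m + m) \sum_(b < m + m | (b < i)%N)
              (ip h Z (br h (frameX b) (frameX i)))%:C
              * spin_act cliffZ (spin_act (cliffX b) (spin_act (cliffX i) (psi y))) k)].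

(* The subspace of L^2 spinors spanned by a finite family. *)
Definition span_of (I : finType) (b : I -> spinor_field) : set spinor_field :=
  [set psi | L2spin psi /\
     exists c : I -> C, ae_eq_spin psi (fun y k => \sum_(i : I) c i * b i y k)].

Definition finite_dimensional (W : set spinor_field) :=
  exists n (b : 'I_n -> spinor_field), (forall i, L2spin (b i)) /\ W = span_of b.

Definition D_invariant (W : set spinor_field) :=
  forall psi, W psi -> exists2 phi, W phi & spin_dirac psi phi.

(* H is the Hilbert space direct sum of the W i. *)
Definition hilbert_direct_sum (I : choiceType) (H : set spinor_field)
    (W : I -> set spinor_field) :=
  [/\ forall i, W i `<=` H,
      forall i j psi phi, i != j -> W i psi -> W j phi -> dot_spin psi phi = 0 &
      forall psi (e : R), H psi -> 0 < e ->
        exists (s : seq I) (w : I -> spinor_field),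
          (forall i, i \in s -> W i (w i)) /\
          sqnorm_spin (fun y k => psi y k - \sum_(i <- s) w i y k) < e].

(* The tensor product of H with the spinor module. *)
Definition tensor_spinors (H : set (G -> C)) : set spinor_field :=
  [set psi | forall k, H (component psi k)].

(** ** The basis functions *)

Definition sign (l : tidx) (j : 'I_m) : R := if l j == 0 then 1 else -1.

Definition flip (j : 'I_m) (l : tidx) : tidx :=
  [ffun a => if a == j then (if l a == 0 then 1 else 0) else l a].

Definition evec (s : 'I_2) : 'cV[C]_2 := delta_mx s 0.

Definition vvec (l : tidx) : spinor := fun k => \prod_(j < m) evec (l j) (k j) 0.

Definition hermite (p : int) (t : R) : R :=
  match p with
  | Posz n => expR (t ^+ 2 / 2) * derive1n n (fun s : R => expR (- s ^+ 2)) t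
  | Negz _ => 0
  end.

Definition ufun (d : 'I_m -> R) (p : 'I_m -> int) (l : tidx) (t : Rn R m) : spinor :=
  fun k => (\prod_(j < m) hermite (p j) (Num.sqrt (2 * pi * d j) * tnth t j))%:C
           * vvec l k.

Definition Evec (l : tidx) (a : 'I_m) : int := if l a == 0 then 0 else -1.

Definition ubar (d : 'I_m -> R) (p : {ffun 'I_m -> nat}) (l : tidx) (t : Rn R m) :
    spinor :=
  fun k => (\prod_(j < m | l j != 0) Num.sqrt (2 * (p j)%:R))%:C
           * ufun d (fun j => (p j)%:Z + Evec l j) l t k.

(* T tensored with the identity of the spinor module. *)
Definition tensor_id (T : (Rn R m -> C) -> (G -> C)) (u : Rn R m -> spinor) : spinor_field :=
  fun y k => T (fun t => u t k) y.

(* The basis spinor \overline u_{p,l}, seen in L^2_eps tensored with spinors. *)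
Definition ubarG T d p l : spinor_field := tensor_id T (ubar d p l).

Definition Uspace T d p : set spinor_field := span_of (ubarG T d p).

End SpinorsOnHeisenbergManifold.

(* Main.v *)
(* Through T everything happens in the Schroedinger model L^2(R^m), where U_j,
   V_j and Z act by d/dt_j, 2 pi i d_j t_j and 2 pi i alpha(Z).  In the standard
   basis of the spinor module, the part of D which involves U_j and V_j has as
   component of index k a multiple of (d/dt_j + l_j 2 pi d_j t_j) psi_l, where l is
   k with the sign k_j flipped; this is a ladder operator for the Hermite functions.
   The other terms of D are diagonal.  This gives the formula, hence the invariance
   of the finite-dimensional spaces U_p.

   The U_p are orthogonal because Hermite functions are.  That they span follows
   from irreducibility instead of the completeness of the Hermite functions: the
   limits of combinations of Hermite functions are stable under pi_alpha, as
   cos, sin and exp times a polynomial Gaussian are L^2 limits of polynomial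
   Gaussians, so that they correspond to a nonzero closed invariant subspace of
   H. *)
From HB Require Import structures.
Require Import Defs.
From mathcomp Require Import all_boot all_order all_algebra.
From mathcomp Require Import all_classical all_reals all_analysis.
From mathcomp Require Import measurable_realfun complex ring lra.

Set Implicit Arguments.
Unset Strict Implicit.
Unset Printing Implicit Defensive.

Import Order.TTheory GRing.Theory Num.Theory.
Import numFieldNormedType.Exports.

Local Open Scope classical_set_scope.
Local Open Scope ring_scope.

(** * Measure-preserving maps and products on R^n *)

(** [T] is linear, isometric and equivariant only up to null sets, so fields are handled through the
    relation [rep phi f] ([phi] agrees almost everywhere with [T f]), which respects linear
    combinations, inner products and the two group actions. The analysis is done in one variable and
    carried to R^m by Fubini, Hermite functions being products; derivatives exist in L^2 because the
    remainder of the difference quotient has squared norm O(s^2). The factors sqrt(2 p_j) of [ubar]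
    give raising and lowering the same coefficient, and the shift E_l turns the flip of l_j into one
    step of the j-th ladder: this is why D keeps p fixed. Conversely each Hermite index q and sign
    vector l satisfy q = p + E_l for exactly one p, so no Hermite function is missed by the spaces
    U_p. The obstacle is that the bracket is given as linear on the left only. Even [x, 0] = 0,
    [x, c Z] = 0 and the linearity of r |-> [U_i, r V_j] have to be extracted from the existence of
    [T], before the action of V_j can be differentiated. *)

Section measure_preserving.
Context d1 d2 (X : measurableType d1) (Y : measurableType d2) (R : realType).
Variables (mu : {measure set X -> \bar R}) (nu : {measure set Y -> \bar R}).

Definition measure_preserving (phi : X -> Y) :=
  measurable_fun setT phi /\
  forall A, measurable A -> mu (phi @^-1` A) = nu A.

Variable phi : X -> Y.
Hypothesis mp : measure_preserving phi.

Lemma measure_preserving_ge0_integral (f : Y -> \bar R) :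
  measurable_fun setT f -> (forall y, 0 <= f y)%E ->
  (\int[nu]_y f y = \int[mu]_x f (phi x))%E.
Proof.
move=> mf f0; have [mphi eqmu] := mp.
have := @ge0_integral_pushforward _ _ X Y R phi mphi mu setT f measurableT mf.
move=> <-; last by move=> y _; exact: f0.
by apply: eq_measure_integral => A mA _; rewrite -eqmu.
Qed.

Lemma measure_preserving_integrable (f : Y -> R) :
  nu.-integrable setT (EFin \o f) -> mu.-integrable setT (EFin \o (f \o phi)).
Proof.
move=> /integrableP[mf fi]; have [mphi eqmu] := mp.
have m2 : measurable_fun setT (EFin \o (f \o phi)) by exact: measurableT_comp mf mphi.
apply/integrableP; split => //.
rewrite -(measure_preserving_ge0_integral (f := fun y => `|(f y)%:E|%E))//.
exact: measurableT_comp.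
Qed.

Lemma measure_preserving_integrableV (f : Y -> R) :
  measurable_fun setT f ->
  mu.-integrable setT (EFin \o (f \o phi)) -> nu.-integrable setT (EFin \o f).
Proof.
move=> mf /integrableP[_ fi].
have mEf : measurable_fun setT (EFin \o f) by exact/measurable_EFinP.
apply/integrableP; split => //.
rewrite (measure_preserving_ge0_integral (f := fun y => `|(f y)%:E|%E))//.
exact: measurableT_comp.
Qed.

Lemma measure_preserving_Rintegral (f : Y -> R) :
  nu.-integrable setT (EFin \o f) ->
  \int[mu]_x f (phi x) = \int[nu]_y f y.
Proof.
move=> fi; have [mphi eqmu] := mp; congr fine.
have mf := measurable_int _ fi.
rewrite -[LHS](@integral_pushforward _ _ X Y R phi mphi mu setT (EFin \o f) mf) //.
  by apply: eq_measure_integral => A mA _; rewrite -eqmu.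
exact: measure_preserving_integrable.
Qed.

End measure_preserving.

Lemma measure_preserving_negligible d (X : measurableType d) (R : realType)
    (mu : {measure set X -> \bar R}) (phi : X -> X) (P : X -> Prop) :
  measure_preserving mu mu phi ->
  {ae mu, forall x, P x} -> {ae mu, forall x, P (phi x)}.
Proof.
move=> [mphi eqmu] [N [mN N0 PN]]; exists (phi @^-1` N); split.
- by rewrite -[X in measurable X]setTI; exact: mphi.
- by rewrite eqmu.
- by move=> x /= nP; apply: PN.
Qed.

Section Rn.
Variable R : realType.
Local Notation leb := (@lebesgue_measure R).

(** Lebesgue measure is determined by its values on half-open intervals, and a translation moves
    such an interval without changing its length. *)
Lemma measure_preserving_translation (a : R) :
  @measure_preserving _ _ (measurableTypeR R) (measurableTypeR R) R leb leb
    (fun x => x + a).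
Proof.
have mf : measurable_fun [set: measurableTypeR R]
    (fun x : measurableTypeR R => x + a : measurableTypeR R).
  by apply: measurable_funD => //; exact: measurable_cst.
split=> // A mA; apply/esym.
have := @lebesgue_measure_unique R
  (measure_function_pushforward__canonical__measure_function_Measure leb mf).
move=> /(_ _ A mA); apply => _ [[b c] bc <-] /=.
rewrite /pushforward/=.
rewrite (_ : _ @^-1` _ = `](b - a), (c - a)]%classic); last first.
  by apply/seteqP; split=> x /=; rewrite !in_itv/= ltrBlDr lerBrDr.
rewrite !lebesgue_measure_itv/= !lte_fin ltrD2r.
by case: ifPn => // _; congr EFin; ring.
Qed.

(* An alias that can carry the sigma-finiteness of [lebesgueRn], whose body is a
   fixpoint. *)
Definition lebf n : set (Rn R n) -> \bar R := lebesgueRn R n.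
Arguments lebf : clear implicits.
HB.instance Definition _ n := Measure.on (lebf n).

Lemma tnth_consRn0 n (z : Rn R n * measurableTypeR R) : tnth (consRn z) ord0 = z.2.
Proof. by []. Qed.

Lemma tnth_consRnS n (z : Rn R n * measurableTypeR R) i :
  tnth (consRn z) (lift ord0 i) = tnth z.1 i.
Proof. by rewrite tnthS. Qed.

Lemma consRnE n (z : Rn R n * measurableTypeR R) (P : 'I_n.+1 -> R -> Prop) :
  (forall j, P j (tnth (consRn z) j)) <->
  (forall j, P (lift ord0 j) (tnth z.1 j)) /\ P ord0 z.2.
Proof.
split=> [h|[h1 h2] j].
  by split=> [j|]; [have := h (lift ord0 j); rewrite tnth_consRnS | exact: (h ord0)].
by have [k ->|-> //] := unliftP ord0 j; rewrite tnth_consRnS.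
Qed.

Lemma measurable_box n (r : R) :
  measurable [set t : Rn R n | forall j, tnth t j \in `[- r, r]].
Proof.
rewrite (_ : [set t | _] = \bigcap_(j in [set: 'I_n]) ((fun t : Rn R n => tnth t j) @^-1` `[- r,
  r]%classic)); last first.
  apply/seteqP; split=> t /= h j; first by move=> _; exact: (h j).
  exact: (h j I).
apply: fin_bigcap_measurable => // j _.
rewrite -[X in measurable X]setTI.
by apply: measurable_tnth => //; exact: measurable_itv.
Qed.

Lemma lebf_sigma_finite n : sigma_finite [set: Rn R n] (lebf n).
Proof.
pose F n (i : nat) : set (Rn R n) := [set t | forall j, tnth t j \in `[- i%:R, i%:R]].
exists (F n).
  apply/seteqP; split=> // t _.
  exists (Num.bound (\sum_j `|tnth t j|)) => //= j.
  rewrite in_itv/= -ler_norml (@le_trans _ _ (\sum_j `|tnth t j|))//.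
    by rewrite (bigD1 j)//= lerDl sumr_ge0.
  by apply/ltW/archi_boundP/sumr_ge0.
move=> i; split; first exact: measurable_box.
elim: n => [|n IH].
  by rewrite /lebf/= diracE ltry.
rewrite /lebf/= /pushforward.
rewrite (_ : _ @^-1` _ = F n i `*` `[- i%:R, i%:R]%classic).
  rewrite product_measure1E//; last exact: (@measurable_box n i%:R).
  rewrite lte_mul_pinfty//.
    by rewrite ge0_fin_numE.
  suff : (leb (`[- i%:R, i%:R]%classic)%R < +oo)%E by [].
  by rewrite lebesgue_measure_itv/=; case: ifP => // _; rewrite -EFinD ltry.
apply/seteqP; split => z /=.
  by move=> h; apply/(@consRnE n z (fun _ r => r \in `[- i%:R, i%:R])).
by move=> h; apply/(@consRnE n z (fun _ r => r \in `[- i%:R, i%:R])).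
Qed.

HB.instance Definition _ n := @Measure_isSigmaFinite.Build _ _ _ (lebf n) (lebf_sigma_finite n).

Lemma measure_preserving_consRn n :
  measure_preserving (lebf n \x leb)%E (lebf n.+1) (@consRn R n).
Proof. by split=> //; exact: measurable_consRn. Qed.

End Rn.

Section tensor_product.
Context d1 d2 (X : measurableType d1) (Y : measurableType d2) (R : realType).
Variables (m1 : {sigma_finite_measure set X -> \bar R}).
Variables (m2 : {sigma_finite_measure set Y -> \bar R}).
Variables (f : X -> R) (g : Y -> R).
Hypotheses (fi : m1.-integrable setT (EFin \o f)) (gi : m2.-integrable setT (EFin \o g)).

Let mfg : measurable_fun setT (fun z : X * Y => (f z.1 * g z.2)%:E).
Proof.
move: fi gi => /integrableP[/measurable_EFinP mf _] /integrableP[/measurable_EFinP mg _].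
apply/measurable_EFinP/measurable_funM.
  exact: measurableT_comp mf measurable_fst.
exact: measurableT_comp mg measurable_snd.
Qed.

Lemma integrable_tensor : (m1 \x m2)%E.-integrable setT (fun z => (f z.1 * g z.2)%:E).
Proof.
move: (fi) (gi) => /integrableP[mf fi'] /integrableP[mg gi'].
apply/(integrable12ltyP _ _ mfg) => /=.
under eq_integral.
  move=> x _.
  under eq_integral do rewrite normrM EFinM.
  rewrite ge0_integralZl//; last first.
    exact: (measurableT_comp (@abse_measurable R setT) mg).
  over.
rewrite ge0_integralZr//; last 2 first.
- exact: (measurableT_comp (@abse_measurable R setT) mf).
- exact: integral_ge0.
by rewrite lte_mul_pinfty//; [exact: integral_ge0|rewrite ge0_fin_numE//; exact: integral_ge0].
Qed.

Lemma Rintegral_tensor :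
  \int[(m1 \x m2)%E]_z (f z.1 * g z.2) = \int[m1]_x f x * \int[m2]_y g y.
Proof.
rewrite /Rintegral -(integral12_prod_meas1 integrable_tensor) /fubini_F/=.
under eq_integral.
  move=> x _.
  under eq_integral do rewrite EFinM.
  rewrite integralZl//.
  over.
rewrite -fineM; [|exact: integrable_fin_num..].
congr fine.
transitivity (\int[m1]_x ((f x)%:E * (fine (\int[m2]_y (g y)%:E))%:E))%E.
  by apply: eq_integral => x _; rewrite fineK//; exact: integrable_fin_num.
by rewrite integralZr// fineK//; exact: integrable_fin_num.
Qed.

End tensor_product.

Section Rn.
Variable R : realType.
Local Notation leb := (@lebesgue_measure R).

(** The fibre over [x] of the preimage of [A] is the fibre of [A] over [tau x], translated by
    [- psi x]; integrating over [x] and using the invariance under [tau] concludes. Translations of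
    R^n and right translations of the group are both of this form. *)
Lemma measure_preserving_shear n (tau : Rn R n -> Rn R n) (psi : Rn R n -> R)
    (phi : Rn R n.+1 -> Rn R n.+1) :
  measure_preserving (lebesgueRn R n) (lebesgueRn R n) tau ->
  measurable_fun setT (psi : Rn R n -> measurableTypeR R) -> measurable_fun setT phi ->
  (forall z, phi (consRn z) = consRn (tau z.1, z.2 + psi z.1)) ->
  measure_preserving (lebesgueRn R n.+1) (lebesgueRn R n.+1) phi.
Proof.
move=> mtau mpsi mphi phiE; split=> // A mA.
have mB : measurable (@consRn R n @^-1` A).
  by rewrite -[X in measurable X]setTI; exact: measurable_consRn.
rewrite /= /pushforward /product_measure1 /=.
transitivity (\int[@lebf R n]_x leb (xsection (@consRn R n @^-1` A) (tau x)))%E.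
  apply: eq_integral => x _.
  have <- := (@measure_preserving_translation R (psi x)).2 _ (measurable_xsection (tau x) mB).
  congr (leb _); apply/seteqP; split => z; rewrite /xsection/= !inE/= phiE//.
have := @measure_preserving_ge0_integral _ _ _ _ R (@lebf R n) (@lebf R n) tau mtau
  (fun x => leb (xsection (@consRn R n @^-1` A) x)).
move=> <- //.
exact: measurable_fun_xsection.
Qed.

Lemma measurable_Rn_map n (f : 'I_n -> R -> R) :
  (forall j, measurable_fun setT (f j : measurableTypeR R -> measurableTypeR R)) ->
  measurable_fun setT (fun t : Rn R n => [tuple f j (tnth t j) | j < n] : Rn R n).
Proof.
move=> mf; apply/measurable_fun_tnthP => j.
rewrite (_ : _ \o _ = fun t => f j (tnth t j)); last first.
  by apply/funext => t /=; rewrite tnth_mktuple.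
by apply: measurableT_comp (mf j) _; exact: measurable_tnth.
Qed.

Lemma measure_preserving_translationRn n (a : 'I_n -> R) :
  measure_preserving (lebesgueRn R n) (lebesgueRn R n)
    (fun t => [tuple tnth t j + a j | j < n]).
Proof.
elim: n a => [|n IH] a.
  split=> [|A mA]; first by apply/measurable_fun_tnthP => -[].
  by congr (lebesgueRn R 0 _); apply/seteqP; split=> t /=;
    rewrite (tuple0 t) (tuple0 [tuple _ | _ < _]).
apply: (@measure_preserving_shear n _ (fun=> a ord0) _ (IH (fun j => a (lift ord0 j)))) => //.
  apply: (measurable_Rn_map (f := fun j x => x + a j)) => j.
  by apply: measurable_funD => //; exact: measurable_cst.
move=> z; apply: eq_from_tnth => i; rewrite tnth_mktuple.
by have [k ->|->] := unliftP ord0 i; rewrite ?tnth_consRnS ?tnth_consRn0 ?tnth_mktuple.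
Qed.

(** Fubini, one coordinate at a time, along the recursive construction of the measure; dimension 0
    is a point mass with an empty product. *)
Lemma integrable_Rn_prod n (f : 'I_n -> R -> R) :
  (forall j, leb.-integrable setT (EFin \o f j)) ->
  (lebesgueRn R n).-integrable setT (fun t => (\prod_(j < n) f j (tnth t j))%:E) /\
  \int[lebesgueRn R n]_t (\prod_(j < n) f j (tnth t j)) = \prod_(j < n) \int[leb]_x f j x.
Proof.
elim: n f => [|n IH] f fi.
  have -> : (fun t : Rn R 0 => \prod_(j < 0) f j (tnth t j)) = fun=> 1.
    by apply/funext => t; rewrite big_ord0.
  rewrite big_ord0; split; last by rewrite /Rintegral integral_dirac//= indicE in_setT mulr1.
  rewrite (_ : (fun t => _%:E) = fun=> 1%E); last by apply/funext => t; rewrite big_ord0.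
  apply/integrableP; split; first exact: measurable_cst.
  by rewrite integral_dirac//= diracE in_setT mul1e normr1 ltry.
have [ip ep] := IH (fun j => f (lift ord0 j)) (fun j => fi (lift ord0 j)).
have it := @integrable_tensor _ _ _ _ R (@lebf R n) leb _ _ ip (fi ord0).
have fE : (fun t : Rn R n.+1 => \prod_(j < n.+1) f j (tnth t j)) \o @consRn R n =
    fun z => \prod_(j < n) f (lift ord0 j) (tnth z.1 j) * f ord0 z.2.
  apply/funext => z /=; rewrite big_ord_recl mulrC.
  by congr (_ * _); apply: eq_bigr => i _; rewrite tnth_consRnS.
have mP : measurable_fun setT (fun t : Rn R n.+1 => \prod_(j < n.+1) f j (tnth t j)).
  apply: measurable_prod => j _.
  have /integrableP[/measurable_EFinP mf _] := fi j.
  exact: measurableT_comp mf (@measurable_tnth _ _ _ j).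
have mp := @measure_preserving_consRn R n.
have ii : (lebesgueRn R n.+1).-integrable setT
    (EFin \o (fun t : Rn R n.+1 => \prod_(j < n.+1) f j (tnth t j))).
  by apply: (measure_preserving_integrableV mp mP); rewrite fE.
split => //.
rewrite -(measure_preserving_Rintegral mp ii).
rewrite (_ : Rintegral _ _ _ = \int[(@lebf R n \x leb)%E]_z (\prod_(j < n) f (lift ord0 j) (tnth
  z.1 j) * f ord0 z.2)).
  rewrite (@Rintegral_tensor _ _ _ _ R (@lebf R n) leb _ _ ip (fi ord0)) big_ord_recl [RHS]mulrC.
  by congr (_ * _); exact: ep.
by rewrite -fE.
Qed.

End Rn.

(** * Polynomial Gaussians and Hermite functions *)

Section gaussian_bounds.
Variable R : realType.
Local Notation leb := (@lebesgue_measure R).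
Implicit Types (f g : R -> R) (p q : {poly R}).

(** A class of multipliers of [gauss_bounded] functions, large enough for polynomials, bounded
    functions and the exponentials that appear when a Gaussian is translated. *)
Definition exp_bounded f :=
  measurable_fun [set: R] f /\ exists C c : R, forall t, `|f t| <= C * expR (c * `|t|).

Definition gauss_bounded f :=
  measurable_fun [set: R] f /\
  exists C k : R, 0 < k /\ forall t, `|f t| <= C * expR (- k * t ^+ 2).

Lemma exp_bounded_pos f : exp_bounded f ->
  exists C c : R, [/\ 0 <= C, 0 <= c & forall t, `|f t| <= C * expR (c * `|t|)].
Proof.
move=> [_ [C [c fC]]]; exists `|C|, `|c|; split => // t.
apply: (le_trans (fC t)); apply: (@le_trans _ _ (`|C| * expR (c * `|t|))).
  by rewrite ler_wpM2r ?expR_ge0// ler_norm.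
by rewrite ler_wpM2l// ler_expR ler_wpM2r// ler_norm.
Qed.

Lemma gauss_bounded_pos f : gauss_bounded f ->
  exists C k : R, [/\ 0 <= C, 0 < k & forall t, `|f t| <= C * expR (- k * t ^+ 2)].
Proof.
move=> [_ [C [k [k0 fC]]]]; exists C, k; split=> //.
by have := fC 0; rewrite expr0n/= mulr0 expR0 mulr1; apply: le_trans.
Qed.

Lemma exp_bounded_bounded f C :
  measurable_fun [set: R] f -> (forall t, `|f t| <= C) -> exp_bounded f.
Proof.
by move=> mf fC; split=> //; exists C, 0 => t; rewrite mul0r expR0 mulr1.
Qed.

Lemma exp_boundedM f g :
  exp_bounded f -> exp_bounded g -> exp_bounded (fun t => f t * g t).
Proof.
move=> ef eg; split; first by apply: measurable_funM; [exact: ef.1|exact: eg.1].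
have [C [c [C0 c0 fC]]] := exp_bounded_pos ef.
have [D [b [D0 b0 gD]]] := exp_bounded_pos eg.
exists (C * D), (c + b) => t.
by rewrite normrM mulrDl expRD mulrACA ler_pM.
Qed.

Lemma exp_boundedD f g :
  exp_bounded f -> exp_bounded g -> exp_bounded (fun t => f t + g t).
Proof.
move=> ef eg; split; first by apply: measurable_funD; [exact: ef.1|exact: eg.1].
have [C [c [C0 c0 fC]]] := exp_bounded_pos ef.
have [D [b [D0 b0 gD]]] := exp_bounded_pos eg.
exists (C + D), (c + b) => t.
rewrite (le_trans (ler_normD _ _))// [leRHS]mulrDl lerD//.
  by rewrite (le_trans (fC t))// ler_wpM2l// ler_expR ler_wpM2r// lerDl.
by rewrite (le_trans (gD t))// ler_wpM2l// ler_expR ler_wpM2r// lerDr.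
Qed.

Lemma exp_bounded_horner p : exp_bounded (horner p).
Proof.
elim/poly_ind: p => [|p c IH].
  apply: (@exp_bounded_bounded _ 0).
    rewrite (_ : horner 0 = cst 0); first exact: measurable_cst.
    by apply/funext => t; rewrite horner0.
  by move=> t; rewrite horner0 normr0.
have -> : horner (p * 'X + c%:P) = fun t => p.[t] * t + c.
  by apply/funext => t; rewrite hornerMXaddC.
apply: exp_boundedD; last by apply: (@exp_bounded_bounded _ `|c|) => //; exact: measurable_cst.
apply: exp_boundedM => //; split => //.
exists 1, 1 => t; rewrite !mul1r.
by apply: le_trans (expR_ge1Dx _); rewrite lerDr.
Qed.

Lemma exp_bounded_expR b : exp_bounded (fun t => expR (b * t)).
Proof.
split.
  by apply: measurableT_comp => //; exact: measurable_funM.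
exists 1, `|b| => t; rewrite mul1r ger0_norm ?expR_ge0// ler_expR.
by rewrite -normrM ler_norm.
Qed.

Lemma gauss_bounded_exp f g :
  exp_bounded f -> gauss_bounded g -> gauss_bounded (fun t => f t * g t).
Proof.
move=> ef eg; split; first by apply: measurable_funM; [exact: ef.1|exact: eg.1].
have [C [c [C0 c0 fC]]] := exp_bounded_pos ef.
have [D [k [D0 k0 gD]]] := gauss_bounded_pos eg.
(* Half of the Gaussian decay absorbs the exponential, at the cost of the maximum of
   [c x - k x^2 / 2], which is [c^2 / (2 k)]. *)
exists (C * D * expR (c ^+ 2 / (2 * k))), (k / 2); split; first by rewrite divr_gt0.
move=> t; rewrite normrM.
apply: (@le_trans _ _ ((C * expR (c * `|t|)) * (D * expR (- k * t ^+ 2)))).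
  exact: ler_pM.
rewrite mulrACA -[leRHS]mulrA ler_wpM2l ?mulr_ge0//.
rewrite -!expRD ler_expR -[t ^+ 2]real_normK ?num_real//.
rewrite -subr_ge0.
have -> : c ^+ 2 / (2 * k) + - (k / 2) * `|t| ^+ 2 - (c * `|t| + - k * `|t| ^+ 2)
   = (c - k * `|t|) ^+ 2 / (2 * k).
  by field; rewrite gt_eqF.
by rewrite divr_ge0 ?sqr_ge0// mulr_ge0// ltW.
Qed.

Lemma gauss_boundedM f g :
  gauss_bounded f -> gauss_bounded g -> gauss_bounded (fun t => f t * g t).
Proof.
move=> gf gg; apply: gauss_bounded_exp gg; split; first exact: gf.1.
have [C [k [C0 k0 fC]]] := gauss_bounded_pos gf.
exists C, 0 => t; rewrite (le_trans (fC t))// ler_wpM2l// ler_expR mul0r.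
by rewrite mulNr oppr_le0 mulr_ge0 ?sqr_ge0 ?ltW.
Qed.

Lemma gauss_boundedD f g :
  gauss_bounded f -> gauss_bounded g -> gauss_bounded (fun t => f t + g t).
Proof.
move=> ef eg; split; first by apply: measurable_funD; [exact: ef.1|exact: eg.1].
have [C [k [C0 k0 fC]]] := gauss_bounded_pos ef.
have [D [l [D0 l0 gD]]] := gauss_bounded_pos eg.
exists (C + D), (Num.min k l); split; first by rewrite lt_min k0.
move=> t; rewrite (le_trans (ler_normD _ _))// mulrDl lerD//.
  by rewrite (le_trans (fC t))// ler_wpM2l// ler_expR ler_wpM2r ?sqr_ge0// lerN2 ge_min lexx.
by rewrite (le_trans (gD t))// ler_wpM2l// ler_expR ler_wpM2r ?sqr_ge0// lerN2 ge_min lexx orbT.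
Qed.

Lemma gauss_boundedZ c f : gauss_bounded f -> gauss_bounded (fun t => c * f t).
Proof.
move=> gf; apply: (gauss_bounded_exp _ gf).
by apply: (@exp_bounded_bounded _ `|c|) => //; exact: measurable_cst.
Qed.

Lemma gauss_boundedB f g :
  gauss_bounded f -> gauss_bounded g -> gauss_bounded (fun t => f t - g t).
Proof.
move=> gf gg; under eq_fun do rewrite -mulN1r.
exact/(gauss_boundedD gf)/gauss_boundedZ.
Qed.

Lemma gauss_bounded_sqr f : gauss_bounded f -> gauss_bounded (fun t => f t ^+ 2).
Proof. by move=> gf; under eq_fun do rewrite expr2; exact: gauss_boundedM. Qed.

Lemma gauss_bounded_integrable f :
  gauss_bounded f -> leb.-integrable setT (EFin \o f).
Proof.
move=> gf; have [C [k [C0 k0 fC]]] := gauss_bounded_pos gf.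
(* The normal density of variance 1 / (2 k) is a multiple of exp(- k t^2). *)
pose s := Num.sqrt (2 * k)^-1.
have s2 : s ^+ 2 = (2 * k)^-1 by rewrite sqr_sqrtr// invr_ge0 mulr_ge0// ltW.
have s0 : s != 0.
  by rewrite -sqrf_eq0 s2 invr_eq0 mulf_neq0// gt_eqF.
have pk0 : 0 < normal_peak s by exact: normal_peak_gt0.
have := @integrable_normal_pdf R 0 s.
move=> /(integrableZl measurableT (C / normal_peak s)).
apply: le_integrable => //.
  by apply/measurable_EFinP; exact: gf.1.
move=> t _ /=; rewrite lee_fin; apply: (le_trans (fC t)).
rewrite normal_pdfE// -[X in `|_ * X|]/(normal_peak s * normal_fun 0 s t) /normal_fun subr0 s2.
have -> : - t ^+ 2 / ((2 * k)^-1 *+ 2) = - k * t ^+ 2 by field; rewrite gt_eqF.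
rewrite (_ : C / _ * _ = C * expR (- k * t ^+ 2)); last by field; rewrite gt_eqF.
exact: ler_norm.
Qed.

Lemma gauss_bounded_expR b : 0 < b -> gauss_bounded (fun t => expR (- (b * t ^+ 2 / 2))).
Proof.
move=> b0; split.
  apply: measurableT_comp => //; apply: measurableT_comp => //.
  by apply: measurable_funM => //; apply: measurable_funM => //; exact: measurable_funX.
exists 1, (b / 2); split; first by rewrite divr_gt0.
move=> t; rewrite mul1r ger0_norm ?expR_ge0// ler_expR.
by rewrite mulNr mulrAC.
Qed.

End gaussian_bounds.

Section polynomial_gaussians.
Variables (R : realType) (b : R).
Hypothesis b_gt0 : 0 < b.
Local Notation leb := (@lebesgue_measure R).
Implicit Types (p q : {poly R}) (f g : R -> R).

Definition pgauss p (t : R) : R := p.[t] * expR (- (b * t ^+ 2 / 2)).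

Lemma pgauss_bounded p : gauss_bounded (pgauss p).
Proof.
by apply: gauss_bounded_exp; [exact: exp_bounded_horner|exact: gauss_bounded_expR].
Qed.

Definition dpgauss p : {poly R} := p^`() - b *: ('X * p).

Lemma is_derive_pgauss p (t : R) : is_derive t 1 (pgauss p) (pgauss (dpgauss p) t).
Proof.
pose q : {poly R} := - ((b / 2) *: 'X^2).
have qE s : q.[s] = - (b * s ^+ 2 / 2) by rewrite hornerN hornerZ hornerXn mulrAC.
have -> : pgauss p = horner p * (expR \o horner q).
  by apply/funext => s; rewrite /pgauss -qE.
apply: is_derive_eq.
rewrite /pgauss /dpgauss -qE /= /q derivN derivZ derivXn.
rewrite !(hornerN, hornerD, hornerZ, hornerM, hornerX, hornerMn).
rewrite /GRing.scale/=.
by set u := expR _; field.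
Qed.

Lemma pgauss_continuous p : continuous (pgauss p).
Proof.
move=> t; apply: differentiable_continuous; apply/derivable1_diffP.
exact: (@ex_derive _ _ _ _ _ _ _ (is_derive_pgauss p t)).
Qed.

Lemma pgauss_MVT p (x y : R) :
  exists z, `|z - x| <= `|y - x| /\ pgauss p y - pgauss p x = pgauss (dpgauss p) z * (y - x).
Proof.
have cp := continuous_subspaceT (pgauss_continuous (p := p)).
have dp t := is_derive_pgauss p t.
case: (leP x y) => [|/ltW] xy.
  have [z] := MVT_segment xy (fun t _ => dp t) (cp _).
  rewrite in_itv/= => /andP[xz zy] e; exists z; split => //.
  by rewrite !ger0_norm ?subr_ge0// lerD2r.
have [z] := MVT_segment xy (fun t _ => dp t) (cp _).
rewrite in_itv/= => /andP[xz zy] e; exists z; split.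
  by rewrite !ler0_norm ?subr_le0// lerN2 lerD2r.
by rewrite -opprB e -mulrN opprB.
Qed.

(** Two applications of the mean value theorem bound the remainder by [|s|] times the second
    derivative at some [w] with [|w - t| <= 1]. The Gaussian bound at [w] gives one at [t], since
    [t^2 / 2 <= w^2 + 1]: hence the factor [expR k] and the halved exponent of the witness. *)
Lemma pgauss_diff_quotient p : exists2 M, gauss_bounded M &
  forall s t, s != 0 -> `|s| <= 1 ->
    `|(pgauss p (t + s) - pgauss p t) / s - pgauss (dpgauss p) t| <= `|s| * M t.
Proof.
have gb := pgauss_bounded (dpgauss (dpgauss p)).
have [C [k [C0 k0 fC]]] := gauss_bounded_pos gb.
exists (fun t => C * expR k * expR (- (k * t ^+ 2 / 2))).
  exact/gauss_boundedZ/gauss_bounded_expR.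
move=> s t s0 s1.
have [z []] := pgauss_MVT p t (t + s).
have -> : t + s - t = s by ring.
move=> zt ->; rewrite mulfK//.
have [w [wt ->]] := pgauss_MVT (dpgauss p) t z.
rewrite normrM mulrC ler_pM// (le_trans (fC w))// -mulrA ler_wpM2l//.
rewrite -expRD ler_expR.
have w1 : `|w - t| <= 1 by rewrite (le_trans wt)// (le_trans zt).
have w2 : (w - t) ^+ 2 <= 1 by rewrite -real_normK ?num_real// expr_le1.
suff : 0 <= k * (w ^+ 2 + 1 - t ^+ 2 / 2) by nra.
rewrite mulr_ge0//; first exact: ltW.
have := sqr_ge0 (w + w - t); nra.
Qed.

(** By translation invariance the difference quotients have integral 0, and they are within [s * M]
    of the derivative; letting [s] tend to 0 replaces the fundamental theorem of calculus on the
    whole line. *)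
Lemma integral_dpgauss p : \int[leb]_t pgauss (dpgauss p) t = 0.
Proof.
have [M gM HM] := pgauss_diff_quotient p.
have iM := gauss_bounded_integrable gM.
have ip := gauss_bounded_integrable (pgauss_bounded p).
have idp := gauss_bounded_integrable (pgauss_bounded (dpgauss p)).
pose I := \int[leb]_t M t.
suff H s : 0 < s -> s <= 1 -> `|\int[leb]_t pgauss (dpgauss p) t| <= s * I.
  apply/eqP; rewrite -normr_le0; apply/ler_addgt0Pr => e e0; rewrite add0r.
  have I0 : 0 < `|I| + 1 by rewrite ltr_wpDl.
  pose s := Num.min 1 (e / (`|I| + 1)).
  have s0 : 0 < s by rewrite lt_min ltr01 divr_gt0.
  apply: (le_trans (H s s0 _)); first by rewrite ge_min lexx.
  apply: (@le_trans _ _ (s * (`|I| + 1))).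
    by rewrite ler_wpM2l ?(ltW s0)// (le_trans (ler_norm _))// lerDl.
  by rewrite -ler_pdivlMr// ge_min lexx orbT.
move=> s0 s1.
have mp := @measure_preserving_translation R s.
have its := measure_preserving_integrable mp ip.
have iq : leb.-integrable setT (EFin \o (fun t => (pgauss p (t + s) - pgauss p t) / s)).
  have := integrableZr measurableT s^-1 (integrableB measurableT its ip).
  by apply: eq_integrable.
have e0 : \int[leb]_t ((pgauss p (t + s) - pgauss p t) / s) = 0.
  rewrite RintegralZr//; last exact: (integrableB measurableT its ip).
  rewrite RintegralB// (measure_preserving_Rintegral mp ip) subrr mul0r//.
rewrite -[\int[leb]_t _](subr0) -[X in _ - X]e0 -RintegralB//.
apply: (le_trans (le_normr_Rintegral _ _)) => //.
  exact: (integrableB measurableT idp iq).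
rewrite -RintegralZl//; apply: le_Rintegral => //.
- exact/integrable_norm/(integrableB measurableT idp iq).
- exact: (integrableZl measurableT s iM).
- move=> t _; rewrite distrC; have := HM s t; rewrite gtr0_norm//.
  by apply; [rewrite gt_eqF|].
Qed.

End polynomial_gaussians.

(** * Hermite polynomials: ladder relations, orthogonality, spanning *)

Section hermite_polynomials.
Variable R : realType.
Local Notation leb := (@lebesgue_measure R).

(** The physicists' Hermite polynomial up to the factor (-1)^n, no sign being put in front of the
    n-th derivative of exp(- t^2), which is [pgauss 2 1 t]. *)
Fixpoint hermite_poly (n : nat) : {poly R} :=
  if n is n'.+1 then dpgauss 2 (hermite_poly n') else 1.

(** Differentiating the recurrence gives the induction; for [n = 0] the truncated predecessor is
    multiplied by 0. *)
Lemma deriv_hermite_poly n :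
  (hermite_poly n)^`() = - (2 * n%:R) *: hermite_poly n.-1.
Proof.
have hS k : hermite_poly k.+1 = (hermite_poly k)^`() - 2%:R *: ('X * hermite_poly k) by [].
elim: n => [|n IH]; first by rewrite derivC mulr0 oppr0 scale0r.
rewrite hS derivB derivZ derivM derivX mul1r IH derivZ /=.
case: n IH => [|n] IH; first by rewrite !mulr0 !oppr0 !scale0r mulr0 addr0 sub0r scaleNr mulr1.
rewrite -scalerAr -!mul_polyC.
have -> : (hermite_poly n)^`() = hermite_poly n.+1 + 2%:R *: ('X * hermite_poly n).
  by rewrite hS subrK.
rewrite -mul_polyC !polyCN !polyCM /=.
have -> : (n.+2%:R : R)%:P = n.+1%:R%:P + 1 by rewrite -natr1 polyCD.
by ring.
Qed.

Lemma derive1n_gauss n (t : R) :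
  derive1n n (fun s : R => expR (- s ^+ 2)) t = pgauss 2 (hermite_poly n) t.
Proof.
elim: n t => [|n IH] t.
  by rewrite /pgauss hornerC mul1r [2 * _]mulrC mulfK.
rewrite derive1nS (_ : derive1n n _ = pgauss 2 (hermite_poly n)); last exact/funext.
by rewrite derive1E; exact: (@derive_val _ _ _ _ _ _ _ (is_derive_pgauss _ _ _)).
Qed.

Lemma hermiteE (n : nat) (t : R) : hermite n t = pgauss 1 (hermite_poly n) t.
Proof.
rewrite /hermite derive1n_gauss /pgauss mulrCA; congr (_ * _).
by rewrite -expRD; congr expR; field.
Qed.

Variable b : R.
Hypothesis b_gt0 : 0 < b.
Let c := Num.sqrt b.
Let c_gt0 : 0 < c. Proof. by rewrite sqrtr_gt0. Qed.
Let cc : c * c = b. Proof. by rewrite -expr2 sqr_sqrtr// ltW. Qed.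

Definition shermite n : {poly R} := hermite_poly n \Po (c *: 'X).

Lemma shermiteE n t : hermite (Posz n) (c * t) = pgauss b (shermite n) t.
Proof.
rewrite hermiteE /pgauss /shermite horner_comp hornerZ hornerX.
by rewrite exprMn mul1r [c ^+ 2]expr2 cc.
Qed.

Lemma deriv_shermite n : (shermite n)^`() = - (2 * n%:R * c) *: shermite n.-1.
Proof.
rewrite /shermite deriv_comp deriv_hermite_poly derivZ derivX comp_polyZ.
by rewrite -!mul_polyC !polyCN !polyCM; ring.
Qed.

Lemma shermiteS n : c *: shermite n.+1 = (shermite n)^`() - (2 * b) *: ('X * shermite n).
Proof.
rewrite /shermite /= /dpgauss linearB/= deriv_comp derivZ derivX comp_polyZ comp_polyM comp_polyX.
rewrite -!mul_polyC -cc !polyCM; ring.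
Qed.

(* The factor of [ubar] in one variable, [s] telling whether the sign is -1. *)
Definition hfactor n (s : bool) : {poly R} :=
  if s then Num.sqrt (2 * n%:R) *: shermite n.-1 else shermite n.

(** With r = sqrt(2 n), d/dt + b t sends h_n to - 2 n c h_(n-1) = - c r (r h_(n-1)), and d/dt - b t
    sends r h_(n-1) to c r h_n. The normalisation by r is what makes the two coefficients agree up
    to sign. If n = 0 then r = 0 and the truncated predecessor disappears from both formulas. *)
Lemma hfactor_ladder n s t :
  pgauss b (dpgauss b (hfactor n s)) t + (-1) ^+ s * (b * t) * pgauss b (hfactor n s) t =
  - (-1) ^+ s * (c * Num.sqrt (2 * n%:R)) * pgauss b (hfactor n (~~ s)) t.
Proof.
have n0 : 0 <= 2 * n%:R :> R by rewrite mulr_ge0.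
have rr := sqr_sqrtr n0; set r := Num.sqrt _ in rr *.
rewrite /pgauss /dpgauss; set E := expR _.
rewrite !(hornerD, hornerN, hornerZ, hornerM, hornerX).
case: s => /=; last first.
  rewrite deriv_shermite !hornerZ expr0.
  transitivity (- (r ^+ 2 * c) * (shermite n.-1).[t] * E); first by rewrite rr; ring.
  by rewrite -/r; ring.
rewrite -/r derivZ !hornerZ expr1.
case: n @r rr n0 => [|n] r rr n0.
  have r0 : r = 0 by rewrite /r mulr0 sqrtr0.
  by clear rr; rewrite r0; ring.
have := congr1 (horner^~ t) (shermiteS n).
rewrite !(hornerD, hornerN, hornerZ, hornerM, hornerX) /= => e.
transitivity (r * (c * (shermite n.+1).[t]) * E); first by rewrite e; ring.
by ring.
Qed.

Local Notation J m n := (\int[leb]_t (pgauss b (shermite m) t * pgauss b (shermite n) t)).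

Lemma pgaussM p q t : pgauss b p t * pgauss b q t = pgauss (2 * b) (p * q) t.
Proof.
by rewrite /pgauss hornerM mulrACA -expRD; congr (_ * expR _); field.
Qed.

Lemma integrable_pgaussM p q :
  leb.-integrable setT (EFin \o (fun t => pgauss b p t * pgauss b q t)).
Proof.
by apply/gauss_bounded_integrable/gauss_boundedM; exact: pgauss_bounded.
Qed.

(** The derivative of h_m h_n exp(- b t^2) has integral 0. Grouping the Gaussian with h_m turns it
    into c h_(m+1) h_n - 2 n c h_m h_(n-1), times the Gaussian. *)
Lemma shermite_integral_rec m n : J m.+1 n = 2 * n%:R * J m n.-1.
Proof.
have b2 : 0 < 2 * b by rewrite mulr_gt0.
have h0 := integral_dpgauss b2 (shermite m * shermite n).
apply/eqP; rewrite -subr_eq0 -(inj_eq (mulfI (lt0r_neq0 c_gt0))) mulr0 -h0.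
rewrite -RintegralZl//; last exact: integrable_pgaussM.
rewrite -RintegralB//; last 2 first.
- exact: integrable_pgaussM.
- exact: (integrableZl measurableT _ (integrable_pgaussM _ _)).
rewrite -RintegralZl//; last first.
  exact: (integrableB measurableT (integrable_pgaussM _ _) (integrableZl measurableT _
    (integrable_pgaussM _ _))).
apply/eqP; congr (Rintegral _ _ _); apply/funext => t.
rewrite !pgaussM /pgauss; set E := expR _; rewrite /dpgauss derivM (deriv_shermite n).
have := congr1 (horner^~ t) (shermiteS m).
rewrite !(hornerD, hornerN, hornerZ, hornerM, hornerX) /= => e.
transitivity (((c * (shermite m.+1).[t]) * (shermite n).[t] - 2 * n%:R * c * (shermite m).[t] *
  (shermite n.-1).[t]) * E); first by ring.
by rewrite e; ring.
Qed.

(** The recurrence lowers both indices until one of them is 0, and then its factor [n%:R]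
    vanishes. *)
Lemma shermite_orthogonal m n : m != n -> J m n = 0.
Proof.
have J0 k : J k.+1 0 = 0 by rewrite shermite_integral_rec mulr0 mul0r.
elim: m n => [|m IH] [|n]//.
  by move=> _; rewrite -[RHS](J0 n); congr (Rintegral _ _ _); apply/funext => t; rewrite mulrC.
by rewrite eqSS shermite_integral_rec => /IH ->; rewrite mulr0.
Qed.

(** The recurrence leads down to the integral of exp(- b t^2), which is read off the normal density
    of variance 1 / (2 b). *)
Lemma shermite_norm_gt0 n : 0 < J n n.
Proof.
elim: n => [|n IH]; last by rewrite shermite_integral_rec mulr_gt0// mulr_gt0.
pose s := Num.sqrt (2 * b)^-1.
have s2 : s ^+ 2 = (2 * b)^-1 by rewrite sqr_sqrtr// invr_ge0 mulr_ge0// ltW.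
have s0 : s != 0.
  by rewrite -sqrf_eq0 s2 invr_eq0 mulf_neq0// gt_eqF.
have pk0 : 0 < normal_peak s by exact: normal_peak_gt0.
have i1 : \int[leb]_t normal_pdf 0 s t = 1 by rewrite /Rintegral integral_normal_pdf.
have : normal_peak s * J 0 0 = 1.
  rewrite -RintegralZl//; last exact: integrable_pgaussM.
  rewrite -i1; congr (Rintegral _ _ _); apply/funext => t.
  rewrite normal_pdfE// -[RHS]/(normal_peak s * normal_fun 0 s t); congr (_ * _).
  rewrite pgaussM /pgauss /shermite comp_polyC mulr1 hornerC mul1r /normal_fun subr0 s2.
  by congr expR; field; rewrite gt_eqF.
by move=> h; rewrite -(pmulr_rgt0 _ pk0) h.
Qed.

(** The span is stable under multiplication by X: the raising relation expresses X h_n through h_n',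
    a multiple of h_(n-1), and h_(n+1). *)
Lemma hermite_span (q : {poly R}) :
  exists l : seq (R * nat), q = \sum_(x <- l) x.1 *: shermite x.2.
Proof.
elim/poly_ind: q => [|q a [l ->]]; first by exists [::]; rewrite big_nil.
have hX : exists l', (\sum_(x <- l) x.1 *: shermite x.2) * 'X = \sum_(x <- l') x.1 *: shermite
  x.2.
  elim: l => [|[u n] l [l' e]]; first by exists [::]; rewrite !big_nil mul0r.
  exists ((- (u * c / (2 * b)), n.+1) :: (- (u * (2 * n%:R * c) / (2 * b)), n.-1) :: l').
  rewrite !big_cons mulrDl e addrA; congr (_ + _).
  have e1 : 'X * shermite n = (2 * b)^-1 *: ((shermite n)^`() - c *: shermite n.+1).
    by rewrite shermiteS opprB addrC subrK scalerA mulVf ?scale1r// mulf_neq0// gt_eqF.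
  rewrite -scalerAl [_ * 'X]mulrC e1 deriv_shermite scalerBr !scalerA scalerBr !scalerA addrC.
  by rewrite -scaleNr /=; congr (_ *: _ + _ *: _); field; rewrite gt_eqF.
have [l' ->] := hX; exists ((a, 0) :: l').
by rewrite big_cons /= /shermite comp_polyC addrC -[a *: _]mul_polyC polyC1 mulr1.
Qed.

End hermite_polynomials.

(** * Closure in L^2 of the polynomial Gaussians of a fixed width *)

Section polynomial_gaussian_closure.
Variables (R : realType) (b : R).
Hypothesis b_gt0 : 0 < b.
Local Notation leb := (@lebesgue_measure R).
Implicit Types (p q : {poly R}) (f g : R -> R).

Definition sqint f : R := \int[leb]_t (f t ^+ 2).

Lemma integrable_sqr f :
  gauss_bounded f -> leb.-integrable setT (EFin \o (fun t => f t ^+ 2)).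
Proof. by move=> gf; exact/gauss_bounded_integrable/gauss_bounded_sqr. Qed.

Lemma sqintD f g : gauss_bounded f -> gauss_bounded g ->
  sqint (fun t => f t + g t) <= 2 * sqint f + 2 * sqint g.
Proof.
move=> gf gg; have i1 := integrable_sqr gf; have i2 := integrable_sqr gg.
have j1 := integrableZl measurableT 2 i1; have j2 := integrableZl measurableT 2 i2.
rewrite -!RintegralZl// -RintegralD//; apply: le_Rintegral => //.
- exact/integrable_sqr/gauss_boundedD.
- exact: (integrableD measurableT j1 j2).
- by move=> t _; have := sqr_ge0 (f t - g t); nra.
Qed.

Definition pgauss_approx f :=
  forall e, 0 < e -> exists q, sqint (fun t => f t - pgauss b q t) < e.

Lemma pgauss_approx_trans f : gauss_bounded f ->
  (forall e, 0 < e -> exists g,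
     [/\ gauss_bounded g, pgauss_approx g & sqint (fun t => f t - g t) < e]) ->
  pgauss_approx f.
Proof.
(* The quarter compensates for the factors 2 of [sqintD], which stands in for the triangle
   inequality. *)
move=> gf H e e0; have e4 : 0 < e / 4 by rewrite divr_gt0.
have [g [gg ag fg]] := H _ e4; have [q gq] := ag _ e4; exists q.
have -> : (fun t => f t - pgauss b q t) = fun t => (f t - g t) + (g t - pgauss b q t).
  by apply/funext => t; rewrite addrA subrK.
apply: (le_lt_trans (sqintD _ _)).
- exact: gauss_boundedB.
- exact/gauss_boundedB/pgauss_bounded.
- lra.
Qed.

Lemma pgauss_approxZ c f : gauss_bounded f -> pgauss_approx f -> pgauss_approx (fun t => c * f t).
Proof.
move=> gf af e e0.
have e1 : 0 < e / (c ^+ 2 + 1) by rewrite divr_gt0// ltr_wpDl ?sqr_ge0.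
have [q fq] := af _ e1; exists (c *: q).
have gq : gauss_bounded (fun t => f t - pgauss b q t) by exact/gauss_boundedB/pgauss_bounded.
have -> : sqint (fun t => c * f t - pgauss b (c *: q) t) = c ^+ 2 * sqint (fun t =>
  f t - pgauss b q t).
  rewrite -RintegralZl//; last exact: integrable_sqr.
  by congr (Rintegral _ _ _); apply/funext => t; rewrite /pgauss hornerZ; ring.
move: fq; rewrite ltr_pdivlMr ?ltr_wpDl ?sqr_ge0//.
have : 0 <= sqint (fun t => f t - pgauss b q t) by apply: Rintegral_ge0 => t _; exact: sqr_ge0.
nra.
Qed.

(** Multiplication by [phi] does not increase the L^2 norm, so [f] may be replaced by a polynomial
    Gaussian close to it. *)
Lemma pgauss_approx_mul (phi : R -> R) f :
  measurable_fun [set: R] phi -> (forall t, `|phi t| <= 1) ->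
  (forall q, pgauss_approx (fun t => phi t * pgauss b q t)) ->
  gauss_bounded f -> pgauss_approx f -> pgauss_approx (fun t => phi t * f t).
Proof.
move=> mphi phi1 aphi gf af.
have gphi g : gauss_bounded g -> gauss_bounded (fun t => phi t * g t).
  by move=> gg; apply: gauss_bounded_exp gg; exact: exp_bounded_bounded phi1.
apply: pgauss_approx_trans; first exact: gphi.
move=> e /af[q fq]; exists (fun t => phi t * pgauss b q t); split => //.
  exact/gphi/pgauss_bounded.
apply: le_lt_trans fq; apply: le_Rintegral => //.
- by apply/integrable_sqr/gauss_boundedB; [exact: gphi|exact/gphi/pgauss_bounded].
- exact/integrable_sqr/gauss_boundedB/pgauss_bounded.
- move=> t _; rewrite -mulrBr exprMn ler_piMl ?sqr_ge0//.
  by rewrite -real_normK ?num_real// expr_le1.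
Qed.

(* By dominated convergence: the partial sums of E are bounded by an exponential,
   which the Gaussian absorbs. *)
Lemma pgauss_approx_series (E : R -> R) (a : nat -> R) (k : R) q :
  measurable_fun [set: R] E ->
  (forall n, `|a n| <= n`!%:R^-1) ->
  (forall x, (series (fun n => a n * x ^+ n)) n @[n --> \oo] --> E x) ->
  pgauss_approx (fun t => E (k * t) * pgauss b q t).
Proof.
move=> mE ha cE.
pose S n : {poly R} := \sum_(0 <= i < n) (a i * k ^+ i) *: 'X^i.
have SE n t : (S n).[t] = series (fun n => a n * (k * t) ^+ n) n.
  rewrite horner_sum /series/=; apply: eq_bigr => i _.
  by rewrite hornerZ hornerXn exprMn mulrA.
have Sle n t : `|series (fun n => a n * t ^+ n) n| <= expR `|t|.
  apply: (@le_trans _ _ (series (exp_coeff `|t|) n)).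
    rewrite /series/= (le_trans (ler_norm_sum _ _ _))// ler_sum// => i _.
    by rewrite normrM normrX mulrC ler_wpM2l ?exprn_ge0//.
  apply: nondecreasing_cvgn_le; last exact: is_cvg_series_exp_coeff.
  by apply/nondecreasing_seqP => i; rewrite seriesSr lerDl exp_coeff_ge0.
have Ele t : `|E t| <= expR `|t|.
  have h : `|series (fun n => a n * t ^+ n) n| @[n --> \oo] --> `|E t| by exact: cvg_norm.
  rewrite -(cvg_lim (@Rhausdorff R) h).
  by apply: limr_le; [apply/cvg_ex; exists (`|E t|)|exact: nearW].
have eE : exp_bounded (fun t => E (k * t)).
  split; first by apply: measurableT_comp mE _; exact: measurable_funM.
  by exists 1, `|k| => t; rewrite mul1r -normrM.
have eS n : exp_bounded (fun t => series (fun n => a n * (k * t) ^+ n) n).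
  have -> : (fun t => series (fun n => a n * (k * t) ^+ n) n) = horner (S n).
    by apply/funext => t; rewrite SE.
  exact: exp_bounded_horner.
pose F n t := ((E (k * t) - series (fun n => a n * (k * t) ^+ n) n) * pgauss b q t) ^+ 2.
pose G t := (2 * expR (`|k * t|) * pgauss b q t) ^+ 2.
have gF n : gauss_bounded (F n).
  apply: gauss_bounded_sqr; apply: gauss_bounded_exp (pgauss_bounded b_gt0 q).
  under eq_fun do rewrite -mulN1r; apply: exp_boundedD => //.
  by apply: exp_boundedM => //; apply: (@exp_bounded_bounded _ _ 1) => [|t];
    [exact: measurable_cst|rewrite normrN1].
have gG : gauss_bounded G.
  apply: gauss_bounded_sqr; apply: gauss_bounded_exp (pgauss_bounded b_gt0 q).
  split.
    apply: measurable_funM => //; apply: measurableT_comp => //.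
    by apply: measurableT_comp => //; exact: measurable_funM.
  by exists 2, `|k| => t; rewrite ger0_norm ?mulr_ge0 ?expR_ge0// normrM.
have cF t : F n t @[n --> \oo] --> 0.
  have h : (E (k * t) - series (fun n => a n * (k * t) ^+ n) n) * pgauss b q t @[n --> \oo] --> 0.
    rewrite -[0](mul0r (pgauss b q t)) -[0 in X in _ --> X](subrr (E (k * t))).
    by apply: cvgM; [apply: cvgB; [exact: cvg_cst|exact: cE]|exact: cvg_cst].
  by have := cvgM h h; rewrite mulr0; exact.
have FG n t : `|F n t| <= G t.
  rewrite ger0_norm ?sqr_ge0// /F /G; set g := pgauss b q t.
  rewrite exprMn [leRHS]exprMn ler_wpM2r ?sqr_ge0// -[leLHS]real_normK ?num_real// lerXn2r
    ?nnegrE ?mulr_ge0 ?expR_ge0//.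
  rewrite (le_trans (ler_normB _ _))// mulr_natl mulr2n lerD//.
have := @dominated_convergence _ _ R leb setT measurableT (fun n =>
  EFin \o F n) (cst 0%E) (EFin \o G).
move=> /(_ _ _ _ (gauss_bounded_integrable gG)) [].
- by move=> n; apply/measurable_EFinP; exact: (gF n).1.
- exact: measurable_cst.
- by apply: aeW => t _; apply: cvg_EFin; [exact: nearW|exact: cF].
- by apply: aeW => t n _; rewrite lee_fin.
move=> _ _; rewrite integral0 => cI e e0.
have cI' : (fun n => sqint (fun t =>
  E (k * t) * pgauss b q t - pgauss b (q * S n) t)) @ \oo --> 0.
  rewrite (_ : (fun n => sqint _) = fine \o (fun n => (\int[leb]_x (EFin \o F n) x)%E)).
    exact: fine_cvg cI.
  apply/funext => n /=.
  congr fine; apply: eq_integral => t _.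
  by rewrite /F /pgauss hornerM SE; congr EFin; ring.
have [n Hn] := filter_ex (cvgr_lt 0 cI' e e0).
by exists (q * S n); exact: Hn.
Qed.

Lemma cos_coeff_le (n : nat) : `|(~~ odd n)%:R * (-1) ^+ n./2 * (n`!%:R)^-1 : R| <= n`!%:R^-1.
Proof.
rewrite !normrM normrX normrN1 expr1n mulr1 normfV !normr_nat.
by case: odd; rewrite /= ?mul0r ?mul1r// invr_ge0.
Qed.

Lemma sin_coeff_le (n : nat) : `|(odd n)%:R * (-1) ^+ n.-1./2 * (n`!%:R)^-1 : R| <= n`!%:R^-1.
Proof.
rewrite !normrM normrX normrN1 expr1n mulr1 normfV !normr_nat.
by case: odd; rewrite /= ?mul0r ?mul1r// invr_ge0.
Qed.

Lemma pgauss_approx_expR k q : pgauss_approx (fun t => expR (k * t) * pgauss b q t).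
Proof.
apply: (@pgauss_approx_series expR (fun n => n`!%:R^-1)) => [//|n|x].
  by rewrite ger0_norm ?invr_ge0.
have := @is_cvg_series_exp_coeff R x.
by rewrite /expR exp_coeffE.
Qed.

Lemma pgauss_approx_cos k q : pgauss_approx (fun t => cos (k * t) * pgauss b q t).
Proof.
apply: (@pgauss_approx_series cos (fun n => (~~ odd n)%:R * (-1) ^+ n./2 * (n`!%:R)^-1)) =>
  [|n|x].
- by apply: continuous_measurable_fun; exact: continuous_cos.
- exact: cos_coeff_le.
have := @is_cvg_series_cos_coeff R x; rewrite cos.unlock.
by rewrite cos_coeffE.
Qed.

Lemma pgauss_approx_sin k q : pgauss_approx (fun t => sin (k * t) * pgauss b q t).
Proof.
apply: (@pgauss_approx_series sin (fun n => (odd n)%:R * (-1) ^+ n.-1./2 * (n`!%:R)^-1)) =>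
  [|n|x].
- by apply: continuous_measurable_fun; exact: continuous_sin.
- exact: sin_coeff_le.
have := @is_cvg_series_sin_coeff R x; rewrite sin.unlock.
by rewrite sin_coeffE.
Qed.

(** Expanding (t + a)^2 shows that a translation keeps the width b of the Gaussian and only creates
    the exponential of - b a t. *)
Lemma pgauss_translation a q : exists c k p,
  forall t, pgauss b q (t + a) = c * (expR (k * t) * pgauss b p t).
Proof.
exists (expR (- (b * a ^+ 2 / 2))), (- (b * a)), (q \Po ('X + a%:P)) => t.
rewrite /pgauss horner_comp hornerD hornerX hornerC.
rewrite [expR (- (b * a) * t) * _]mulrCA [RHS]mulrCA -!expRD.
by congr (_ * expR _); field.
Qed.

Lemma gauss_bounded_translation a q : gauss_bounded (fun t => pgauss b q (t + a)).
Proof.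
have [c [k [p e]]] := pgauss_translation a q; rewrite (funext e).
by apply/gauss_boundedZ/gauss_bounded_exp; [exact: exp_bounded_expR|exact: pgauss_bounded].
Qed.

Lemma pgauss_approx_translation a q : pgauss_approx (fun t => pgauss b q (t + a)).
Proof.
have [c [k [p e]]] := pgauss_translation a q; rewrite (funext e).
apply: pgauss_approxZ; last exact: pgauss_approx_expR.
by apply: gauss_bounded_exp; [exact: exp_bounded_expR|exact: pgauss_bounded].
Qed.

(** These are the real and imaginary parts of what [pi_alpha] makes, in each variable, of a
    polynomial Gaussian: a translation followed by a modulation. *)
Lemma pgauss_approx_pi a k q :
  pgauss_approx (fun t => cos (k * t) * pgauss b q (t + a)) /\
  pgauss_approx (fun t => sin (k * t) * pgauss b q (t + a)).
Proof.
have mk : measurable_fun [set: R] (fun t => k * t) by exact: measurable_funM.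
split; apply: pgauss_approx_mul.
- by apply: measurableT_comp mk; apply: continuous_measurable_fun; exact: continuous_cos.
- by move=> t; rewrite ler_norml cos_geN1 cos_le1.
- exact: pgauss_approx_cos.
- exact: gauss_bounded_translation.
- exact: pgauss_approx_translation.
- by apply: measurableT_comp mk; apply: continuous_measurable_fun; exact: continuous_sin.
- by move=> t; rewrite ler_norml sin_geN1 sin_le1.
- exact: pgauss_approx_sin.
- exact: gauss_bounded_translation.
- exact: pgauss_approx_translation.
Qed.

End polynomial_gaussian_closure.

(* [measurableC] is also the measurability of complements. *)
Notation measurable_complex := Defs.measurableC (only parsing).

(** * Complex square-integrable functions *)

Section complex_L2.
Context (R : realType) d (T : measurableType d).
Variable mu : {measure set T -> \bar R}.
Local Notation C := R[i].
Local Open Scope complex_scope.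
Implicit Types (f g : T -> C) (z w : C).

Lemma sqmod_ge0 z : 0 <= sqmod z.
Proof. by rewrite addr_ge0 ?sqr_ge0. Qed.

Lemma sqmodM z w : sqmod (z * w) = sqmod z * sqmod w.
Proof. by case: z w => [a b] [x y]; rewrite /sqmod /=; ring. Qed.

Lemma sqmodD_le z w : sqmod (z + w) <= 2 * sqmod z + 2 * sqmod w.
Proof.
case: z w => [a b] [x y]; rewrite /sqmod /=.
have := sqr_ge0 (a - x); have := sqr_ge0 (b - y); nra.
Qed.

Lemma sqmod_real (x : R) : sqmod x%:C = x ^+ 2.
Proof. by rewrite /sqmod/= expr0n addr0. Qed.

Lemma sqmod_eq0 z : sqmod z = 0 -> z = 0.
Proof.
case: z => [a b]; rewrite /sqmod/= => /eqP.
by rewrite paddr_eq0 ?sqr_ge0// !sqrf_eq0 => /andP[/eqP -> /eqP ->].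
Qed.

Lemma Re_mulC_conj z w : complex.Re (z * w^*) = complex.Re z * complex.Re w + complex.Im z *
  complex.Im w.
Proof. by case: z w => [a b] [x y] /=; ring. Qed.

Lemma measurable_complexD f g : measurable_complex f -> measurable_complex g ->
  measurable_complex (fun x => f x + g x).
Proof.
move=> [f1 f2] [g1 g2]; split.
  rewrite (_ : (fun x => _) = fun x => complex.Re (f x) + complex.Re (g x));
    first exact: measurable_funD.
  by apply/funext => x; case: (f x) (g x) => [? ?] [].
rewrite (_ : (fun x => _) = fun x => complex.Im (f x) + complex.Im (g x));
  first exact: measurable_funD.
by apply/funext => x; case: (f x) (g x) => [? ?] [].
Qed.

Lemma measurable_complexM f g : measurable_complex f -> measurable_complex g ->
  measurable_complex (fun x => f x * g x).
Proof.
move=> [f1 f2] [g1 g2]; split.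
  rewrite (_ : (fun x => _) = fun x =>
    complex.Re (f x) * complex.Re (g x) - complex.Im (f x) * complex.Im (g x)).
    by apply: measurable_funB; exact: measurable_funM.
  by apply/funext => x; case: (f x) (g x) => [? ?] [].
rewrite (_ : (fun x => _) = fun x =>
  complex.Re (f x) * complex.Im (g x) + complex.Im (f x) * complex.Re (g x)).
  by apply: measurable_funD; exact: measurable_funM.
by apply/funext => x; case: (f x) (g x) => [? ?] [].
Qed.

Lemma measurable_complex_cst (c : C) : measurable_complex (fun _ : T => c).
Proof. by split; exact: measurable_cst. Qed.

Lemma measurable_complex_conj f : measurable_complex f -> measurable_complex (fun x => (f x)^*).
Proof.
move=> [f1 f2]; split.
  by rewrite (_ : (fun x => _) = fun x => complex.Re (f x))//; apply/funext => x; case: (f x).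
rewrite (_ : (fun x => _) = fun x => - complex.Im (f x)); first exact: measurable_funN.
by apply/funext => x; case: (f x).
Qed.

Lemma measurable_sqmod f : measurable_complex f -> measurable_fun setT (fun x => sqmod (f x)).
Proof. by move=> [f1 f2]; apply: measurable_funD; exact: measurable_funX. Qed.

(** For the measure [lebesgueRn R m] this is convertible to [L2Rm], the domain on which [T] is
    specified. *)
Definition L2C f := measurable_complex f /\ sq_integrable mu setT f.
Definition nrm2 f : R := \int[mu]_x sqmod (f x).

Lemma L2C_le f (g : T -> R) : measurable_complex f -> mu.-integrable setT (EFin \o g) ->
  (forall x, sqmod (f x) <= g x) -> L2C f.
Proof.
move=> mf ig fg; split=> //; apply: le_integrable ig => //.
  exact/measurable_EFinP/measurable_sqmod.
by move=> x _; rewrite /= lee_fin ger0_norm ?sqmod_ge0// (le_trans (fg x))// ler_norm.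
Qed.

Lemma nrm2_ge0 f : 0 <= nrm2 f.
Proof. by apply: Rintegral_ge0 => x _; exact: sqmod_ge0. Qed.

Lemma nrm2_0 : nrm2 (fun=> 0) = 0.
Proof.
rewrite /nrm2 (_ : (fun _ => _) = cst 0) ?Rintegral_cst ?mul0r//.
by apply/funext => t; rewrite sqmod_real expr0n.
Qed.

Lemma L2CD f g : L2C f -> L2C g -> L2C (fun x => f x + g x).
Proof.
move=> [mf i1] [mg i2].
have j1 := integrableZl measurableT 2 i1; have j2 := integrableZl measurableT 2 i2.
apply: (L2C_le _ (integrableD measurableT j1 j2)); first exact: measurable_complexD.
by move=> x; exact: sqmodD_le.
Qed.

Lemma L2CM (phi : T -> C) f (c : R) : measurable_complex phi -> (forall x, sqmod (phi x) <= c) ->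
  L2C f -> L2C (fun x => phi x * f x).
Proof.
move=> mphi pc [mf i1]; apply: (L2C_le _ (integrableZl measurableT c i1));
  first exact: measurable_complexM.
by move=> x; rewrite sqmodM ler_wpM2r// sqmod_ge0.
Qed.

Lemma L2CZ (c : C) f : L2C f -> L2C (fun x => c * f x).
Proof. by apply: (@L2CM (fun=> c) _ (sqmod c)) => //; exact: measurable_complex_cst. Qed.

Lemma L2C_0 : L2C (fun=> 0).
Proof.
have i0 : mu.-integrable setT (EFin \o (fun _ : T => 0 : R)) by exact: integrable0.
apply: (L2C_le (measurable_complex_cst 0) i0) => x.
by rewrite sqmod_real expr0n.
Qed.

Lemma L2C_sum I (r : seq I) (f_ : I -> T -> C) :
  (forall i, L2C (f_ i)) -> L2C (fun x => \sum_(i <- r) f_ i x).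
Proof.
move=> mf; elim: r => [|i r IH]; last by under eq_fun do rewrite big_cons; exact: L2CD.
by under eq_fun do rewrite big_nil; exact: L2C_0.
Qed.

(** A substitute for the triangle inequality that stays with squared norms. *)
Lemma nrm2D f g : L2C f -> L2C g -> nrm2 (fun x => f x + g x) <= 2 * nrm2 f + 2 * nrm2 g.
Proof.
move=> [mf i1] [mg i2].
have j1 := integrableZl measurableT 2 i1; have j2 := integrableZl measurableT 2 i2.
rewrite -!RintegralZl// -RintegralD//; apply: le_Rintegral => //.
- exact: (L2CD (conj mf i1) (conj mg i2)).2.
- exact: (integrableD measurableT j1 j2).
- by move=> x _; exact: sqmodD_le.
Qed.

Lemma nrm2Z (c : C) f : L2C f -> nrm2 (fun x => c * f x) = sqmod c * nrm2 f.
Proof.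
move=> [mf i1]; rewrite -RintegralZl//; congr (Rintegral _ _ _).
by apply/funext => x; rewrite sqmodM.
Qed.

Lemma Re_dotL2 (D : set T) f : complex.Re (dotL2 mu D f f) = \int[mu]_(x in D) sqmod (f x).
Proof.
congr (Rintegral _ _ _); apply/funext => x.
by rewrite Re_mulC_conj /sqmod !expr2.
Qed.

Lemma ae_eq_dotL2 (D : set T) f f' g g' : measurable D ->
  measurable_complex f -> measurable_complex f' -> measurable_complex g ->
    measurable_complex g' ->
  {ae mu, forall x, f x = f' x} -> {ae mu, forall x, g x = g' x} ->
  dotL2 mu D f g = dotL2 mu D f' g'.
Proof.
move=> mD mf mf' mg mg' ef eg.
have [m1 m2] := measurable_complexM mf (measurable_complex_conj mg).
have [m1' m2'] := measurable_complexM mf' (measurable_complex_conj mg').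
have efg : {ae mu, forall x, f x * (g x)^* = f' x * (g' x)^*}.
  by apply: filterS2 ef eg => x -> ->.
rewrite /dotL2 /integralC /Rintegral; congr (fine _ +i* fine _); apply: ae_eq_integral => //.
- exact/measurable_EFinP/measurable_funTS.
- exact/measurable_EFinP/measurable_funTS.
- by apply: filterS efg => x -> _.
- exact/measurable_EFinP/measurable_funTS.
- exact/measurable_EFinP/measurable_funTS.
- by apply: filterS efg => x -> _.
Qed.

End complex_L2.

(** * Products of functions of one variable *)

Section tensor_functions.
Variables (R : realType) (m : nat).
Local Notation C := R[i].
Local Notation leb := (@lebesgue_measure R).
Local Notation lebm := (lebesgueRn R m).
Local Open Scope complex_scope.
Implicit Types (f g : 'I_m -> R -> C).

Definition gauss_boundedC (u : R -> C) :=
  gauss_bounded (fun t => complex.Re (u t)) /\ gauss_bounded (fun t => complex.Im (u t)).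

Lemma gauss_boundedC_measurable u : gauss_boundedC u ->
  measurable_complex (u : measurableTypeR R -> C).
Proof. by move=> [u1 u2]; split; [exact: u1.1|exact: u2.1]. Qed.

Lemma gauss_boundedC_real (u : R -> R) : gauss_bounded u -> gauss_boundedC (fun t => (u t)%:C).
Proof.
move=> gu; split => //=; split; first exact: measurable_cst.
by exists 0, 1; split => // t; rewrite normr0 mul0r.
Qed.

Lemma gauss_boundedCD u v :
  gauss_boundedC u -> gauss_boundedC v -> gauss_boundedC (fun t => u t + v t).
Proof.
move=> [u1 u2] [v1 v2]; split.
  rewrite (_ : (fun t => _) = fun t => complex.Re (u t) + complex.Re (v t));
    first exact: gauss_boundedD.
  by apply/funext => t; case: (u t) (v t) => [? ?] [].
rewrite (_ : (fun t => _) = fun t => complex.Im (u t) + complex.Im (v t));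
  first exact: gauss_boundedD.
by apply/funext => t; case: (u t) (v t) => [? ?] [].
Qed.

Lemma gauss_boundedCZ (a : C) u : gauss_boundedC u -> gauss_boundedC (fun t => a * u t).
Proof.
case: a => a1 a2 [u1 u2]; split.
  rewrite (_ : (fun t => _) = fun t => a1 * complex.Re (u t) - a2 * complex.Im (u t)).
    by apply: gauss_boundedB; exact: gauss_boundedZ.
  by apply/funext => t; case: (u t).
rewrite (_ : (fun t => _) = fun t => a1 * complex.Im (u t) + a2 * complex.Re (u t)).
  by apply: gauss_boundedD; exact: gauss_boundedZ.
by apply/funext => t; case: (u t).
Qed.

Lemma gauss_boundedCB u v :
  gauss_boundedC u -> gauss_boundedC v -> gauss_boundedC (fun t => u t - v t).
Proof.
move=> gu gv; under eq_fun do rewrite -mulN1r.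
exact/(gauss_boundedCD gu)/gauss_boundedCZ.
Qed.

Lemma integrable_sqmod_gauss u : gauss_boundedC u ->
  leb.-integrable setT (EFin \o (fun t => sqmod (u t))).
Proof.
move=> [u1 u2]; apply: gauss_bounded_integrable.
by apply: gauss_boundedD; exact: gauss_bounded_sqr.
Qed.

Lemma nrm2_gauss u : gauss_boundedC u ->
  nrm2 leb u = sqint (fun t => complex.Re (u t)) + sqint (fun t => complex.Im (u t)).
Proof.
move=> [u1 u2]; rewrite -RintegralD//; exact: integrable_sqr.
Qed.

Definition tens f (t : Rn R m) : C := \prod_(j < m) f j (tnth t j).

Lemma sqmod_prod I (r : seq I) (F : I -> C) :
  sqmod (\prod_(i <- r) F i) = \prod_(i <- r) sqmod (F i).
Proof.
elim: r => [|i r IH]; last by rewrite !big_cons sqmodM IH.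
by rewrite !big_nil sqmod_real expr1n.
Qed.

Lemma measurable_complex_prod d (T : measurableType d) I (r : seq I) (f_ : I -> T -> C) :
  (forall i, measurable_complex (f_ i)) -> measurable_complex (fun x => \prod_(i <- r) f_ i x).
Proof.
move=> mf; elim: r => [|i r IH]; first by under eq_fun do rewrite big_nil;
  exact: measurable_complex_cst.
by under eq_fun do rewrite big_cons; exact: measurable_complexM.
Qed.

Lemma measurable_complex_comp d1 d2 (T1 : measurableType d1) (T2 : measurableType d2)
    (u : T2 -> C) (phi : T1 -> T2) :
  measurable_fun setT phi -> measurable_complex u -> measurable_complex (u \o phi).
Proof. by move=> mphi [u1 u2]; split;
  [exact: measurableT_comp u1 mphi|exact: measurableT_comp u2 mphi]. Qed.

Lemma tens_L2 f : (forall j, gauss_boundedC (f j)) ->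
  L2C lebm (tens f) /\ nrm2 lebm (tens f) = \prod_(j < m) nrm2 leb (f j).
Proof.
move=> gf.
have [ip ep] := integrable_Rn_prod (fun j => integrable_sqmod_gauss (gf j)).
have e : (fun t => sqmod (tens f t)) = fun t => \prod_(j < m) sqmod (f j (tnth t j)).
  by apply/funext => t; rewrite sqmod_prod.
split; last by rewrite -ep -e.
split.
  apply: measurable_complex_prod => j.
  exact: (measurable_complex_comp (@measurable_tnth _ _ _ j) (gauss_boundedC_measurable (gf j))).
by rewrite /sq_integrable -/(EFin \o (fun t => sqmod (tens f t))) e.
Qed.

Definition repl f (j : 'I_m) (u : R -> C) : 'I_m -> R -> C := fun i => if i == j then u else f i.

Lemma replE f j : repl f j (f j) = f.
Proof. by apply/funext => i; rewrite /repl; case: eqP => [->|]. Qed.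

Lemma tens_repl f j u t :
  tens (repl f j u) t = u (tnth t j) * \prod_(i < m | i != j) f i (tnth t i).
Proof.
rewrite /tens (bigD1 j)//= /repl eqxx; congr (_ * _).
by apply: eq_bigr => i /negbTE ->.
Qed.

Lemma tens_replD f j u v t :
  tens (repl f j (fun s => u s + v s)) t = tens (repl f j u) t + tens (repl f j v) t.
Proof. by rewrite !tens_repl mulrDl. Qed.

Lemma tens_replZ f j a u t :
  tens (repl f j (fun s => a * u s)) t = a * tens (repl f j u) t.
Proof. by rewrite !tens_repl mulrA. Qed.

Lemma gauss_repl f j u : (forall i, gauss_boundedC (f i)) -> gauss_boundedC u ->
  forall i, gauss_boundedC (repl f j u i).
Proof. by move=> gf gu i; rewrite /repl; case: ifP. Qed.

(** Carries one-variable estimates to R^m: the constant comes from the norms of the other factors,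
    with 1 added to keep it positive when one of them vanishes. *)
Lemma nrm2_tens_repl f j : (forall i, gauss_boundedC (f i)) ->
  exists2 K, 0 < K & forall u, gauss_boundedC u ->
    nrm2 lebm (tens (repl f j u)) <= K * nrm2 leb u.
Proof.
move=> gf; pose K := \prod_(i < m | i != j) nrm2 leb (f i).
exists (K + 1); first by rewrite ltr_wpDl// prodr_ge0// => i _; exact: nrm2_ge0.
move=> u gu; rewrite (tens_L2 (gauss_repl j gf gu)).2 (bigD1 j)//= /repl eqxx mulrC.
rewrite ler_wpM2r ?nrm2_ge0// (_ : \prod_(i < m | _) _ = K) ?lerDl//.
by apply: eq_bigr => i /negbTE ->.
Qed.

End tensor_functions.

(** * Closure in L^2(R^m) of the span of the Hermite functions *)

Section hermite_closure.
Variables (R : realType) (m : nat) (b : 'I_m -> R).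
Hypothesis b_gt0 : forall j, 0 < b j.
Local Notation C := R[i].
Local Notation leb := (@lebesgue_measure R).
Local Notation lebm := (lebesgueRn R m).
Local Open Scope complex_scope.
Implicit Types (F G : Rn R m -> C).

Definition hfun (q : {ffun 'I_m -> nat}) : Rn R m -> C :=
  tens (fun j t => (pgauss (b j) (shermite (b j) (q j)) t)%:C).

Lemma gauss_pgaussC (c : R) p : 0 < c -> gauss_boundedC (fun t => (pgauss c p t)%:C).
Proof. by move=> c0; exact/gauss_boundedC_real/pgauss_bounded. Qed.

Lemma hfun_L2 q : L2C lebm (hfun q).
Proof. by apply: (tens_L2 _).1 => j; exact: gauss_pgaussC. Qed.

Definition hcomb (s : seq (C * {ffun 'I_m -> nat})) : Rn R m -> C :=
  fun t => \sum_(x <- s) x.1 * hfun x.2 t.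

Lemma hcomb_L2 s : L2C lebm (hcomb s).
Proof. by apply: L2C_sum => x; exact/L2CZ/hfun_L2. Qed.

Lemma hcomb_cat s1 s2 t : hcomb (s1 ++ s2) t = hcomb s1 t + hcomb s2 t.
Proof. by rewrite /hcomb big_cat. Qed.

Lemma hcombZ c s t : hcomb [seq (c * x.1, x.2) | x <- s] t = c * hcomb s t.
Proof. by rewrite /hcomb big_map mulr_sumr; apply: eq_bigr => x _; rewrite mulrA. Qed.

Definition happrox F :=
  forall e : R, 0 < e -> exists s, nrm2 lebm (fun t => F t - hcomb s t) < e.

Lemma L2CB F G : L2C lebm F -> L2C lebm G -> L2C lebm (fun t => F t - G t).
Proof.
by move=> lF lG; under eq_fun do rewrite -mulN1r; apply: L2CD => //; exact: L2CZ.
Qed.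

Lemma happroxD F G : L2C lebm F -> L2C lebm G ->
  happrox F -> happrox G -> happrox (fun t => F t + G t).
Proof.
move=> lF lG aF aG e e0; have e4 : 0 < e / 4 by rewrite divr_gt0.
have [s1 h1] := aF _ e4; have [s2 h2] := aG _ e4; exists (s1 ++ s2).
have -> : (fun t => F t + G t - hcomb (s1 ++ s2) t) =
    fun t => (F t - hcomb s1 t) + (G t - hcomb s2 t).
  by apply/funext => t; rewrite hcomb_cat; ring.
have := nrm2D (L2CB lF (hcomb_L2 s1)) (L2CB lG (hcomb_L2 s2)); lra.
Qed.

Lemma happroxZ c F : L2C lebm F -> happrox F -> happrox (fun t => c * F t).
Proof.
move=> lF aF e e0.
have c1 : 0 < sqmod c + 1 by rewrite ltr_wpDl ?sqmod_ge0.
have [s hs] := aF (e / (sqmod c + 1)) (divr_gt0 e0 c1).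
exists [seq (c * x.1, x.2) | x <- s].
have -> : (fun t => c * F t - hcomb [seq (c * x.1, x.2) | x <- s] t) =
    fun t => c * (F t - hcomb s t).
  by apply/funext => t; rewrite hcombZ mulrBr.
rewrite nrm2Z; last exact: L2CB (hcomb_L2 s).
move: hs; rewrite ltr_pdivlMr//; apply: le_lt_trans.
by rewrite mulrC ler_wpM2l ?nrm2_ge0// lerDl.
Qed.

Lemma happrox_sum I (r : seq I) (F_ : I -> Rn R m -> C) :
  (forall i, L2C lebm (F_ i)) -> (forall i, happrox (F_ i)) ->
  happrox (fun t => \sum_(i <- r) F_ i t).
Proof.
move=> lF aF; elim: r => [|i r IH].
  move=> e e0; exists [::]; under eq_fun do rewrite big_nil /hcomb big_nil subr0.
  by rewrite nrm2_0.
under eq_fun do rewrite big_cons.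
by apply: happroxD => //; exact: L2C_sum.
Qed.

Lemma happrox_trans F : L2C lebm F ->
  (forall e : R, 0 < e -> exists G, [/\ L2C lebm G, happrox G & nrm2 lebm (fun t =>
    F t - G t) < e]) ->
  happrox F.
Proof.
move=> lF H e e0; have e4 : 0 < e / 4 by rewrite divr_gt0.
have [G [lG aG FG]] := H _ e4; have [s Gs] := aG _ e4; exists s.
have -> : (fun t => F t - hcomb s t) = fun t => (F t - G t) + (G t - hcomb s t).
  by apply/funext => t; rewrite addrA subrK.
have := nrm2D (L2CB lF lG) (L2CB lG (hcomb_L2 s)); lra.
Qed.

Definition pgauss_approxC (c : R) (u : R -> C) :=
  [/\ gauss_boundedC u, pgauss_approx c (fun t => complex.Re (u t)) &
      pgauss_approx c (fun t => complex.Im (u t))].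

(** The factors are replaced by Hermite functions one at a time: the induction is on the number [n]
    of leading factors that are still arbitrary, the others being exactly Hermite functions. *)
Lemma happrox_tens (f : 'I_m -> R -> C) :
  (forall j, pgauss_approxC (b j) (f j)) -> happrox (tens f).
Proof.
move=> af.
suff H n : forall f : 'I_m -> R -> C, (forall j : 'I_m, (j < n)%N ->
  pgauss_approxC (b j) (f j)) ->
    (forall j : 'I_m, (n <= j)%N -> exists k, f j = fun t =>
      (pgauss (b j) (shermite (b j) k) t)%:C) ->
    happrox (tens f).
  by apply: (H m) => // j; rewrite leqNgt ltn_ord.
elim: n {f af} => [|n IH] f af hf.
  have [k fk] := choice (fun j => hf j (leq0n _)).
  have -> : tens f = hfun [ffun j => k j].
    by rewrite /hfun; congr tens; apply/funext => j; rewrite fk ffunE.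
  move=> e e0; exists [:: (1, [ffun j => k j])].
  have -> : (fun t => hfun [ffun j => k j] t - hcomb [:: (1, [ffun j => k j])] t) = fun=> 0.
    by apply/funext => t; rewrite /hcomb big_seq1 mul1r subrr.
  by rewrite nrm2_0.
(* Past the last variable there is no factor of index [n] to replace. *)
case: (ltnP n m) => [nm|mn]; last first.
  by apply: IH => j jn; [exact/af/ltnW|have := leq_trans mn jn; rewrite leqNgt ltn_ord].
pose j0 : 'I_m := Ordinal nm.
have gf i : gauss_boundedC (f i).
  case: (ltnP i n.+1) => ni; first by have [] := af i ni.
  by have [k ->] := hf i ni; exact: gauss_pgaussC.
have step1 k : happrox (tens (repl f j0 (fun t => (pgauss (b j0) (shermite (b j0) k) t)%:C))).
  apply: IH => i ni; rewrite /repl.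
    by rewrite -val_eqE/= ltn_eqF//; apply: af; exact: ltnW.
  case: eqP => [->|/eqP ij]; first by exists k.
  by apply: hf; rewrite ltn_neqAle ni andbT eq_sym.
(* The product is linear in its factor of index [j0], so Hermite functions there give all polynomial
   Gaussians there. *)
have step2 q : happrox (tens (repl f j0 (fun t => (pgauss (b j0) q t)%:C))).
  have [l ->] := hermite_span (b_gt0 j0) q.
  have -> : tens (repl f j0 (fun t =>
    (pgauss (b j0) (\sum_(x <- l) x.1 *: shermite (b j0) x.2) t)%:C)) =
     fun t => \sum_(x <- l) (x.1)%:C * tens (repl f j0 (fun t =>
       (pgauss (b j0) (shermite (b j0) x.2) t)%:C)) t.
    apply/funext => t; elim: l => [|x l IHl].
      by rewrite !big_nil tens_repl /pgauss horner0 mul0r mul0r.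
    rewrite !big_cons -IHl -tens_replZ -tens_replD; congr (tens (repl _ _ _) _).
    by apply/funext => s; rewrite /pgauss hornerD hornerZ mulrDl -mulrA rmorphD rmorphM.
  have lF k : L2C lebm (tens (repl f j0 (fun t => (pgauss (b j0) (shermite (b j0) k) t)%:C))).
    exact/(tens_L2 _).1/gauss_repl/gauss_pgaussC.
  by apply: happrox_sum => x; [exact: L2CZ|exact: happroxZ].
have [gj a1 a2] := af j0 (ltnSn n).
rewrite -(replE f j0); apply: happrox_trans.
  exact/(tens_L2 _).1/gauss_repl.
move=> e e0; have [K K0 HK] := nrm2_tens_repl j0 gf.
(* The real and imaginary parts of the factor are approximated separately; each contributes at most
   half of [e] once multiplied by [K]. *)
have e2 : 0 < e / (2 * K) by rewrite divr_gt0// mulr_gt0.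
have [q1 h1] := a1 _ e2; have [q2 h2] := a2 _ e2.
pose u1 t : C := (pgauss (b j0) q1 t)%:C; pose u2 t : C := (pgauss (b j0) q2 t)%:C.
have gu1 : gauss_boundedC u1 by exact: gauss_pgaussC.
have gu2 : gauss_boundedC u2 by exact: gauss_pgaussC.
have l1 : L2C lebm (tens (repl f j0 u1)) by exact/(tens_L2 _).1/gauss_repl.
have l2 : L2C lebm (tens (repl f j0 u2)) by exact/(tens_L2 _).1/gauss_repl.
pose u t := u1 t + 'i%C * u2 t.
have gu : gauss_boundedC u by apply: gauss_boundedCD => //; exact: gauss_boundedCZ.
exists (tens (repl f j0 u)); split.
- exact/(tens_L2 _).1/gauss_repl.
- have -> : tens (repl f j0 u) = fun t => tens (repl f j0 u1) t + 'i%C * tens (repl f j0 u2) t.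
    by apply/funext => t; rewrite tens_replD tens_replZ.
  by apply: happroxD => //; [exact: L2CZ|exact: step2|apply: happroxZ => //; exact: step2].
have -> : (fun t => tens (repl f j0 (f j0)) t - tens (repl f j0 u) t) =
    tens (repl f j0 (fun t => f j0 t - u t)).
  by apply/funext => t; rewrite !tens_repl mulrBl.
apply: le_lt_trans (HK _ _) _; first exact: gauss_boundedCB.
rewrite nrm2_gauss; last exact: gauss_boundedCB.
have -> : (fun t => complex.Re (f j0 t - u t)) = fun t =>
  complex.Re (f j0 t) - pgauss (b j0) q1 t.
  by apply/funext => t; rewrite /u; case: (f j0 t) => x y /=; ring.
have -> : (fun t => complex.Im (f j0 t - u t)) = fun t =>
  complex.Im (f j0 t) - pgauss (b j0) q2 t.
  by apply/funext => t; rewrite /u; case: (f j0 t) => x y /=; ring.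
have -> : e = K * (e / (2 * K) + e / (2 * K)) by field; rewrite gt_eqF.
by rewrite ltr_pM2l// ltrD.
Qed.

End hermite_closure.

(** * The representation pi_alpha *)

Section expi.
Variable R : realType.
Local Open Scope complex_scope.
Implicit Types x y : R.

Lemma expiD x y : expi (x + y) = expi x * expi y.
Proof. by rewrite /expi cosD sinD; apply/eqP; rewrite eq_complex/= eqxx addrC eqxx. Qed.

Lemma expi0 : expi 0 = 1 :> R[i].
Proof. by rewrite /expi cos0 sin0. Qed.

Lemma expi_sum I (r : seq I) (f : I -> R) : expi (\sum_(i <- r) f i) = \prod_(i <- r) expi (f i).
Proof. by elim: r => [|i r IH]; rewrite ?big_nil ?expi0// !big_cons expiD IH. Qed.

Lemma sqmod_expi x : sqmod (expi x) = 1.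
Proof. by rewrite /sqmod/= cos2Dsin2. Qed.

Lemma measurable_expi d (T : measurableType d) (f : T -> R) :
  measurable_fun setT f -> measurable_complex (fun t => expi (f t)).
Proof.
move=> mf; split => /=.
  by apply: measurableT_comp mf; apply: continuous_measurable_fun; exact: continuous_cos.
by apply: measurableT_comp mf; apply: continuous_measurable_fun; exact: continuous_sin.
Qed.

Lemma increment_le (f df : R -> R) (M x : R) : f 0 = 0 ->
  (forall y, is_derive y 1 f (df y)) -> (forall y, `|y| <= `|x| -> `|df y| <= M) ->
  `|f x| <= M * `|x|.
Proof.
move=> f0 dfE dfM.
have cf : continuous f.
  move=> y; apply: differentiable_continuous; apply/derivable1_diffP.
  exact: (@ex_derive _ _ _ _ _ _ _ (dfE y)).
have cs := continuous_subspaceT cf.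
case: (leP 0 x) => [|/ltW] x0.
  have [z] := MVT_segment x0 (fun t _ => dfE t) (cs _).
  rewrite in_itv/= f0 !subr0 => /andP[z0 zx] ->; rewrite normrM ler_wpM2r// dfM// !ger0_norm//.
have [z] := MVT_segment x0 (fun t _ => dfE t) (cs _).
rewrite in_itv/= f0 !sub0r => /andP[xz z0]; rewrite mulrN => /eqP; rewrite eqr_opp => /eqP ->.
by rewrite normrM ler_wpM2r// dfM// !ler0_norm// lerN2.
Qed.

Lemma norm_sin_le x : `|sin x| <= `|x|.
Proof.
rewrite -[leRHS]mul1r; apply: (@increment_le sin cos) => [|y _]; first exact: sin0.
by rewrite ler_norml cos_geN1 cos_le1.
Qed.

Lemma norm_cosB1_le x : `|cos x - 1| <= x ^+ 2.
Proof.
rewrite -real_normK ?num_real// expr2.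
apply: (@increment_le (fun x => cos x - 1) (fun y => - sin y)) => [|y|y yx].
- by rewrite cos0 subrr.
- by apply: is_derive_eq; rewrite subr0.
- by rewrite normrN (le_trans (norm_sin_le y)).
Qed.

Lemma norm_cosB1_le1 x : `|cos x - 1| <= `|x|.
Proof.
rewrite -[leRHS]mul1r.
apply: (@increment_le (fun x => cos x - 1) (fun y => - sin y)) => [|y|y yx].
- by rewrite cos0 subrr.
- by apply: is_derive_eq; rewrite subr0.
- by rewrite normrN ler_norml sin_geN1 sin_le1.
Qed.

Lemma norm_sinB_le x : `|sin x - x| <= x ^+ 2.
Proof.
rewrite -real_normK ?num_real// expr2.
apply: (@increment_le (fun x => sin x - x) (fun y => cos y - 1)) => [|y yx].
- by rewrite sin0 subr0.
- by rewrite (le_trans (norm_cosB1_le1 y)).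
Qed.

(** The real and imaginary parts are (cos(s x) - 1) / s and (sin(s x) - s x) / s, and both
    numerators are at most (s x)^2 in absolute value. *)
Lemma sqmod_expi_quotient s x : s != 0 ->
  sqmod ((expi (s * x) - 1) / s%:C - 'i%C * x%:C) <= s ^+ 2 * (2 * x ^+ 4).
Proof.
move=> s0.
have -> : (expi (s * x) - 1) / s%:C - 'i%C * x%:C = ((cos (s * x) - 1) / s) +i* ((sin (s * x) - s
  * x) / s).
  rewrite -[s%:C^-1]fmorphV; apply/eqP; rewrite eq_complex /=; apply/andP; split; apply/eqP;
    field => //.
rewrite /sqmod /= !exprMn.
have h (z : R) : `|z| <= (s * x) ^+ 2 -> z ^+ 2 * s^-1 ^+ 2 <= s ^+ 2 * x ^+ 4.
  move=> hz; rewrite exprVn ler_pdivrMr ?exprn_even_gt0//.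
  have -> : s ^+ 2 * x ^+ 4 * s ^+ 2 = ((s * x) ^+ 2) ^+ 2 by ring.
  by rewrite -real_normK ?num_real// lerXn2r ?nnegrE ?sqr_ge0.
have := h _ (norm_cosB1_le (s * x)); have := h _ (norm_sinB_le (s * x)); nra.
Qed.

Lemma expi_injZ x y : (forall r, expi (r * x) = expi (r * y)) -> x = y.
Proof.
move=> h; apply/eqP; rewrite -subr_eq0; apply/negPn/negP => xy0.
(* For this [r] the two arguments differ by pi, which would make the two values opposite. *)
have := h (pi / (x - y)).
have -> : pi / (x - y) * x = pi + pi / (x - y) * y by field.
rewrite expiD => e.
have : expi (- (pi / (x - y) * y)) * (expi pi * expi (pi / (x - y) * y)) = 1.
  by rewrite e -expiD addNr expi0.
rewrite mulrCA -expiD addNr expi0 mulr1 /expi cospi => /(congr1 (@complex.Re R)) /= /eqP.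
by rewrite -subr_eq0 -opprD oppr_eq0 -[1 + 1]/(2%:R) pnatr_eq0.
Qed.

Lemma expi_pi_small x : `|x| < 1 -> expi (pi * x) = 1 -> x = 0.
Proof.
move=> x1 /(congr1 (@complex.Im R)) /= sx.
have pos (z : R) : 0 < z -> z < 1 -> 0 < sin (pi * z).
  by move=> z0 z1; rewrite sin_gt0_pi// mulr_gt0 ?pi_gt0//= gtr_pMr ?pi_gt0.
case: (ltgtP x 0) => // x0.
  have := pos (- x); rewrite oppr_gt0 mulrN sinN sx oppr0 ltxx.
  suff x1' : - x < 1 by move=> /(_ x0 x1').
  by move: x1; rewrite ltr_norml => /andP[]; lra.
have := pos x x0; rewrite sx ltxx.
suff x1' : x < 1 by move=> /(_ x1').
by move: x1; rewrite ltr_norml => /andP[].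
Qed.

(* The exponent is a bi-additive function with values in 2 Z; replacing s by s / n
   makes it small, hence zero. *)
Lemma expi_bilinear (F G : R -> R) :
  (forall s r, expi (pi * (s * F r + r * G s)) = 1) -> forall r, F r = r * F 1.
Proof.
move=> h.
have addF (F' G' : R -> R) : (forall s r, expi (pi * (s * F' r + r * G' s)) = 1) ->
    forall r r', F' (r + r') = F' r + F' r'.
  move=> h' r r'; apply/eqP; rewrite -subr_eq0 -[_ == 0](inj_eq (mulfI (lt0r_neq0 (pi_gt0 R))))
    mulr0.
  apply/eqP/expi_injZ => s; rewrite mulr0 expi0.
  have e1 := h' s r; have e2 := h' s r'; have e3 := h' s (r + r').
  have : expi (pi * (s * F' (r + r') + (r + r') * G' s)) =
     expi (s * (pi * (F' (r + r') - (F' r + F' r')))) *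
     (expi (pi * (s * F' r + r * G' s)) * expi (pi * (s * F' r' + r' * G' s))).
    by rewrite -!expiD; congr expi; ring.
  by rewrite e1 e2 e3 !mulr1.
have aF := addF F G h.
have aG : forall r r', G (r + r') = G r + G r'.
  by apply: (addF G F) => s r; rewrite addrC.
have Gn n x : G (n.+1%:R * x) = n.+1%:R * G x.
  by elim: n => [|n IH]; [rewrite !mul1r|rewrite -natr1 !mulrDl aG IH !mul1r].
have b0 s r : s * F r + r * G s = 0.
  set b := s * F r + r * G s.
  pose n := Num.bound `|b|.
  have bn : `|b| < n.+1%:R.
    by rewrite (lt_trans (archi_boundP (normr_ge0 _)))// ltr_nat.
  have n0 : n.+1%:R != 0 :> R by rewrite pnatr_eq0.
  have e : (s / n.+1%:R) * F r + r * G (s / n.+1%:R) = b / n.+1%:R.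
    have : n.+1%:R * G (s / n.+1%:R) = G s by rewrite -Gn mulrC divfK.
    by rewrite /b => <-; field.
  have /expi_pi_small : `|b / n.+1%:R| < 1.
    by rewrite normrM normfV normr_nat ltr_pdivrMr ?mul1r// ltr0n.
  rewrite -e h e => /(_ erefl)/eqP.
  by rewrite mulf_eq0 invr_eq0 (negbTE n0) orbF => /eqP.
move=> r; have := b0 1 r; have := b0 1 1; rewrite !mul1r; nra.
Qed.

End expi.

Section heisenberg_forms.
Variables (R : realType) (m : nat) (h : heisenberg R m).
Implicit Types x y z : lie R m.

Lemma ip_addl x y z : ip h (x + y) z = ip h x z + ip h y z.
Proof. by have := ip_linearl h 1 x y z; rewrite scale1r mul1r. Qed.

Lemma ip_0l z : ip h 0 z = 0.
Proof. by have := ip_addl 0 0 z; rewrite addr0 => /eqP;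
  rewrite -subr_eq0 opprD addNKr oppr_eq0 => /eqP. Qed.

Lemma ip_scalel a x z : ip h (a *: x) z = a * ip h x z.
Proof. by have := ip_linearl h a x 0 z; rewrite ip_0l !addr0. Qed.

Lemma ip_suml I (r : seq I) (f : I ->
  lie R m) z : ip h (\sum_(i <- r) f i) z = \sum_(i <- r) ip h (f i) z.
Proof. by elim: r => [|i r IH]; rewrite ?big_nil ?ip_0l// !big_cons ip_addl IH. Qed.

Lemma br_addl x y z : br h (x + y) z = br h x z + br h y z.
Proof. by have := br_linearl h 1 x y z; rewrite !scale1r. Qed.

Lemma br_0l z : br h 0 z = 0.
Proof. by have := br_addl 0 0 z; rewrite addr0 => /eqP;
  rewrite -subr_eq0 opprD addNKr oppr_eq0 => /eqP. Qed.

Lemma br_scalel a x z : br h (a *: x) z = a *: br h x z.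
Proof. by have := br_linearl h a x 0 z; rewrite br_0l !addr0. Qed.

Lemma br_suml I (r : seq I) (f : I ->
  lie R m) z : br h (\sum_(i <- r) f i) z = \sum_(i <- r) br h (f i) z.
Proof. by elim: r => [|i r IH]; rewrite ?big_nil ?br_0l// !big_cons br_addl IH. Qed.

End heisenberg_forms.

Section schrodinger.
Variables (R : realType) (m : nat) (h : heisenberg R m).
Variables (Z : lie R m) (U V : 'I_m -> lie R m) (alpha : {scalar lie R m}).
Local Notation C := R[i].
Local Notation lebm := (lebesgueRn R m).
Local Notation pi_ := (pi_alpha h Z U V alpha).
Local Open Scope complex_scope.
Implicit Types (x : lie R m) (f g : Rn R m -> C) (t : Rn R m).

Definition ucoord x (j : 'I_m) := ip h x (U j).
(** Up to the factor 2 pi, the frequency in t_j of the phase of [pi_alpha x]. The sum over the V_i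
    stays inside the bracket, which is linear on the left only. *)
Definition vform x (j : 'I_m) := alpha (br h (U j) (\sum_(i < m) ip h x (V i) *: V i)).
Definition zchar x := alpha Z * ip h x Z.

Definition translate (a : 'I_m -> R) t : Rn R m := [tuple tnth t j + a j | j < m].

Definition pi_phase x t := 2 * pi * (zchar x + \sum_(j < m) (tnth t j + ucoord x j / 2) * vform x
  j).

Lemma pi_alphaE x f t : pi_ x f t = expi (pi_phase x t) * f (translate (ucoord x) t).
Proof.
rewrite /pi_alpha; congr (expi (2 * pi * _) * _).
rewrite linearD linearZ /= mulrC; congr (_ + _).
rewrite br_suml linear_sum; apply: eq_bigr => j _.
by rewrite br_scalel linearZ.
Qed.

Lemma translate_preserving a : measure_preserving lebm lebm (translate a).
Proof. exact: measure_preserving_translationRn. Qed.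

Lemma measurable_pi_phase x : measurable_fun setT (pi_phase x : Rn R m -> R).
Proof.
apply: measurable_funM; first exact: measurable_cst.
apply: measurable_funD; first exact: measurable_cst.
apply: measurable_sum => j; apply: measurable_funM; last exact: measurable_cst.
by apply: measurable_funD; [exact: measurable_tnth|exact: measurable_cst].
Qed.

Lemma L2C_phase_translate (p : Rn R m -> R) a f : measurable_fun setT p -> L2C lebm f ->
  L2C lebm (fun t => expi (p t) * f (translate a t)) /\
  nrm2 lebm (fun t => expi (p t) * f (translate a t)) = nrm2 lebm f.
Proof.
move=> mp [mf i1]; have mpt := translate_preserving a.
have i2 := measure_preserving_integrable mpt i1.
have e : (fun t => sqmod (expi (p t) * f (translate a t))) = fun t => sqmod (f (translate a t)).
  by apply/funext => t; rewrite sqmodM sqmod_expi mul1r.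
split; last by rewrite /nrm2 e (measure_preserving_Rintegral mpt i1).
split.
  apply: measurable_complexM; first exact: measurable_expi.
  exact: (measurable_complex_comp mpt.1 mf).
by rewrite /sq_integrable -/(EFin \o (fun t => sqmod (expi (p t) * f (translate a t)))) e.
Qed.

Lemma pi_alpha_L2 x f : L2C lebm f -> L2C lebm (pi_ x f).
Proof.
move=> lf; rewrite (funext (pi_alphaE x f)).
by apply: (L2C_phase_translate _ _ lf).1; exact: measurable_pi_phase.
Qed.

Lemma nrm2_pi_alpha x f : L2C lebm f -> nrm2 lebm (pi_ x f) = nrm2 lebm f.
Proof.
move=> lf; rewrite (funext (pi_alphaE x f)).
by apply: (L2C_phase_translate _ _ lf).2; exact: measurable_pi_phase.
Qed.

Lemma pi_alphaZ x c f t : pi_ x (fun s => c * f s) t = c * pi_ x f t.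
Proof. by rewrite !pi_alphaE mulrCA. Qed.

(** The translation and the phase are undone explicitly; [pi_alpha (- x)] is not known to be the
    inverse at this point, since the phase depends on [x] through the right argument of the
    bracket. *)
Lemma pi_alpha_surj x f : L2C lebm f -> exists2 g, L2C lebm g & pi_ x g = f.
Proof.
move=> lf; pose b j := - ucoord x j.
exists (fun t => expi (- pi_phase x (translate b t)) * f (translate b t)).
  apply: (L2C_phase_translate _ _ lf).1.
  rewrite -[X in measurable_fun _ X]/(-%R \o (pi_phase x \o translate b)).
  apply: measurableT_comp => //; apply: measurableT_comp; first exact: measurable_pi_phase.
  exact: (translate_preserving b).1.
apply/funext => t; rewrite pi_alphaE.
have -> : translate b (translate (ucoord x) t) = t.
  by apply: eq_from_tnth => j; rewrite !tnth_mktuple addrK.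
by rewrite mulrA -expiD subrr expi0 mul1r.
Qed.

(** The Weyl commutation relation: translations commute and the phases are affine in [t], so
    exchanging the two operators leaves a constant phase. *)
Lemma pi_alpha_comm x x' f t :
  pi_ x (pi_ x' f) t =
  expi (2 * pi * \sum_(j < m) (ucoord x j * vform x' j - ucoord x' j * vform x j)) * pi_ x' (pi_
    x f) t.
Proof.
rewrite !pi_alphaE !mulrA -!expiD.
have -> : translate (ucoord x') (translate (ucoord x) t) = translate (ucoord x) (translate
  (ucoord x') t).
  by apply: eq_from_tnth => j; rewrite !tnth_mktuple addrAC.
congr (expi _ * _); rewrite /pi_phase -!mulrDr; congr (_ * _).
set S1 := \sum_(j < m) _; set S2 := \sum_(j < m) _; set S3 := \sum_(j < m) _.
set S4 := \sum_(j < m) _; set S5 := \sum_(j < m) _.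
suff e : S1 + S2 = S3 + (S4 + S5) by rewrite addrACA e; ring.
rewrite /S1 /S2 /S3 /S4 /S5 -!big_split /=; apply: eq_bigr => j _.
by rewrite !tnth_mktuple; field.
Qed.

(** The phase being affine in [t], its exponential is a constant times a product of exponentials in
    one variable each. *)
Lemma pi_alpha_tens x (f : 'I_m -> R -> C) t :
  pi_ x (tens f) t = expi (2 * pi * (zchar x + \sum_(j < m) ucoord x j / 2 * vform x j)) *
    tens (fun j s => expi (2 * pi * vform x j * s) * f j (s + ucoord x j)) t.
Proof.
rewrite pi_alphaE /tens big_split /= mulrA -expi_sum -expiD; congr (expi _ * _).
  rewrite /pi_phase -[X in _ = _ + X]/(\sum_(j < m) _).
  have -> : \sum_(j < m) 2 * pi * vform x j * tnth t j = 2 * pi * \sum_(j < m) tnth t j * vform x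
    j.
    by rewrite mulr_sumr; apply: eq_bigr => j _; ring.
  rewrite -mulrDr -addrA -big_split /=; congr (_ * (_ + _)); apply: eq_bigr => j _; ring.
by apply: eq_bigr => j _; rewrite tnth_mktuple.
Qed.

Variable b : 'I_m -> R.
Hypothesis b_gt0 : forall j, 0 < b j.

(** As [pi_alpha x] is isometric, [f] may be replaced by a combination of Hermite functions; each of
    them becomes a scalar times a product of translated and modulated factors, to which
    [happrox_tens] applies. *)
Lemma happrox_pi_alpha x f : L2C lebm f -> happrox b f -> happrox b (pi_ x f).
Proof.
move=> lf af; apply: happrox_trans => //; first exact: pi_alpha_L2.
move=> e /af[s fs]; exists (pi_ x (hcomb b s)); split.
- exact/pi_alpha_L2/hcomb_L2.
- have -> : pi_ x (hcomb b s) = fun t => \sum_(y <- s) y.1 * pi_ x (hfun b y.2) t.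
    apply/funext => t; rewrite pi_alphaE /hcomb mulr_sumr; apply: eq_bigr => y _.
    by rewrite pi_alphaE mulrCA.
  have lh q : L2C lebm (pi_ x (hfun b q)) by exact/pi_alpha_L2/hfun_L2.
  apply: happrox_sum => // y; first exact: L2CZ.
  apply: happroxZ => //; rewrite /hfun (funext (pi_alpha_tens x _)).
  have aj j : pgauss_approxC (b j) (fun s =>
    expi (2 * pi * vform x j * s) * (pgauss (b j) (shermite (b j) (y.2 j)) (s + ucoord x j))%:C).
    have [a1 a2] := pgauss_approx_pi (b_gt0 j) (ucoord x j) (2 * pi * vform x j) (shermite (b j)
      (y.2 j)).
    have gt := gauss_bounded_translation (b_gt0 j) (ucoord x j) (shermite (b j) (y.2 j)).
    have eR : (fun s => complex.Re (expi (2 * pi * vform x j * s) * (pgauss (b j) (shermite (b j)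
      (y.2 j)) (s + ucoord x j))%:C)) =
      fun s => cos (2 * pi * vform x j * s) * pgauss (b j) (shermite (b j) (y.2 j)) (s + ucoord x
        j).
      by apply/funext => r /=; rewrite mulr0 subr0.
    have eI : (fun s => complex.Im (expi (2 * pi * vform x j * s) * (pgauss (b j) (shermite (b j)
      (y.2 j)) (s + ucoord x j))%:C)) =
      fun s => sin (2 * pi * vform x j * s) * pgauss (b j) (shermite (b j) (y.2 j)) (s + ucoord x
        j).
      by apply/funext => r /=; rewrite mulr0 add0r.
    split; rewrite ?eR ?eI//; split; rewrite ?eR ?eI; apply: gauss_bounded_exp gt.
      apply: (@exp_bounded_bounded _ _ 1) => [|r]; last by rewrite ler_norml cos_geN1 cos_le1.
      by apply: measurableT_comp; [apply: continuous_measurable_fun;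
        exact: continuous_cos|exact: measurable_funM].
    apply: (@exp_bounded_bounded _ _ 1) => [|r]; last by rewrite ler_norml sin_geN1 sin_le1.
    by apply: measurableT_comp; [apply: continuous_measurable_fun;
      exact: continuous_sin|exact: measurable_funM].
  apply: (happroxZ b_gt0); last exact: (happrox_tens b_gt0).
  by apply: (tens_L2 _).1 => j; have [] := aj j.
have -> : (fun t => pi_ x f t - pi_ x (hcomb b s) t) = pi_ x (fun t => f t - hcomb b s t).
  by apply/funext => t; rewrite !pi_alphaE mulrBr.
by rewrite nrm2_pi_alpha//; exact: L2CB (hcomb_L2 _ _).
Qed.

End schrodinger.

(** * Derivatives of pi_alpha along U_j, V_j and Z *)

Section infinitesimal_schrodinger.
Variables (R : realType) (m : nat) (h : heisenberg R m).
Variables (Z : lie R m) (U V : 'I_m -> lie R m) (alpha : {scalar lie R m}).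
Local Notation C := R[i].
Local Notation leb := (@lebesgue_measure R).
Local Notation lebm := (lebesgueRn R m).
Local Notation pi_ := (pi_alpha h Z U V alpha).
Local Open Scope complex_scope.
Implicit Types (X : lie R m) (f g : Rn R m -> C).

Definition pi_quotient X f g (s : R) : Rn R m -> C :=
  fun t => (pi_ (s *: X) f t - f t) / s%:C - g t.

Definition pi_deriv X f g :=
  nrm2 lebm (pi_quotient X f g s) @[s --> (0 : R)^'] --> (0 : R).

Lemma pi_deriv_le X f g (K : R) :
  (forall s, s != 0 -> `|s| <= 1 -> nrm2 lebm (pi_quotient X f g s) <= s ^+ 2 * K) ->
  pi_deriv X f g.
Proof.
move=> HK; apply/cvgrPdist_le => e e0.
have K1 : 0 < `|K| + 1 by rewrite ltr_wpDl.
have d0 : 0 < Num.min 1 (e / (`|K| + 1)) by rewrite lt_min ltr01 divr_gt0.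
near=> s.
have s0 : s != 0 by near: s; exact: nbhs_dnbhs_neq.
have : `|s| <= Num.min 1 (e / (`|K| + 1)).
  near: s; apply: dnbhs0_le => //.
rewrite le_min => /andP[s1 s2].
rewrite sub0r normrN ger0_norm ?nrm2_ge0//; apply: (le_trans (HK _ s0 s1)).
apply: (@le_trans _ _ (`|s| * (`|K| + 1))); last by rewrite -ler_pdivlMr.
rewrite -real_normK ?num_real// expr2 -mulrA ler_wpM2l//.
apply: (@le_trans _ _ (`|s| * (`|K| + 1))).
  by rewrite ler_wpM2l// (le_trans (ler_norm _))// lerDl.
by rewrite ler_piMl ?(ltW K1).
Unshelve. all: by end_near. Qed.

Lemma pi_quotient_L2 X f g s : L2C lebm f -> L2C lebm g -> L2C lebm (pi_quotient X f g s).
Proof.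
move=> lf lg; apply: L2CB => //; under eq_fun do rewrite mulrC.
by apply/L2CZ/L2CB => //; exact: pi_alpha_L2.
Qed.

Lemma pi_derivZ X c f g : L2C lebm f -> L2C lebm g ->
  pi_deriv X f g -> pi_deriv X (fun t => c * f t) (fun t => c * g t).
Proof.
move=> lf lg d1; rewrite /pi_deriv.
have -> : (fun s => nrm2 lebm (pi_quotient X (fun t => c * f t) (fun t => c * g t) s)) =
    fun s => sqmod c * nrm2 lebm (pi_quotient X f g s).
  apply/funext => s; rewrite -nrm2Z; last exact: pi_quotient_L2.
  by congr (nrm2 _ _); apply/funext => t; rewrite /pi_quotient pi_alphaZ; ring.
by have := cvgM (cvg_cst (sqmod c)) d1; rewrite mulr0; exact.
Qed.

Lemma gauss_boundedC_expi (c : R) (u : R -> C) :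
  gauss_boundedC u -> gauss_boundedC (fun t => expi (c * t) * u t).
Proof.
move=> [u1 u2].
have mc : measurable_fun [set: R] (fun t => c * t) by exact: measurable_funM.
have ec : exp_bounded (fun t => cos (c * t)).
  apply: (@exp_bounded_bounded _ _ 1) => [|r]; last by rewrite ler_norml cos_geN1 cos_le1.
  by apply: measurableT_comp mc; apply: continuous_measurable_fun; exact: continuous_cos.
have es : exp_bounded (fun t => sin (c * t)).
  apply: (@exp_bounded_bounded _ _ 1) => [|r]; last by rewrite ler_norml sin_geN1 sin_le1.
  by apply: measurableT_comp mc; apply: continuous_measurable_fun; exact: continuous_sin.
split.
  rewrite (_ : (fun t => _) = fun t =>
    cos (c * t) * complex.Re (u t) - sin (c * t) * complex.Im (u t)).
    by apply: gauss_boundedB; exact: gauss_bounded_exp.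
  by apply/funext => t; case: (u t).
rewrite (_ : (fun t => _) = fun t =>
  cos (c * t) * complex.Im (u t) + sin (c * t) * complex.Re (u t)).
  by apply: gauss_boundedD; exact: gauss_bounded_exp.
by apply/funext => t; case: (u t).
Qed.

Variable b : 'I_m -> R.
Hypothesis b_gt0 : forall j, 0 < b j.

Definition ptens (p : 'I_m -> {poly R}) : Rn R m -> C :=
  tens (fun j s => (pgauss (b j) (p j) s)%:C).

Lemma ptens_L2 p : L2C lebm (ptens p).
Proof. by apply: (tens_L2 _).1 => j; exact: gauss_pgaussC. Qed.

(** The assumptions bear on every multiple [s *: X] because [vform] is not yet known to be linear in
    [s]. The remainder of the difference quotient is again a product, whose factor of index [j] is a
    one-variable remainder. *)
Lemma ptens_deriv_translation X j p :
  (forall s i, ucoord h U (s *: X) i = if i == j then s else 0) ->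
  (forall s i, vform h U V alpha (s *: X) i = 0) ->
  (forall s, zchar h Z alpha (s *: X) = 0) ->
  pi_deriv X (ptens p) (ptens (fun i => if i == j then dpgauss (b j) (p j) else p i)).
Proof.
move=> hU hV hZ; pose f i s : C := (pgauss (b i) (p i) s)%:C.
have gf i : gauss_boundedC (f i) by exact: gauss_pgaussC.
have [K K0 HK] := nrm2_tens_repl j gf.
have [M gM HM] := pgauss_diff_quotient (b_gt0 j) (p j).
apply: (@pi_deriv_le _ _ _ (K * sqint M)) => s s0 s1.
pose w t : C := ((pgauss (b j) (p j) (t + s) - pgauss (b j) (p j) t) / s - pgauss (b j) (dpgauss
  (b j) (p j)) t)%:C.
have gw : gauss_boundedC w.
  apply/gauss_boundedC_real/gauss_boundedB/pgauss_bounded => //.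
  under eq_fun do rewrite mulrC; apply/gauss_boundedZ/gauss_boundedB/pgauss_bounded => //.
  exact: gauss_bounded_translation.
have -> : pi_quotient X (ptens p) (ptens (fun i =>
  if i == j then dpgauss (b j) (p j) else p i)) s = tens (repl f j w).
  apply/funext => t; rewrite /pi_quotient pi_alphaE /pi_phase hZ big1; last by move=> i _;
    rewrite hV mulr0.
  have E p' u : ptens p' u = (pgauss (b j) (p' j) (tnth u j))%:C *
      \prod_(i < m | i != j) (pgauss (b i) (p' i) (tnth u i))%:C.
    by rewrite /ptens /tens (bigD1 j).
  rewrite addr0 mulr0 expi0 mul1r tens_repl !E tnth_mktuple hU !eqxx.
  have -> : w (tnth t j) = ((pgauss (b j) (p j) (tnth t j + s))%:C - (pgauss (b j) (p j) (tnth t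
    j))%:C) / s%:C
      - (pgauss (b j) (dpgauss (b j) (p j)) (tnth t j))%:C.
    by rewrite /w -fmorphV -!rmorphB -rmorphM -rmorphB.
  rewrite /f.
  pose P : C := \prod_(i < m | i != j) (pgauss (b i) (p i) (tnth t i))%:C.
  rewrite -/P.
  have -> : \prod_(i < m | i != j) (pgauss (b i) (p i) (tnth (translate (ucoord h U (s *: X)) t)
    i))%:C = P.
    by apply: eq_bigr => i ij; rewrite tnth_mktuple hU (negbTE ij) addr0.
  have -> : \prod_(i < m | i != j) (pgauss (b i) (if i == j then dpgauss (b j) (p j) else p i)
    (tnth t i))%:C = P.
    by apply: eq_bigr => i ij; rewrite (negbTE ij).
  ring.
apply: (le_trans (HK _ gw)); rewrite mulrCA ler_wpM2l ?(ltW K0)//.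
rewrite -RintegralZl//; last exact: integrable_sqr.
apply: le_Rintegral => //.
- exact: integrable_sqmod_gauss.
- exact: (integrableZl measurableT _ (integrable_sqr gM)).
- move=> t _; rewrite sqmod_real -exprMn -real_normK ?num_real// -[leRHS]real_normK ?num_real//.
  by rewrite lerXn2r ?nnegrE// (le_trans (HM s t s0 s1))// normrM ler_wpM2l// ler_norm.
Qed.

Lemma ptens_deriv_modulation X j k p :
  (forall s i, ucoord h U (s *: X) i = 0) ->
  (forall s i, vform h U V alpha (s *: X) i = if i == j then s * k else 0) ->
  (forall s, zchar h Z alpha (s *: X) = 0) ->
  pi_deriv X (ptens p) (fun t => 'i%C * (2 * pi * k * tnth t j)%:C * ptens p t).
Proof.
move=> hU hV hZ; pose f i s : C := (pgauss (b i) (p i) s)%:C.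
have gf i : gauss_boundedC (f i) by exact: gauss_pgaussC.
have [K K0 HK] := nrm2_tens_repl j gf.
(* With x = 2 pi k t, the bound [s ^+ 2 * (2 * x ^+ 4)] on the squared quotient error, times the
   squared modulus of the factor, is 2 s^2 times the square of this polynomial Gaussian. *)
pose q : {poly R} := (2 * pi * k) ^+ 2 *: ('X ^+ 2 * p j).
have gM := gauss_boundedM (pgauss_bounded (b_gt0 j) q) (pgauss_bounded (b_gt0 j) q).
apply: (@pi_deriv_le _ _ _ (K * (2 * sqint (pgauss (b j) q)))) => s s0 s1.
pose w t : C := ((expi (s * (2 * pi * k * t)) - 1) / s%:C - 'i%C * (2 * pi * k * t)%:C) * f j t.
have wle t : sqmod (w t) <= s ^+ 2 * (2 * pgauss (b j) q t ^+ 2).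
  rewrite sqmodM; apply: (le_trans (ler_wpM2r (sqmod_ge0 _) (sqmod_expi_quotient _ s0))).
  rewrite sqmod_real /pgauss /q hornerZ hornerM hornerXn.
  by rewrite le_eqVlt; apply/orP; left; apply/eqP; ring.
have gw : gauss_boundedC w.
  have -> : w = fun t => (s%:C^-1 * (expi (s * (2 * pi * k) * t) * f j t - f j t)) -
      'i%C * (pgauss (b j) ((2 * pi * k) *: ('X * p j)) t)%:C.
    apply/funext => t; rewrite /w /f /pgauss hornerZ hornerM hornerX.
    by rewrite -[s * (2 * pi * k) * t]mulrA !rmorphM; ring.
  apply: gauss_boundedCB; apply: gauss_boundedCZ; last exact: gauss_pgaussC.
  by apply: gauss_boundedCB => //; exact: gauss_boundedC_expi.
have -> : pi_quotient X (ptens p) (fun t =>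
  'i%C * (2 * pi * k * tnth t j)%:C * ptens p t) s = tens (repl f j w).
  apply/funext => t; rewrite /pi_quotient pi_alphaE /pi_phase hZ (bigD1 j)//= big1 ?addr0;
    last first.
    by move=> i ij; rewrite hV (negbTE ij) mulr0.
  rewrite add0r hU hV eqxx mul0r addr0.
  have -> : translate (ucoord h U (s *: X)) t = t.
    by apply: eq_from_tnth => i; rewrite tnth_mktuple hU addr0.
  rewrite tens_repl /w /f /ptens /tens (bigD1 j)//=.
  rewrite (_ : 2 * pi * (tnth t j * (s * k)) = s * (2 * pi * k * tnth t j)); last by ring.
  ring.
apply: (le_trans (HK _ gw)); rewrite mulrCA ler_wpM2l ?(ltW K0)//.
have i2 := integrable_sqr (pgauss_bounded (b_gt0 j) q).
rewrite -!RintegralZl//; last exact: (integrableZl measurableT _ i2).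
apply: le_Rintegral => //.
- exact: integrable_sqmod_gauss.
- exact: (integrableZl measurableT _ (integrableZl measurableT _ i2)).
Qed.

Lemma pi_deriv_central X k f : L2C lebm f ->
  (forall s i, ucoord h U (s *: X) i = 0) ->
  (forall s i, vform h U V alpha (s *: X) i = 0) ->
  (forall s, zchar h Z alpha (s *: X) = s * k) ->
  pi_deriv X f (fun t => 'i%C * (2 * pi * k)%:C * f t).
Proof.
move=> lf hU hV hZ.
apply: (@pi_deriv_le _ _ _ (2 * (2 * pi * k) ^+ 4 * nrm2 lebm f)) => s s0 s1.
have -> : pi_quotient X f (fun t => 'i%C * (2 * pi * k)%:C * f t) s =
    fun t => ((expi (s * (2 * pi * k)) - 1) / s%:C - 'i%C * (2 * pi * k)%:C) * f t.
  apply/funext => t; rewrite /pi_quotient pi_alphaE /pi_phase hZ big1 ?addr0; last first.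
    by move=> i _; rewrite hV mulr0.
  have -> : translate (ucoord h U (s *: X)) t = t.
    by apply: eq_from_tnth => i; rewrite tnth_mktuple hU addr0.
  by rewrite mulrCA; ring.
by rewrite nrm2Z// [leRHS]mulrA ler_wpM2r ?nrm2_ge0// sqmod_expi_quotient.
Qed.

End infinitesimal_schrodinger.

(** * Clifford multiplication *)

Section clifford.
Variables (R : realType) (m : nat).
Local Notation C := R[i].
Local Open Scope complex_scope.
Implicit Types (k l : tidx m) (s : spinor R m).

Definition sgn2 (e : 'I_2) : R := if e == 0 then 1 else -1.
Definition flip2 (e : 'I_2) : 'I_2 := if e == 0 then 1 else 0.

Lemma ord2_ind (P : 'I_2 -> Prop) : P 0 -> P 1 -> forall e, P e.
Proof.
move=> P0 P1 [[|[|//]] i].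
  by have -> : Ordinal i = 0 by apply: val_inj.
by have -> : Ordinal i = 1 by apply: val_inj.
Qed.

Lemma sigma1E (a b : 'I_2) : sigma1 R a b = (b == flip2 a)%:R.
Proof. by elim/ord2_ind: a; elim/ord2_ind: b; rewrite mxE. Qed.

Lemma sigma2E (a b : 'I_2) :
  sigma2 R a b = if b == flip2 a then 'i%C * (sgn2 a)%:C else 0.
Proof.
by elim/ord2_ind: a; elim/ord2_ind: b; rewrite mxE //= ?mulr1// ?rmorphN1 ?mulrN1.
Qed.

Lemma one'E (a b : 'I_2) : one' R a b = if b == a then (sgn2 a)%:C else 0.
Proof. by elim/ord2_ind: a; elim/ord2_ind: b; rewrite mxE //= rmorphN1. Qed.

Lemma flipE j k a : flip j k a = if a == j then flip2 (k a) else k a.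
Proof. by rewrite ffunE. Qed.

Lemma flip2K : involutive flip2.
Proof. by apply: ord2_ind. Qed.

Lemma flipK j : involutive (flip (m := m) j).
Proof. by move=> k; apply/ffunP => a; rewrite !flipE; case: eqP => // _; rewrite flip2K. Qed.

Lemma sign_flip j k a : sign R (flip j k) a = (if a == j then -1 else 1) * sign R k a.
Proof.
rewrite /sign flipE; case: (a == j); last by rewrite mul1r.
by elim/ord2_ind: (k a); rewrite /= ?mulN1r ?opprK.
Qed.

(** All tensor factors are diagonal except the antidiagonal one in position [j], so the row of index
    [k] has its only possibly nonzero entry in the column [flip j k]. *)
Lemma spin_act_cliff_at (S : 'M[C]_2) (w : 'I_2 -> C) j s k :
  (forall a b, S a b = if b == flip2 a then w a else 0) ->
  spin_act (cliff_at S j) s k =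
  'i%C * (\prod_(a < m | (a < j)%N) sign R k a)%:C * w (k j) * s (flip j k).
Proof.
move=> hS; rewrite /spin_act (bigD1 (flip j k))//= big1 ?addr0; last first.
  move=> l lk; rewrite /cliff_at.
  pose A (a : 'I_m) : 'M[C]_2 := if (a < j)%N then one' R else if a == j then S else 1%:M.
  suff [a ha] : exists a, A a (k a) (l a) = 0.
    by rewrite /tensor (bigD1 a)//= ha mul0r mulr0 mul0r.
  have [a la] : exists a, l a != flip j k a.
    by apply/existsP; rewrite -negb_forall; apply: contra lk => /forallP h; apply/eqP/ffunP => a;
      exact/eqP.
  exists a; move: la; rewrite flipE /A.
  have [->|aj] := eqVneq a j; first by rewrite ltnn hS => /negbTE ->.
  by case: ifP => _ la; [rewrite one'E (negbTE la)|rewrite mxE eq_sym (negbTE la)].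
congr (_ * _); rewrite /cliff_at -mulrA; congr (_ * _).
rewrite /tensor (bigID (fun a : 'I_m => (a < j)%N))/=; congr (_ * _).
  rewrite rmorph_prod; apply: eq_bigr => a aj.
  have aj' : (a == j) = false by rewrite -val_eqE/= ltn_eqF.
  by rewrite aj one'E flipE aj' eqxx.
rewrite (bigD1 j)/= ?ltnn// eqxx hS flipE eqxx eqxx big1 ?mulr1// => a /andP[aj ane].
by rewrite (negbTE aj) (negbTE ane) mxE flipE (negbTE ane) eqxx.
Qed.

Lemma spin_act_cliffU j s k :
  spin_act (cliffU R j) s k = 'i%C * (\prod_(a < m | (a < j)%N) sign R k a)%:C * s (flip j k).
Proof.
rewrite (@spin_act_cliff_at _ (fun=> 1)) ?mulr1// => a b.
by rewrite sigma1E; case: eqP.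
Qed.

Lemma spin_act_cliffV j s k :
  spin_act (cliffV R j) s k =
  - (\prod_(a < m | (a < j)%N) sign R k a * sign R k j)%:C * s (flip j k).
Proof.
rewrite (@spin_act_cliff_at _ (fun a => 'i%C * (sgn2 a)%:C)); last exact: sigma2E.
have i2 : 'i%C * 'i%C = -1 :> C by rewrite -expr2 sqr_i.
rewrite rmorphM /= -/(sign R k j); set P := _%:C.
transitivity ('i%C * 'i%C * P * (sign R k j)%:C * s (flip j k)); first by ring.
by rewrite i2; ring.
Qed.

Lemma spin_act_cliffZ s k :
  spin_act (@cliffZ R m) s k = 'i%C * (\prod_(a < m) sign R k a)%:C * s k.
Proof.
rewrite /spin_act (bigD1 k)//= big1 ?addr0; last first.
  move=> l lk; have [a la] : exists a, l a != k a.
    by apply/existsP; rewrite -negb_forall; apply: contra lk => /forallP h; apply/eqP/ffunP => a;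
      exact/eqP.
  by rewrite /cliffZ /tensor (bigD1 a)//= one'E (negbTE la) mul0r mulr0 mul0r.
rewrite /cliffZ /tensor rmorph_prod; congr (_ * _ * _).
by apply: eq_bigr => a _; rewrite one'E eqxx.
Qed.

Lemma cliffX_lshift j : cliffX R (lshift m j) = cliffU R j.
Proof. by rewrite /cliffX (unsplitK (inl j)). Qed.

Lemma cliffX_rshift j : cliffX R (rshift m j) = cliffV R j.
Proof. by rewrite /cliffX (unsplitK (inr j)). Qed.

Lemma vvecE l k : vvec R l k = (k == l)%:R.
Proof.
rewrite /vvec; have [->|kl] := eqVneq k l.
  by rewrite big1// => j _; rewrite mxE !eqxx.
have [a la] : exists a, k a != l a.
  by apply/existsP; rewrite -negb_forall; apply: contra kl => /forallP h; apply/eqP/ffunP => a;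
    exact/eqP.
by rewrite (bigD1 a)//= mxE (negbTE la) mul0r.
Qed.

(** The index is flipped twice, the signs before [j] coming from U_j and V_j cancel, and so do the
    two signs k_j coming from Z and V_j. The factors i of Z and U_j account for one minus sign; the
    minus sign of V_j cancels the one produced by the flip. *)
Lemma spin_act_ZUV j s k :
  spin_act (@cliffZ R m) (spin_act (cliffU R j) (spin_act (cliffV R j) s)) k =
  - (\prod_(a < m | a != j) sign R k a)%:C * s k.
Proof.
rewrite spin_act_cliffZ spin_act_cliffU spin_act_cliffV flipK.
have sg (a : 'I_m) : sign R k a * sign R k a = 1.
  by rewrite /sign; case: eqP; rewrite ?mulr1// mulrNN mulr1.
have -> : \prod_(a < m | (a < j)%N) sign R (flip j k) a = \prod_(a < m | (a < j)%N) sign R k a.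
  by apply: eq_bigr => a aj; rewrite sign_flip -val_eqE/= ltn_eqF// mul1r.
rewrite sign_flip eqxx (bigD1 j)//=.
set P := \prod_(a < m | (a < j)%N) _; set Q := \prod_(a < m | a != j) _.
have PP : P * P = 1 by rewrite /P -big_split/=; apply: big1 => a _.
have -> : 'i%C * (sign R k j * Q)%:C * ('i%C * P%:C * (- (P * (-1 * sign R k j))%:C * s k)) =
  'i%C * 'i%C * (sign R k j * sign R k j * Q * (P * P))%:C * s k.
  by rewrite !rmorphM !rmorphN1; ring.
by rewrite -expr2 sqr_i sg PP mul1r mulr1 mulN1r.
Qed.

End clifford.

(** * Transport to the group *)

Section chart.
Variables (R : realType) (m : nat) (h : heisenberg R m).
Variables (Z : lie R m) (U V : 'I_m -> lie R m).
Variables (alpha : {scalar lie R m}) (d : 'I_m -> R).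
Hypothesis hZ : lie_center h Z.
Hypothesis hZ1 : ip h Z Z = 1.
Hypothesis hbasis : adapted_basis h Z alpha U V d.
Local Notation G := (lie R m).
Local Notation volR := (lebesgueRn R (m + m).+1).
Local Notation chart := (chart Z U V).
Local Notation frameX := (frameX U V).
Implicit Types x y w : G.

Lemma ip_ZU i : ip h Z (U i) = 0. Proof. by have [[_ _ _ /(_ i)[]]] := hbasis. Qed.
Lemma ip_ZV i : ip h Z (V i) = 0. Proof. by have [[_ _ _ /(_ i)[]]] := hbasis. Qed.
Lemma ip_UU i j : ip h (U i) (U j) = (i == j)%:R. Proof. by have [[]] := hbasis. Qed.
Lemma ip_VV i j : ip h (V i) (V j) = (i == j)%:R. Proof. by have [[]] := hbasis. Qed.
Lemma ip_UV i j : ip h (U i) (V j) = 0. Proof. by have [[]] := hbasis. Qed.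

Lemma frameX_lshift j : frameX (lshift m j) = U j.
Proof. by rewrite /Defs.frameX (unsplitK (inl j)). Qed.

Lemma frameX_rshift j : frameX (rshift m j) = V j.
Proof. by rewrite /Defs.frameX (unsplitK (inr j)). Qed.

Lemma ip_Zframe i : ip h Z (frameX i) = 0.
Proof. by rewrite /Defs.frameX; case: fintype.split => j; rewrite ?ip_ZU ?ip_ZV. Qed.

Lemma ip_frame i j : ip h (frameX i) (frameX j) = (i == j)%:R.
Proof.
rewrite -(splitK i) -(splitK j); case: fintype.split => a; case: fintype.split => c /=.
- by rewrite !frameX_lshift ip_UU (inj_eq (@lshift_inj _ _)).
- by rewrite frameX_lshift frameX_rshift ip_UV eq_lrshift.
- by rewrite frameX_lshift frameX_rshift ip_sym ip_UV eq_rlshift.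
- by rewrite !frameX_rshift ip_VV (inj_eq (@rshift_inj _ _)).
Qed.

Lemma center_line w : lie_center h w -> w = ip h w Z *: Z.
Proof.
have [z0 z00 hz] := br_center1 h.
have [a Za] : exists a, Z = a *: z0 by apply/hz.
move=> /hz[c ->]; rewrite ip_scalel [X in _ = _ *: X]Za scalerA.
have z1 : a * ip h z0 Z = 1 by have := hZ1; rewrite {1}Za ip_scalel.
by rewrite -mulrA [_ * a]mulrC z1 mulr1.
Qed.

Lemma br_center x y : lie_center h (br h x y).
Proof. by move=> z; exact: br_2step. Qed.

Lemma brE x y : br h x y = ip h (br h x y) Z *: Z.
Proof. exact/center_line/br_center. Qed.

(** Pairing a linear relation with one vector of the orthonormal frame isolates a coefficient; so
    the square matrix with these rows is invertible. *)
Lemma chart_surj x : exists c, x = chart c.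
Proof.
pose e (i : 'I_(m + m).+1) : G := if unlift ord0 i is Some j then frameX j else Z.
have eo i j : ip h (e i) (e j) = (i == j)%:R.
  rewrite /e; case: unliftP => [a ->|->]; case: unliftP => [c ->|->].
  - by rewrite ip_frame (inj_eq lift_inj).
  - by rewrite ip_sym ip_Zframe.
  - by rewrite ip_Zframe.
  - by rewrite hZ1 eqxx.
pose E : 'M[R]_((m + m).+1) := \matrix_i e i.
have uE : E \in unitmx.
  rewrite -row_free_unit; apply: inj_row_free => v; rewrite mulmx_sum_row => v0.
  apply/rowP => j; rewrite mxE.
  have := congr1 (fun z => ip h z (e j)) v0; rewrite ip_0l ip_suml (bigD1 j)//= big1.
    by rewrite addr0 rowK ip_scalel eo eqxx mulr1.
  by move=> i ij; rewrite rowK ip_scalel eo (negbTE ij) mulr0.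
pose v := x *m invmx E.
exists [tuple v 0 i | i < (m + m).+1].
rewrite -[x](mulmxKV uE) -/v mulmx_sum_row big_ord_recl /Defs.chart tnth_mktuple.
congr (_ + _); first by rewrite rowK /e unlift_none.
by apply: eq_bigr => i _; rewrite tnth_mktuple rowK /e liftK.
Qed.

(* In the chart a right translation is a shear: the frame coordinates are
   translated, and the central one is translated by a function of them. *)
Lemma mulG_chart x : exists2 phi : Rn R (m + m).+1 -> Rn R (m + m).+1,
  measure_preserving volR volR phi & forall c, mulG h (chart c) x = chart (phi c).
Proof.
have [a ax] := chart_surj x.
pose beta i := ip h (br h (frameX i) x) Z / 2.
pose psi (t : Rn R (m + m)) : R := tnth a ord0 + \sum_(i < m + m) tnth t i * beta i.
pose tau (t : Rn R (m + m)) : Rn R (m + m) := [tuple tnth t j + tnth a (lift ord0 j) | j < m + m].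
pose tl (c : Rn R (m + m).+1) : Rn R (m + m) := [tuple tnth c (lift ord0 j) | j < m + m].
pose phi (c : Rn R (m + m).+1) : Rn R (m + m).+1 := consRn (tau (tl c), tnth c ord0 + psi (tl c)).
have mpsi : measurable_fun setT (psi : Rn R (m + m) -> measurableTypeR R).
  apply: measurable_funD; first exact: measurable_cst.
  apply: measurable_sum => i; apply: measurable_funM; last exact: measurable_cst.
  exact: measurable_tnth.
have mtl : measurable_fun setT tl.
  apply/measurable_fun_tnthP => j.
  rewrite (_ : _ \o _ = fun c : Rn R (m + m).+1 => tnth c (lift ord0 j)); last first.
    by apply/funext => c /=; rewrite tnth_mktuple.
  exact: measurable_tnth.
have mtau : measure_preserving (lebesgueRn R (m + m)) (lebesgueRn R (m + m)) tau.
  exact: (measure_preserving_translationRn (fun j => tnth a (lift ord0 j))).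
have tlE z : tl (consRn z) = z.1.
  by apply: eq_from_tnth => j; rewrite tnth_mktuple tnth_consRnS.
exists phi.
  apply: (measure_preserving_shear mtau mpsi) => [|z]; last by rewrite /phi tlE.
  apply: measurable_cons.
    apply: measurable_funD; first exact: measurable_tnth.
    exact: measurableT_comp mpsi mtl.
  exact: measurableT_comp mtau.1 mtl.
move=> c; rewrite /mulG.
have -> : 2^-1 *: br h (chart c) x = (\sum_(i < m + m) tnth c (lift ord0 i) * beta i) *: Z.
  rewrite brE scalerA; congr (_ *: _).
  rewrite /Defs.chart br_addl br_scalel hZ scaler0 add0r br_suml ip_suml mulr_sumr.
  by apply: eq_bigr => i _; rewrite br_scalel ip_scalel /beta mulrCA [2^-1 * _]mulrC.
rewrite {1}ax /Defs.chart /phi tnth_consRn0 /psi.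
have -> : \sum_(i < m + m) tnth (tl c) i * beta i = \sum_(i < m + m) tnth c (lift ord0 i) * beta
  i.
  by apply: eq_bigr => i _; rewrite tnth_mktuple.
have -> : \sum_(i < m + m) tnth (consRn (tau (tl c),
  tnth c ord0 + (tnth a ord0 + \sum_(i < m + m) tnth c (lift ord0 i) * beta i))) (lift ord0 i) *:
  frameX i =
   \sum_(i < m + m) tnth c (lift ord0 i) *: frameX i + \sum_(i < m + m) tnth a (lift ord0 i) *:
     frameX i.
  by rewrite -big_split; apply: eq_bigr => i _; rewrite tnth_consRnS !tnth_mktuple scalerDl.
rewrite !scalerDl.
set S1 := \sum_(i < m + m) _; set S2 := \sum_(i < m + m) _; set S3 := \sum_(i < m + m) _.
by rewrite -!addrA; congr (_ + _); rewrite addrCA; congr (_ + _);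
  rewrite addrCA addrA addrC [S1 + _]addrC !addrA addrAC.
Qed.

Lemma aeG_mulG x (P : G -> Prop) : aeG Z U V P -> aeG Z U V (fun y => P (mulG h y x)).
Proof.
move=> hP; have [phi mp e] := mulG_chart x.
by apply: filterS (measure_preserving_negligible mp hP) => c; rewrite e.
Qed.

(** Shown directly in the chart: adding [r *: Z] is not yet known to be the right multiplication by
    it, which would require [y, r Z] = 0. *)
Lemma aeG_shift (r : R) (P : G -> Prop) :
  aeG Z U V P -> aeG Z U V (fun y => P (y + r *: Z)).
Proof.
move=> hP.
pose phi (c : Rn R (m + m).+1) : Rn R (m + m).+1 :=
  [tuple tnth c j + (if j == ord0 then r else 0) | j < (m + m).+1].
have mp : measure_preserving volR volR phi.
  exact: (measure_preserving_translationRn (fun j => if j == ord0 then r else 0)).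
apply: filterS (measure_preserving_negligible mp hP) => c.
suff -> : chart (phi c) = chart c + r *: Z by [].
rewrite /Defs.chart tnth_mktuple eqxx scalerDl addrAC; congr (_ + _ + _).
by apply: eq_bigr => i _; rewrite tnth_mktuple addr0.
Qed.

End chart.

(** * The dictionary between fields in H and functions on R^m *)

Section identification.
Variables (R : realType) (m : nat) (h : heisenberg R m).
Variables (Gam : set (lie R m)) (eps : lie R m -> R[i]) (F : set (lie R m)).
Variables (Z : lie R m) (alpha : {scalar lie R m}).
Variables (U V : 'I_m -> lie R m) (d : 'I_m -> R).
Variables (H : set (lie R m -> R[i])) (T : (Rn R m -> R[i]) -> (lie R m -> R[i])).
Hypothesis hZ : lie_center h Z.
Hypothesis hZ1 : ip h Z Z = 1.
Hypothesis halpha : alpha Z != 0.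
Hypothesis hbasis : adapted_basis h Z alpha U V d.
Hypothesis hF : fundamental_domain h Z U V Gam F.
Hypothesis hH : irreducible_subspace h Z U V Gam F eps H.
Hypothesis hT : unitary_identification h Z U V F alpha H T.
Local Notation C := R[i].
Local Notation G := (lie R m).
Local Notation lebm := (lebesgueRn R m).
Local Notation volR := (lebesgueRn R (m + m).+1).
Local Notation chart := (chart Z U V).
Local Notation aeG := (aeG Z U V).
Local Notation L2eps := (L2eps h Z U V Gam eps).
Local Notation dotG := (dotG Z U V F).
Local Notation sqnormG := (sqnormG Z U V F).
Local Notation rho := (rho h).
Local Notation pi_ := (pi_alpha h Z U V alpha).
Local Open Scope complex_scope.
Implicit Types (phi psi : G -> C) (f g : Rn R m -> C) (x y : G).

Lemma aeGS (P Q : G -> Prop) : (forall y, P y -> Q y) -> aeG P -> aeG Q.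
Proof. by move=> PQ; apply: filterS => c; exact: PQ. Qed.

Lemma aeGS2 (P Q S : G -> Prop) : (forall y, P y -> Q y -> S y) -> aeG P -> aeG Q -> aeG S.
Proof. by move=> PQ; apply: filterS2 => c; exact: PQ. Qed.

Lemma aeGW (P : G -> Prop) : (forall y, P y) -> aeG P.
Proof. by move=> hP; apply: aeW => c. Qed.

Lemma aeG_rho x (P : G -> Prop) : aeG P -> aeG (fun y => P (mulG h y x)).
Proof. exact: (aeG_mulG hZ hZ1 hbasis). Qed.

Lemma H_L2eps phi : H phi -> L2eps phi.
Proof. by have [[[sH _ _] _ _ _] _ _] := hH; exact: sH. Qed.

Lemma H_lin (c : C) phi psi : H phi -> H psi -> H (fun y => c * phi y + psi y).
Proof. by have [[[_ _ lH] _ _ _] _ _] := hH; exact: lH. Qed.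

Lemma H_ae phi psi : H phi -> L2eps psi -> aeG (fun y => phi y = psi y) -> H psi.
Proof. by have [[_ aH _ _] _ _] := hH; exact: aH. Qed.

Lemma H_rho x phi : H phi -> H (rho x phi).
Proof. by have [[_ _ _ rH] _ _] := hH; exact: rH. Qed.

Lemma H_closed phi : L2eps phi ->
  (forall e : R, 0 < e -> exists2 psi, H psi & sqnormG (fun y => phi y - psi y) < e) -> H phi.
Proof. by have [[_ _ cH _] _ _] := hH; exact: cH. Qed.

(** A relation rather than the function [T], so that the almost everywhere identities satisfied by
    [T] become closure rules, under which whole expressions can be transported. *)
Definition rep phi f := [/\ H phi, L2C lebm f & aeG (fun y => phi y = T f y)].

Lemma rep_T f : L2C lebm f -> rep (T f) f.
Proof. by move=> lf; have [[TH _ _] _ _ _] := hT; split => //; [exact: TH|exact: aeGW]. Qed.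

Lemma rep_lin (c : C) phi psi f g : rep phi f -> rep psi g ->
  rep (fun y => c * phi y + psi y) (fun t => c * f t + g t).
Proof.
move=> [Hphi lf ef] [Hpsi lg eg]; have [[_ _ Tl] _ _ _] := hT; split.
- exact: H_lin.
- exact/(L2CD _ lg)/L2CZ.
- by apply: aeGS2 (aeGS2 (fun y a b => conj a b) ef eg) (Tl c f g lf lg) => y [-> ->] ->.
Qed.

Lemma rep0 : rep (fun=> 0) (fun=> 0).
Proof.
have H0 : H (fun=> 0) by have [[[_ H0 _] _ _ _] _ _] := hH.
have l0 : L2C lebm (fun=> 0 : C) by exact: L2C_0.
split => //; have [_ _ eT] := rep_lin (-1) (rep_T l0) (rep_T l0).
have e0 : (fun _ : Rn R m => -1 * 0 + 0 : C) = fun=> 0 by apply/funext => t; rewrite mulr0 addr0.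
by apply: aeGS eT => y; rewrite e0 mulN1r addNr.
Qed.

Lemma repD phi psi f g : rep phi f -> rep psi g ->
  rep (fun y => phi y + psi y) (fun t => f t + g t).
Proof.
move=> r1 r2; have := rep_lin 1 r1 r2.
by under eq_fun do rewrite mul1r; under [X in rep _ X]eq_fun do rewrite mul1r.
Qed.

Lemma repZ c phi f : rep phi f -> rep (fun y => c * phi y) (fun t => c * f t).
Proof.
move=> r1; have := rep_lin c r1 rep0.
by under eq_fun do rewrite addr0; under [X in rep _ X]eq_fun do rewrite addr0.
Qed.

Lemma repB phi psi f g : rep phi f -> rep psi g ->
  rep (fun y => phi y - psi y) (fun t => f t - g t).
Proof.
move=> r1 r2; have := repD r1 (repZ (-1) r2).
by under eq_fun do rewrite mulN1r; under [X in rep _ X]eq_fun do rewrite mulN1r.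
Qed.

Lemma rep_sum I (r : seq I) (P : pred I) (phi_ : I -> G -> C) (f_ : I -> Rn R m -> C) :
  (forall i, P i -> rep (phi_ i) (f_ i)) ->
  rep (fun y => \sum_(i <- r | P i) phi_ i y) (fun t => \sum_(i <- r | P i) f_ i t).
Proof.
move=> rf; elim: r => [|i r IH].
  rewrite (_ : (fun y => _) = fun=> 0); last by apply/funext => y; rewrite big_nil.
  rewrite (_ : (fun t => _) = fun=> 0); last by apply/funext => y; rewrite big_nil.
  exact: rep0.
rewrite (_ : (fun y => _) = fun y =>
  if P i then phi_ i y + \sum_(i <- r | P i) phi_ i y else \sum_(i <- r | P i) phi_ i y);
  last by apply/funext => y; rewrite big_cons.
rewrite (_ : (fun t => _) = fun t =>
  if P i then f_ i t + \sum_(i <- r | P i) f_ i t else \sum_(i <- r | P i) f_ i t);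
  last by apply/funext => t; rewrite big_cons.
by case Pi: (P i) => //; apply: repD => //; exact: rf.
Qed.

Lemma rep_ae phi psi f : rep phi f -> L2eps psi -> aeG (fun y => phi y = psi y) -> rep psi f.
Proof.
move=> [Hphi lf ef] Lpsi e; split=> //; first exact: (H_ae Hphi).
by apply: aeGS2 e ef => y -> ->.
Qed.

Lemma rep_eq phi psi f : rep phi f -> rep psi f -> aeG (fun y => phi y = psi y).
Proof. by move=> [_ _ e1] [_ _ e2]; apply: aeGS2 e1 e2 => y -> ->. Qed.

Lemma rep_exists phi : H phi -> exists f, rep phi f.
Proof.
move=> Hphi; have [_ _ Ts _] := hT; have [f lf ef] := Ts _ Hphi.
by exists f; split=> //; apply: aeGS ef => y ->.
Qed.

Lemma rep_rho x phi f : rep phi f -> rep (rho x phi) (pi_ x f).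
Proof.
move=> [Hphi lf ef]; split; [exact: H_rho|exact: pi_alpha_L2|].
have [_ _ _ Ti] := hT.
by apply: aeGS2 (aeG_rho x ef) (Ti x f lf) => y e1 <-; rewrite /Defs.rho e1.
Qed.

Lemma H_measurable phi : H phi -> measurable_complex (phi \o chart : Rn R (m + m).+1 -> C).
Proof. by move=> /H_L2eps[]. Qed.

Lemma rep_dot phi psi f g : rep phi f -> rep psi g -> dotG phi psi = dotL2 lebm setT f g.
Proof.
move=> [Hphi lf ef] [Hpsi lg eg]; have [_ Tu _ _] := hT.
have [[TH _ _] _ _ _] := hT.
rewrite -Tu//; apply: ae_eq_dotL2 => //; try exact: H_measurable.
- by case: hF.
- exact/H_measurable/TH.
- exact/H_measurable/TH.
Qed.

Lemma rep_sqnorm phi f : rep phi f -> sqnormG phi = nrm2 lebm f.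
Proof. by move=> r; rewrite /Defs.sqnormG (rep_dot r r) Re_dotL2. Qed.

Lemma rep_rho_star X phi psi f g : rep phi f -> rep psi g ->
  pi_deriv h Z U V alpha X f g -> rho_star h Z U V Gam F eps X phi psi.
Proof.
move=> r1 r2 dfg; split; [by have [/H_L2eps] := r1|by have [/H_L2eps] := r2|].
rewrite (_ : (fun s => _) = fun s => nrm2 lebm (pi_quotient h Z U V alpha X f g s))//.
apply/funext => s; apply: rep_sqnorm; apply: repB => //.
rewrite (_ : (fun y => _) = fun y => s%:C^-1 * (rho (s *: X) phi y - phi y)); last first.
  by apply/funext => y; rewrite mulrC.
rewrite (_ : (fun t => _) = fun t => s%:C^-1 * (pi_ (s *: X) f t - f t)); last first.
  by apply/funext => y; rewrite mulrC.
by apply/repZ/repB => //; exact: rep_rho.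
Qed.

(** * Linearity of the bracket on the right, deduced from the identification *)

Definition om x y : R := ip h (br h x y) Z.

Lemma br_om x y : br h x y = om x y *: Z.
Proof. exact: (brE hZ hZ1). Qed.

Lemma om_scalel r x y : om (r *: x) y = r * om x y.
Proof. by rewrite /om br_scalel ip_scalel. Qed.

Lemma om_addl x x' y : om (x + x') y = om x y + om x' y.
Proof. by rewrite /om br_addl ip_addl. Qed.

Lemma om_Zl y : om Z y = 0.
Proof. by rewrite /om hZ ip_0l. Qed.

Lemma om_0l y : om 0 y = 0.
Proof. by rewrite /om br_0l ip_0l. Qed.

Lemma alpha_br x y : alpha (br h x y) = alpha Z * om x y.
Proof. by rewrite br_om linearZ /= mulrC. Qed.

Let b j := 2 * pi * d j.

Lemma d_gt0 j : 0 < d j. Proof. by have [] := hbasis. Qed.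

Lemma b_gt0 j : 0 < b j.
Proof. by rewrite !mulr_gt0// ?pi_gt0// d_gt0. Qed.

Lemma hfun_nrm2_gt0 q : 0 < nrm2 lebm (hfun b q).
Proof.
rewrite /hfun (tens_L2 _).2; last by move=> j; exact/gauss_pgaussC/b_gt0.
apply: prodr_gt0 => j _; have := shermite_norm_gt0 (b_gt0 j) (q j).
congr (_ < _); congr (Rintegral _ _ _); apply/funext => t.
by rewrite sqmod_real expr2.
Qed.

Lemma rep_null phi f : rep phi f -> aeG (fun y => phi y = 0) -> nrm2 lebm f = 0.
Proof.
move=> r e.
have r0 := rep_ae r (H_L2eps (let: And3 h0 _ _ := rep0 in h0)) e.
by rewrite -(rep_sqnorm r0) (rep_sqnorm rep0) nrm2_0.
Qed.

(* [heisenberg] only asks the bracket to be linear on the left.  The linearity on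
   the right which is needed, that of r |-> [U_i, r V_j], is forced by T: the two
   orders of the action of x and x' differ by a central translation in H and by a
   scalar in L^2(R^m), so that the central translations act by scalars, which must
   be consistent. *)
Definition central_char (s : R) (c : C) :=
  forall f, L2C lebm f -> aeG (fun y => T f (y + s *: Z) = c * T f y).

(** Tested on a Hermite function: its norm is positive, so its image under [T] is not null. *)
Lemma central_char_inj s c c' : central_char s c -> central_char s c' -> c = c'.
Proof.
move=> h1 h2; pose q : {ffun 'I_m -> nat} := [ffun=> 0%N].
have lf : L2C lebm (hfun b q) by apply: hfun_L2; exact: b_gt0.
have := rep_null (repZ (c - c') (rep_T lf)).
rewrite nrm2Z// => hn.
have /hn /eqP : aeG (fun y => (c - c') * T (hfun b q) y = 0).
  by apply: aeGS2 (h1 _ lf) (h2 _ lf) => y e1 e2; rewrite mulrBl -e1 -e2 subrr.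
rewrite mulf_eq0 [X in _ || X]gt_eqF ?hfun_nrm2_gt0// orbF => /eqP/sqmod_eq0/eqP.
by rewrite subr_eq0 => /eqP.
Qed.

Lemma central_char_comm x x' :
  central_char ((om x x' - om x' x) / 2)
    (expi (2 * pi * \sum_(j < m) (ucoord h U x j * vform h U V alpha x' j -
                                  ucoord h U x' j * vform h U V alpha x j))).
Proof.
move=> f lf; set c := expi _; set s := _ / 2.
have [g1 lg1 e1] := pi_alpha_surj h Z U V alpha x' lf.
have [g lg e2] := pi_alpha_surj h Z U V alpha x lg1.
have r1 := rep_rho x (rep_rho x' (rep_T lg)).
have r2 := rep_rho x' (rep_rho x (rep_T lg)).
rewrite e2 e1 in r2.
have e3 : pi_ x (pi_ x' g) = fun t => c * f t.
  by apply/funext => t; rewrite pi_alpha_comm e2 e1.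
rewrite e3 in r1.
have a1 := rep_eq r1 (repZ c (rep_T lf)).
have a2 : aeG (fun y => rho x' (rho x (T g)) (y + s *: Z) = T f (y + s *: Z)).
  by have := aeG_shift s (rep_eq r2 (rep_T lf)).
apply: aeGS2 a1 a2 => y <- <-; rewrite /Defs.rho; congr (T g _).
(* By this formula the products of [y], [x], [x'] in the two orders differ by
   [(om x x' - om x' x) / 2] times [Z]. *)
have E u v w : mulG h (mulG h u v) w = u + v + w + (om u v / 2 + (om u w + om v w) / 2) *: Z.
  rewrite /mulG !br_addl br_scalel br_2step scaler0 addr0 !br_om.
  rewrite -[om u w *: Z + _]scalerDl !scalerA [u + v + _ + w]addrAC -[LHS]addrA.
  by rewrite -[X in _ + X = _]scalerDl; congr (_ + _ *: _); ring.
rewrite !E !om_addl !om_scalel !om_Zl.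
rewrite [y + _ + x']addrAC [y + x' + _ + x]addrAC [y + x' + x]addrAC.
rewrite -[LHS]addrA -[X in _ + X = _]scalerDl.
by congr (_ + _ *: _); rewrite /s; field.
Qed.

Lemma zcharZ c : zchar h Z alpha (c *: Z) = alpha Z * c.
Proof. by rewrite /zchar ip_scalel hZ1 mulr1. Qed.

Lemma ucoordZ c j : ucoord h U (c *: Z) j = 0.
Proof. by rewrite /ucoord ip_scalel (ip_ZU hbasis) mulr0. Qed.

Lemma ucoord0 j : ucoord h U 0 j = 0.
Proof. by rewrite /ucoord ip_0l. Qed.

Lemma ucoordU r i j : ucoord h U (r *: U i) j = if j == i then r else 0.
Proof. by rewrite /ucoord ip_scalel (ip_UU hbasis) eq_sym; case: eqP; rewrite ?mulr1 ?mulr0. Qed.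

Lemma ucoordV r i j : ucoord h U (r *: V i) j = 0.
Proof. by rewrite /ucoord ip_scalel ip_sym (ip_UV hbasis) mulr0. Qed.

Lemma vform0_of x j : (forall i, ip h x (V i) = 0) ->
  vform h U V alpha x j = alpha Z * om (U j) 0.
Proof.
move=> hx; rewrite /vform -alpha_br; congr (alpha (br h _ _)).
by apply: big1 => i _; rewrite hx scale0r.
Qed.

Lemma vformU r i j : vform h U V alpha (r *: U i) j = alpha Z * om (U j) 0.
Proof. by apply: vform0_of => a; rewrite ip_scalel (ip_UV hbasis) mulr0. Qed.

Lemma vformZ c j : vform h U V alpha (c *: Z) j = alpha Z * om (U j) 0.
Proof. by apply: vform0_of => a; rewrite ip_scalel (ip_ZV hbasis) mulr0. Qed.

Lemma vform0 j : vform h U V alpha 0 j = alpha Z * om (U j) 0.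
Proof. by apply: vform0_of => a; rewrite ip_0l. Qed.

Lemma vformV r i j : vform h U V alpha (r *: V i) j = alpha Z * om (U j) (r *: V i).
Proof.
rewrite /vform -alpha_br; congr (alpha (br h _ _)).
rewrite (bigD1 i)//= big1 ?addr0; first by rewrite ip_scalel (ip_VV hbasis) eqxx mulr1.
by move=> a ai; rewrite ip_scalel (ip_VV hbasis) eq_sym (negbTE ai) mulr0 scale0r.
Qed.

Lemma alpha_om_UV i : alpha Z * om (U i) (V i) = d i.
Proof. by rewrite -alpha_br; have [_ _ ->] := hbasis. Qed.

Lemma not_trivial_char (i : 'I_m) : ~ (forall s, central_char s 1).
Proof.
(* Chosen so that the commutation phase of [r *: U i] and [V i] is 2 pi r d_i = pi, giving the
   scalar -1. *)
move=> h1; pose r := (2 * d i)^-1.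
have := central_char_comm (r *: U i) (1 *: V i).
rewrite (bigD1 i)//= big1 ?addr0 => [|j ji];
  last by rewrite ucoordU ucoordV (negbTE ji) !mul0r subr0.
rewrite ucoordU ucoordV eqxx mul0r subr0 vformV scale1r alpha_om_UV => hc.
have := central_char_inj (h1 _) hc.
have -> : 2 * pi * (r * d i) = pi by rewrite /r; field; rewrite gt_eqF ?d_gt0.
rewrite /expi cospi => /(congr1 (@complex.Re R)) /= /eqP.
by rewrite -subr_eq0 opprK -[1 + 1]/(2%:R) pnatr_eq0.
Qed.

(** Otherwise the multiples of V_i, commuted with 0, produce every central translation, while the
    commutation phase is trivial because both U-coordinates vanish. *)
Lemma om_V0 i : om (V i) 0 = 0.
Proof.
apply/eqP/negPn/negP => o0; apply: (not_trivial_char i) => s.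
have := central_char_comm ((2 * s / om (V i) 0) *: V i) 0.
rewrite big1 ?mulr0 ?expi0 => [|j _]; last by rewrite ucoordV ucoord0 !mul0r subr0.
by rewrite om_0l subr0 om_scalel divfK// [2 * s]mulrC mulfK.
Qed.

Lemma om_y0 y : om y 0 = \sum_(j < m) ucoord h U y j * om (U j) 0.
Proof.
have [c ->] := chart_surj hZ1 hbasis y.
rewrite /Defs.chart om_addl om_scalel om_Zl mulr0 add0r big_split_ord /=.
have sumE (I : finType) (f : I -> G) w : om (\sum_i f i) w = \sum_i om (f i) w.
  by rewrite /om br_suml ip_suml.
rewrite om_addl !sumE [X in _ + X]big1 ?addr0; last first.
  by move=> i _; rewrite frameX_rshift om_scalel om_V0 mulr0.
apply: eq_bigr => j _; rewrite frameX_lshift om_scalel; congr (_ * _).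
rewrite /ucoord ip_addl ip_scalel (ip_ZU hbasis) mulr0 add0r ip_addl !ip_suml.
rewrite [X in _ + X]big1 ?addr0 => [|i _]; last first.
  by rewrite frameX_rshift ip_scalel ip_sym (ip_UV hbasis) mulr0.
rewrite (bigD1 j)//= big1 ?addr0 => [|i ij].
  by rewrite frameX_lshift ip_scalel (ip_UU hbasis) eqxx mulr1.
by rewrite frameX_lshift ip_scalel (ip_UU hbasis) (negbTE ij) mulr0.
Qed.

(** The action of [c *: Z] is compared with that of 0, which need not be the identity while [y, 0]
    is unknown; under the assumption the two differ exactly by the shift along [Z]. *)
Lemma central_char_of_om (c : R) : (forall y, om y (c *: Z) = om y 0) ->
  central_char c (expi (2 * pi * (alpha Z * c))).
Proof.
move=> hc f lf; set a := expi _.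
have [g lg e] := pi_alpha_surj h Z U V alpha 0 lf.
have r1 := rep_rho 0 (rep_T lg); rewrite e in r1.
have r2 := rep_rho (c *: Z) (rep_T lg).
have e2 : pi_ (c *: Z) g = fun t => a * f t.
  apply/funext => t; rewrite -e !pi_alphaE mulrA -expiD.
  have -> : translate (ucoord h U (c *: Z)) t = translate (ucoord h U 0) t.
    by apply: eq_from_tnth => j; rewrite !tnth_mktuple ucoordZ ucoord0.
  congr (expi _ * _); rewrite /pi_phase -mulrDr zcharZ; congr (_ * _).
  rewrite [zchar h Z alpha 0](_ : _ = 0) ?add0r; last by rewrite /zchar ip_0l mulr0.
  by congr (_ + _); apply: eq_bigr => j _; rewrite ucoordZ ucoord0 vformZ vform0.
rewrite e2 in r2.
have a1 := rep_eq r2 (repZ a (rep_T lf)).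
have a2 : aeG (fun y => rho 0 (T g) (y + c *: Z) = T f (y + c *: Z)).
  by have := aeG_shift c (rep_eq r1 (rep_T lf)).
apply: aeGS2 a1 a2 => y <- <-; rewrite /Defs.rho; congr (T g _).
by rewrite /mulG !br_om om_addl om_scalel om_Zl mulr0 addr0 hc addr0.
Qed.

(** Commuting [c *: Z] with the multiples of [y] gives the same central translation two scalars,
    exponentials linear in a free parameter [r]; their frequencies must agree. *)
Lemma om_yZ_of (k : R) : (forall c, central_char c (expi (2 * pi * (k * c)))) ->
  forall c y, k / 2 * om y (c *: Z) = alpha Z * om y 0.
Proof.
move=> hk c y; apply: (mulfI (lt0r_neq0 (pi_gt0 R))); apply: expi_injZ => r.
have := central_char_comm (c *: Z) ((- (r / 2)) *: y).
have -> : (om (c *: Z) (- (r / 2) *: y) - om (- (r / 2) *: y) (c *: Z)) / 2 = r / 4 * om y (c *: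
  Z).
  by rewrite (om_scalel c) om_Zl (om_scalel (- (r / 2))); field.
have -> : 2 * pi * (\sum_(j < m) (ucoord h U (c *: Z) j * vform h U V alpha (- (r / 2) *: y) j -
      ucoord h U (- (r / 2) *: y) j * vform h U V alpha (c *: Z) j)) = r * (pi * (alpha Z * om y
        0)).
  rewrite om_y0 !mulr_sumr; apply: eq_bigr => j _.
  by rewrite ucoordZ vformZ /ucoord ip_scalel; field.
by move=> /(central_char_inj (hk _)) <-; congr expi; field.
Qed.

(** Otherwise commuting the multiples of U_i with 0 gives central characters of slope 2 alpha(Z).
    For this slope [om_yZ_of] yields [y, c Z] = [y, 0], and [central_char_of_om] then gives the
    slope alpha(Z), a contradiction. *)
Lemma om_U0 i : om (U i) 0 = 0.
Proof.
apply/eqP/negPn/negP => o0.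
have a0 : om (U i) 0 != 0 by [].
have h2 s : central_char s (expi (2 * pi * (2 * alpha Z * s))).
  have := central_char_comm ((2 * s / om (U i) 0) *: U i) 0.
  rewrite (bigD1 i)//= big1 ?addr0 => [|j ji]; last first.
    by rewrite ucoordU ucoord0 (negbTE ji) !mul0r subr0.
  rewrite ucoordU ucoord0 eqxx mul0r subr0 vform0 om_0l subr0 om_scalel divfK// [2 * s]mulrC
    mulfK//.
  by congr (central_char _ (expi _)); field; rewrite ?halpha.
have h1 c : central_char c (expi (2 * pi * (alpha Z * c))).
  apply: central_char_of_om => y; apply: (mulfI halpha).
  by rewrite -[RHS](om_yZ_of h2 c); field.
have : 2 * pi * (2 * alpha Z) = 2 * pi * alpha Z.
  apply: expi_injZ => r; have := central_char_inj (h2 r) (h1 r).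
  by congr (expi _ = expi _); ring.
move=> /(mulfI (lt0r_neq0 (mulr_gt0 (ltr0n _ 2) (pi_gt0 R)))) /eqP.
by rewrite -subr_eq0 mulrDl mul1r addrK (negbTE halpha).
Qed.

Lemma om_0r y : om y 0 = 0.
Proof. by rewrite om_y0 big1// => j _; rewrite om_U0 mulr0. Qed.

(** Now that [y, 0] = 0, the commutation phase of [c *: Z] with any multiple of [y] is trivial; a
    nonzero bracket would make all central characters trivial. *)
Lemma om_Zr (i : 'I_m) y c : om y (c *: Z) = 0.
Proof.
apply/eqP/negPn/negP => o0; apply: (not_trivial_char i) => s.
have := central_char_comm (c *: Z) ((- (2 * s / om y (c *: Z))) *: y).
rewrite big1 => [|j _]; last by rewrite ucoordZ vformZ om_0r !mulr0 mul0r subr0.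
rewrite mulr0 expi0; congr (central_char _ _).
by rewrite (om_scalel c) om_Zl om_scalel; field; rewrite ?o0.
Qed.

Lemma central_charE (i : 'I_m) c : central_char c (expi (2 * pi * (alpha Z * c))).
Proof. by apply: central_char_of_om => y; rewrite (om_Zr i) om_0r. Qed.

(** The scalar given by the Weyl relation for [s *: U i] and [r *: V j] must be the known central
    character. This is the hypothesis of [expi_bilinear] for r |-> alpha(Z) [om] (U_i, r V_j) and s
    |-> alpha(Z) [om] (V_j, s U_i). *)
Lemma om_UV_linear i j r : om (U i) (r *: V j) = r * om (U i) (V j).
Proof.
have H0 s r' : expi (pi * (s * (alpha Z * om (U i) (r' *: V j)) + r' * (alpha Z * om (V j) (s *:
  U i)))) = 1.
  have := central_char_comm (s *: U i) (r' *: V j).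
  rewrite (bigD1 i)//= big1 ?addr0 => [|a ai]; last first.
    by rewrite ucoordU ucoordV (negbTE ai) !mul0r subr0.
  rewrite ucoordU ucoordV eqxx mul0r subr0 vformV => h1.
  have e := central_char_inj (central_charE i _) h1.
  move: e; set x := 2 * pi * (s * _) => e.
  have : expi (x - 2 * pi * (alpha Z * ((om (s *: U i) (r' *: V j) - om (r' *: V j) (s *: U i)) /
    2))) = 1.
    by rewrite expiD -e -expiD addrN expi0.
  by move=> <-; rewrite !om_scalel /x; congr expi; field.
apply: (mulfI halpha); rewrite (expi_bilinear H0 r) scale1r; ring.
Qed.

Lemma vformV_linear r i j : vform h U V alpha (r *: V i) j = if j == i then r * d i else 0.
Proof.
rewrite vformV om_UV_linear mulrCA -alpha_br; have [_ _ hd ho _] := hbasis.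
by case: eqP => [->|/eqP ji]; rewrite ?hd// ho// mulr0.
Qed.

Lemma vformU0 r i j : vform h U V alpha (r *: U i) j = 0.
Proof. by rewrite vformU om_0r mulr0. Qed.

Lemma vformZ0 c j : vform h U V alpha (c *: Z) j = 0.
Proof. by rewrite vformZ om_0r mulr0. Qed.

Lemma zcharU r i : zchar h Z alpha (r *: U i) = 0.
Proof. by rewrite /zchar ip_scalel ip_sym (ip_ZU hbasis) !mulr0. Qed.

Lemma zcharV r i : zchar h Z alpha (r *: V i) = 0.
Proof. by rewrite /zchar ip_scalel ip_sym (ip_ZV hbasis) !mulr0. Qed.

Lemma happrox_hcomb s : happrox b (hcomb b s).
Proof.
move=> e e0; exists s.
by under eq_fun do rewrite subrr; rewrite nrm2_0.
Qed.

Lemma rep_unique phi f g : rep phi f -> rep phi g -> nrm2 lebm (fun t => f t - g t) = 0.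
Proof.
move=> r1 r2; apply: rep_null (repB r1 r2) _.
by apply: aeGW => y; rewrite subrr.
Qed.

(* By irreducibility: the fields that are limits of combinations of Hermite
   functions form a nonzero closed invariant subspace. *)
Lemma rep_happrox phi f : rep phi f -> happrox b f.
Proof.
move=> rf; pose K : set (G -> C) := [set phi | exists2 f, rep phi f & happrox b f].
have [_ _ irr] := hH.
have cK : closed_invariant_subspace h Z U V Gam F eps K.
  split; first split.
  - by move=> u [g [Hu _ _] _]; exact: H_L2eps.
  - exists (fun=> 0); first exact: rep0.
    rewrite (_ : (fun=> 0) = hcomb b [::]); first exact: happrox_hcomb.
    by apply/funext => t; rewrite /hcomb big_nil.
  - move=> c u v [g rg ag] [k rk ak].
    exists (fun t => c * g t + k t); first exact: rep_lin.
    have [_ lg _] := rg; have [_ lk _] := rk.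
    by apply: happroxD => //; [exact: b_gt0|exact: L2CZ|exact: happroxZ b_gt0 _ _ _ _].
  - by move=> u v [g rg ag] Lv e; exists g => //; exact: rep_ae e.
  - move=> u Lu hu.
    have Hu : H u.
      by apply: H_closed => // e /hu[v [g [Hv _ _] _]] ?; exists v.
    have [g rg] := rep_exists Hu; exists g => //.
    have [_ lg _] := rg.
    apply: (happrox_trans b_gt0 lg) => e /hu[v [k rk ak]] uv.
    exists k; have [_ lk _] := rk; split=> //.
    by rewrite -(rep_sqnorm (repB rg rk)).
  - move=> x u [g rg ag]; exists (pi_ x g); first exact: rep_rho.
    by have [_ lg _] := rg; apply: happrox_pi_alpha => //; exact: b_gt0.
have KH : K `<=` H by move=> u [g [Hu _ _] _].
have [nK|HK] := irr K cK KH.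
  exfalso; pose q : {ffun 'I_m -> nat} := [ffun=> 0%N].
  have lf : L2C lebm (hfun b q) by apply: hfun_L2; exact: b_gt0.
  have Kq : K (T (hfun b q)).
    exists (hfun b q); first exact: rep_T.
    rewrite (_ : hfun b q = hcomb b [:: (1, q)]); first exact: happrox_hcomb.
    by apply/funext => t; rewrite /hcomb big_seq1 mul1r.
  by have := hfun_nrm2_gt0 q; rewrite (rep_null (rep_T lf) (nK _ Kq)) ltxx.
have [Hphi lf _] := rf; have [g rg ag] := HK _ Hphi; have [_ lg _] := rg.
apply: (happrox_trans b_gt0 lf) => e e0; exists g; split => //.
by rewrite (rep_unique rf rg).
Qed.

(** * The Dirac operator on the spaces U_p *)

Implicit Types (p : {ffun 'I_m -> nat}) (k l : tidx m) (c : tidx m -> C).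

Definition ubar_poly p l (j : 'I_m) : {poly R} := hfactor (b j) (p j) (l j != 0).

Definition ubar_fun p l : Rn R m -> C := ptens b (ubar_poly p l).

Lemma ubar_fun_L2 p l : L2C lebm (ubar_fun p l).
Proof. by apply: ptens_L2; exact: b_gt0. Qed.

Lemma ubarE p l t k : ubar d p l t k = (k == l)%:R * ubar_fun p l t.
Proof.
rewrite /ubar /ufun vvecE mulrA -rmorphM mulrC; congr (_ * _).
rewrite big_mkcond -big_split rmorph_prod; apply: eq_bigr => j _; congr (_%:C).
rewrite /ubar_poly /Evec; have [_|_] := eqVneq (l j) 0.
  transitivity (hermite (Posz (p j)) (Num.sqrt (b j) * tnth t j)).
    by rewrite -[RHS]mul1r -{2}[Posz (p j)]addr0.
  by rewrite (shermiteE (b_gt0 j)).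
transitivity (Num.sqrt (2 * (p j)%:R) * hermite (Posz (p j) + -1) (Num.sqrt (b j) * tnth t j)).
  by [].
rewrite /hfactor /=; case: (p j) => [|n].
  (* When p_j = 0 and l_j = -1 the Hermite index is -1; the square root vanishes as well, on both
     sides. *)
  have r0 : Num.sqrt (2 * 0%:R) = 0 :> R by rewrite mulr0 sqrtr0.
  by rewrite r0 mul0r scale0r /pgauss horner0 mul0r.
rewrite (_ : Posz n.+1 + -1 = Posz n); last by rewrite -addn1 PoszD addrK.
by rewrite (shermiteE (b_gt0 j)) /pgauss hornerZ mulrA.
Qed.

(** Flipping l_j changes only the factor of index [j], where [hfactor_ladder] applies. As b_j = 2 pi
    d_j, its coefficient sqrt(b_j) sqrt(2 p_j) is 2 sqrt(pi d_j p_j). *)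
Lemma ubar_fun_ladder p l (j : 'I_m) t :
  ptens b (fun i => if i == j then dpgauss (b j) (ubar_poly p l j) else ubar_poly p l i) t
    + (sign R l j * (b j * tnth t j))%:C * ubar_fun p l t
  = - (sign R l j * (2 * Num.sqrt (pi * d j * (p j)%:R)))%:C * ubar_fun p (flip j l) t.
Proof.
have E q : ptens b q t = (pgauss (b j) (q j) (tnth t j))%:C *
    \prod_(i < m | i != j) (pgauss (b i) (q i) (tnth t i))%:C.
  by rewrite /ptens /tens (bigD1 j).
rewrite /ubar_fun !E eqxx.
set P := \prod_(i < m | i != j) _; set P1 := \prod_(i < m | i != j) _; set P2 :=
  \prod_(i < m | i != j) _.
have -> : P = P1 by apply: eq_bigr => i ij; rewrite (negbTE ij).
have -> : P2 = P1 by apply: eq_bigr => i ij; rewrite /ubar_poly flipE (negbTE ij).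
have := hfactor_ladder (b_gt0 j) (p j) (l j != 0) (tnth t j).
have -> : Num.sqrt (b j) * Num.sqrt (2 * (p j)%:R) = 2 * Num.sqrt (pi * d j * (p j)%:R).
  have pd0 : 0 <= pi * d j * (p j)%:R :> R by rewrite !mulr_ge0 ?pi_ge0// ltW// d_gt0.
  rewrite -sqrtrM ?(ltW (b_gt0 j))//.
  have -> : b j * (2 * (p j)%:R) = (pi * d j * (p j)%:R) * 2 ^+ 2 by rewrite /b; ring.
  by rewrite (sqrtrM _ pd0) sqrtr_sqr ger0_norm// mulrC.
have -> : (-1) ^+ (l j != 0) = sign R l j by rewrite /sign; case: eqP.
have -> : ~~ (l j != 0) = (flip j l j != 0) by rewrite flipE eqxx /flip2; case: eqP.
rewrite -/(ubar_poly p l j) -/(ubar_poly p (flip j l) j) => /(congr1 (@real_complex R)) e.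
rewrite mulrA -[(sign R l j * _)%:C * _]rmorphM -mulrDl -[X in X * P1]rmorphD /= e.
by rewrite !rmorphM !rmorphN; ring.
Qed.

Lemma ubar_fun_mulX p k (j : 'I_m) t :
  (b j * tnth t j)%:C * ubar_fun p k t =
  ptens b (fun i => if i == j then b j *: ('X * ubar_poly p k j) else ubar_poly p k i) t.
Proof.
rewrite /ubar_fun /ptens /tens !(bigD1 j (P := predT))//= eqxx.
rewrite [X in _ = _ * X](_ : _ = \prod_(i < m | i != j) (pgauss (b i) (ubar_poly p k i) (tnth t
  i))%:C); last first.
  by apply: eq_bigr => i /negbTE ->.
rewrite /pgauss hornerZ hornerM hornerX !rmorphM; ring.
Qed.

Lemma ubar_fun_modulation_L2 p k (j : 'I_m) :
  L2C lebm (fun t => 'i%C * (2 * pi * d j * tnth t j)%:C * ubar_fun p k t).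
Proof.
under eq_fun do rewrite -mulrA -/(b j) ubar_fun_mulX.
by apply: L2CZ; apply: ptens_L2; exact: b_gt0.
Qed.

Lemma ip_Z_br x y : ip h Z (br h x y) = alpha (br h x y) / alpha Z.
Proof. by rewrite alpha_br mulrAC divff// mul1r ip_sym. Qed.

(** Only the pairs (U_j, V_j) have a nonzero bracket, and the condition [a < i] keeps each once, in
    this order. The bracket is central, so its component along the unit vector [Z] is d_j /
    alpha(Z). *)
Lemma zeroth_order_term (s : spinor R m) k :
  \sum_(i < m + m) \sum_(a < m + m | (a < i)%N)
    (ip h Z (br h (frameX U V a) (frameX U V i)))%:C
      * spin_act (@cliffZ R m) (spin_act (cliffX R a) (spin_act (cliffX R i) s)) k
  = - (\sum_(j < m) d j / alpha Z * \prod_(a < m | a != j) sign R k a)%:C * s k.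
Proof.
have [_ _ hd ho hUV] := hbasis.
rewrite big_split_ord /= big1 ?add0r => [|i _]; last first.
  apply: big1 => a; case: (split_ordP a) => a' -> /= ai.
    by rewrite ip_Z_br !frameX_lshift (hUV _ _).1 !mul0r.
  by move: ai; rewrite ltnNge (leq_trans (ltnW (ltn_ord i)))// leq_addr.
rewrite rmorph_sum -sumrN mulr_suml; apply: eq_bigr => i _.
rewrite big_mkcond big_split_ord /= [X in _ + X]big1 ?addr0 => [|a _]; last first.
  by case: ifP => // _; rewrite ip_Z_br !frameX_rshift (hUV _ _).2 !mul0r.
rewrite (bigD1 i)//= big1 ?addr0 => [|a ai]; last first.
  by case: ifP => // _; rewrite ip_Z_br frameX_lshift frameX_rshift ho// !mul0r.
rewrite ifT; last by rewrite (leq_trans (ltn_ord i))// leq_addr.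
rewrite ip_Z_br frameX_lshift frameX_rshift hd cliffX_lshift cliffX_rshift spin_act_ZUV.
by rewrite !rmorphM; ring.
Qed.

Definition dirac_scalar k : R := - (2 * pi * alpha Z * \prod_(a < m) sign R k a)
  - 4^-1 * \sum_(j < m) d j / alpha Z * \prod_(a < m | a != j) sign R k a.

(** The matrix of D on U_p, acting on coordinates [c]. The signs are those of the target index [k]:
    rewriting them with the source [flip j k] changes one sign, whence the minus in the final
    formula. *)
Definition dirac_coef p c k : C :=
  \sum_(j < m) 2 * 'i%C * (Num.sqrt (pi * d j * (p j)%:R) * \prod_(a < m | (a <= j)%N) sign R k
    a)%:C
     * c (flip j k) + (dirac_scalar k)%:C * c k.

(** Stated for any fields with the given representatives, so that it serves both the basis spinors
    and general elements of U_p. *)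
Lemma dirac_ubar p c (psi phi : spinor_field R m) :
  (forall k, rep (component psi k) (fun t => c k * ubar_fun p k t)) ->
  (forall k, rep (component phi k) (fun t => dirac_coef p c k * ubar_fun p k t)) ->
  spin_dirac h Z U V Gam F eps psi phi.
Proof.
move=> rpsi rphi.
pose dZ k t : C := c k * ('i%C * (2 * pi * alpha Z)%:C * ubar_fun p k t).
pose dU (j : 'I_m) k t : C := c k *
  ptens b (fun i => if i == j then dpgauss (b j) (ubar_poly p k j) else ubar_poly p k i) t.
pose dV (j : 'I_m) k t : C := c k * ('i%C * (2 * pi * d j * tnth t j)%:C * ubar_fun p k t).
have LdZ k : L2C lebm (dZ k) by apply/L2CZ/L2CZ/ubar_fun_L2.
have LdU j k : L2C lebm (dU j k) by apply: L2CZ; apply: ptens_L2; exact: b_gt0.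
have LdV j k : L2C lebm (dV j k) by apply: L2CZ; exact: ubar_fun_modulation_L2.
pose WZ : spinor_field R m := fun y k => T (dZ k) y.
pose W (i : 'I_(m + m)) : spinor_field R m := fun y k =>
  match fintype.split i with inl j => T (dU j k) y | inr j => T (dV j k) y end.
have WU j k : component (W (lshift m j)) k = T (dU j k).
  by apply/funext => y; rewrite /component /W (unsplitK (inl j)).
have WV j k : component (W (rshift m j)) k = T (dV j k).
  by apply/funext => y; rewrite /component /W (unsplitK (inr j)).
exists WZ, W; split.
- move=> k; apply: rep_rho_star (rpsi k) (rep_T (LdZ k)) _.
  apply: pi_derivZ; [exact: ubar_fun_L2|exact/L2CZ/ubar_fun_L2|].
  apply: pi_deriv_central; first exact: ubar_fun_L2.
  + by move=> s i; rewrite ucoordZ.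
  + by move=> s i; rewrite vformZ0.
  + by move=> s; rewrite zcharZ mulrC.
- move=> i k; case: (split_ordP i) => j ->.
    rewrite frameX_lshift WU; apply: rep_rho_star (rpsi k) (rep_T (LdU j k)) _.
    apply: pi_derivZ; [exact: ubar_fun_L2|by apply: ptens_L2; exact: b_gt0|].
    apply: ptens_deriv_translation; first exact: b_gt0.
    + by move=> s a; rewrite ucoordU.
    + by move=> s a; rewrite vformU0.
    + by move=> s; rewrite zcharU.
  rewrite frameX_rshift WV; apply: rep_rho_star (rpsi k) (rep_T (LdV j k)) _.
  apply: pi_derivZ; first exact: ubar_fun_L2.
    exact: ubar_fun_modulation_L2.
  apply: ptens_deriv_modulation; first exact: b_gt0.
  + by move=> s a; rewrite ucoordV.
  + by move=> s a; rewrite vformV_linear.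
  + by move=> s; rewrite zcharV.
- by move=> k; have [/H_L2eps] := rphi k.
- move=> k; pose S j : R := \prod_(a < m | (a < j)%N) sign R k a.
  have rU j := rep_T (LdU j (flip j k)); have rV j := rep_T (LdV j (flip j k)).
  have rR := repD (repD (repZ ('i%C * (\prod_(a < m) sign R k a)%:C) (rep_T (LdZ k)))
    (repD (rep_sum (P := xpredT) (index_enum 'I_m) (fun j _ => repZ ('i%C * (S j)%:C) (rU j)))
          (rep_sum (P := xpredT) (index_enum 'I_m) (fun j _ =>
            repZ (- (S j * sign R k j)%:C) (rV j)))))
    (repZ (- (4^-1 * \sum_(j < m) d j / alpha Z * \prod_(a < m | a != j) sign R k a)%:C) (rpsi
      k)).
  move: rR; set Phi := (X in rep X _); set f0 := (X in rep _ X) => rR.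
  have ef : f0 = fun t => dirac_coef p c k * ubar_fun p k t.
    apply/funext => t; rewrite /dirac_coef mulrDl mulr_suml.
    transitivity ('i%C * (\prod_(a < m) sign R k a)%:C * dZ k t +
      \sum_(j < m) 2 * 'i%C * (Num.sqrt (pi * d j * (p j)%:R) *
        \prod_(a < m | (a <= j)%N) sign R k a)%:C * c (flip j k) * ubar_fun p k t +
      - (4^-1 * \sum_(j < m) d j / alpha Z * \prod_(a < m | a != j) sign R k a)%:C * (c k *
        ubar_fun p k t)).
      congr (_ + _ + _); rewrite -big_split; apply: eq_bigr => j _.
      (* The component [k] of the U_j and V_j terms is i S_j (d/dt_j - k_j b_j t_j) applied to the
         component [flip j k], and - k_j is the sign of that index: the ladder operator. *)
      have := ubar_fun_ladder p (flip j k) j t; rewrite flipK sign_flip eqxx mulN1r => e.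
      rewrite (bigD1 j)//= (eq_bigl (fun a : 'I_m => (a < j)%N)); last first.
        by move=> a; rewrite ltn_neqAle andbC -val_eqE.
      rewrite -/(S j) /dU /dV.
      transitivity ('i%C * (S j)%:C * c (flip j k) *
        (- (- sign R k j * (2 * Num.sqrt (pi * d j * (p j)%:R)))%:C * ubar_fun p k t));
          last first.
        by rewrite !rmorphM rmorphN; ring.
      by rewrite -e !rmorphM; ring.
    rewrite [X in X + _ = _]addrC -addrA; congr (_ + _).
    have i2 : 'i%C * 'i%C = -1 :> C by rewrite -expr2 sqr_i.
    rewrite /dirac_scalar rmorphB rmorphN mulrDl mulrDl; congr (_ + _); last by ring.
    transitivity ('i%C * 'i%C * (2 * pi * alpha Z * \prod_(a < m) sign R k a)%:C * c k * ubar_fun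
      p k t).
      by rewrite /dZ !rmorphM; ring.
    by rewrite i2; ring.
  rewrite ef in rR; apply: aeGS (rep_eq (rphi k) rR) => y.
  rewrite {1}/component => ->; rewrite /Phi.
  rewrite spin_act_cliffZ zeroth_order_term big_split_ord /= -!addrA.
  congr (_ + _); congr (_ + (_ + _)).
  + apply: eq_bigr => j _; rewrite cliffX_lshift spin_act_cliffU.
    by rewrite -[W _ y _]/(component (W (lshift m j)) (flip j k) y) WU.
  + apply: eq_bigr => j _; rewrite cliffX_rshift spin_act_cliffV.
    by rewrite -[W _ y _]/(component (W (rshift m j)) (flip j k) y) WV.
  + rewrite /component mulrA mulrN; congr (- _ * _).
    by rewrite rmorphM fmorphV rmorph_nat.
Qed.

(** * Inner products of Hermite functions on R^m *)

Lemma integralC_sum I (r : seq I) (v : I -> C) (g : I -> Rn R m -> R) :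
  (forall i, lebm.-integrable setT (EFin \o g i)) ->
  integralC lebm setT (fun t => \sum_(i <- r) v i * (g i t)%:C) =
  \sum_(i <- r) v i * (\int[lebm]_t g i t)%:C.
Proof.
move=> ig.
have h1 (w : I -> R) : lebm.-integrable setT (EFin \o (fun t => \sum_(i <- r) w i * g i t)) /\
    \int[lebm]_t (\sum_(i <- r) w i * g i t) = \sum_(i <- r) w i * \int[lebm]_t g i t.
  elim: r => [|i r [IH1 IH2]].
    rewrite big_nil (_ : (fun t => _) = fun=> 0); last by apply/funext => t; rewrite big_nil.
    by split; [exact: integrable0|rewrite Rintegral_cst ?mul0r].
  rewrite (_ : (fun t => _) = fun t => w i * g i t + \sum_(i <- r) w i * g i t); last first.
    by apply/funext => t; rewrite big_cons.
  have iz := integrableZl measurableT (w i) (ig i).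
  split; first exact: (integrableD measurableT iz IH1).
  by rewrite RintegralD// big_cons IH2 RintegralZl.
have reE (w : I -> C) : complex.Re (\sum_(i <- r) w i) = \sum_(i <- r) complex.Re (w i).
  by apply: (big_morph (@complex.Re R)) => [[? ?] [? ?]|].
have imE (w : I -> C) : complex.Im (\sum_(i <- r) w i) = \sum_(i <- r) complex.Im (w i).
  by apply: (big_morph (@complex.Im R)) => [[? ?] [? ?]|].
have reM (z : C) (x : R) : complex.Re (z * x%:C) = complex.Re z * x.
  by case: z => a c; rewrite /= mulr0 subr0.
have imM (z : C) (x : R) : complex.Im (z * x%:C) = complex.Im z * x.
  by case: z => a c; rewrite /= mulr0 add0r.
apply/eqP; rewrite eq_complex reE imE; apply/andP; split.
- rewrite (eq_bigr (fun i => complex.Re (v i) * \int[lebm]_t g i t)); last by move=> i _;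
  rewrite reM.
  rewrite -(h1 _).2; apply/eqP; congr (Rintegral _ _ _); apply/funext => t.
  by rewrite reE; apply: eq_bigr => i _; rewrite reM.
- rewrite (eq_bigr (fun i => complex.Im (v i) * \int[lebm]_t g i t)); last by move=> i _;
  rewrite imM.
  rewrite -(h1 _).2; apply/eqP; congr (Rintegral _ _ _); apply/funext => t.
  by rewrite imE; apply: eq_bigr => i _; rewrite imM.
Qed.

Definition gram (P Q : 'I_m -> {poly R}) : R :=
  \prod_(j < m) \int[@lebesgue_measure R]_t (pgauss (b j) (P j) t * pgauss (b j) (Q j) t).

Lemma dotL2_ptens I (r : seq I) (v : I -> C) (P_ : I -> 'I_m -> {poly R}) (w : C) Q :
  dotL2 lebm setT (fun t => \sum_(i <- r) v i * ptens b (P_ i) t) (fun t => w * ptens b Q t) =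
  \sum_(i <- r) v i * w^* * (gram (P_ i) Q)%:C.
Proof.
pose g i (t : Rn R m) : R := \prod_(j < m) (pgauss (b j) (P_ i j) (tnth t j) * pgauss (b j) (Q j)
  (tnth t j)).
have ig i := integrable_Rn_prod (fun j => integrable_pgaussM (b_gt0 j) (P_ i j) (Q j)).
have -> : \sum_(i <- r) v i * w^* * (gram (P_ i) Q)%:C = \sum_(i <- r) v i * w^* * (\int[lebm]_t
  g i t)%:C.
  by apply: eq_bigr => i _; rewrite /gram -(ig i).2.
rewrite -integralC_sum => [|i]; last exact: (ig i).1.
congr (integralC _ _ _); apply/funext => t; rewrite mulr_suml; apply: eq_bigr => i _.
rewrite rmorphM mulrACA -!mulrA; congr (_ * (_ * _)).
rewrite /ptens /tens -!rmorph_prod.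
have cr (x : R) : (x%:C)^* = x%:C by rewrite -[LHS]/(x +i* - 0) oppr0.
rewrite [X in _ * X]cr; transitivity ((\prod_(j < m) pgauss (b j) (P_ i j) (tnth t j) *
    \prod_(j < m) pgauss (b j) (Q j) (tnth t j))%:C); first by rewrite rmorphM.
by congr (_%:C); rewrite -big_split.
Qed.

Lemma hfactor_orthogonal (c : R) n n' s : 0 < c -> n != n' ->
  \int[@lebesgue_measure R]_t (pgauss c (hfactor c n s) t * pgauss c (hfactor c n' s) t) = 0.
Proof.
move=> c0 nn; case: s => /=; last exact: shermite_orthogonal.
rewrite (_ : (fun t => _) = fun t => Num.sqrt (2 * n%:R) * Num.sqrt (2 * n'%:R) *
    (pgauss c (shermite c n.-1) t * pgauss c (shermite c n'.-1) t)); last first.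
  by apply/funext => t; rewrite /pgauss !hornerZ; ring.
rewrite RintegralZl//; last exact: integrable_pgaussM.
(* The predecessors of 0 and 1 coincide, but then the prefactor of index 0 vanishes. *)
have s0 : Num.sqrt (2 * 0%:R) = 0 :> R by rewrite mulr0 sqrtr0.
case: n n' nn => [|n] [|n']//; rewrite ?s0 ?mulr0 ?mul0r// => nn.
by rewrite shermite_orthogonal ?mulr0.
Qed.

Lemma gram_ubar0 p q k : p != q -> gram (ubar_poly p k) (ubar_poly q k) = 0.
Proof.
move=> pq; have [j pqj] : exists j, p j != q j.
  by apply/existsP; rewrite -negb_forall; apply: contra pq => /forallP e; apply/eqP/ffunP => j;
    exact/eqP.
by rewrite /gram (bigD1 j)//= /ubar_poly (hfactor_orthogonal _ (b_gt0 j)) ?mul0r.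
Qed.

Definition hermite_family (q : {ffun 'I_m -> nat}) j : {poly R} := shermite (b j) (q j).

Lemma gram_hermite0 p q : p != q -> gram (hermite_family p) (hermite_family q) = 0.
Proof.
move=> pq; have [j pqj] : exists j, p j != q j.
  by apply/existsP; rewrite -negb_forall; apply: contra pq => /forallP e; apply/eqP/ffunP => j;
    exact/eqP.
by rewrite /gram (bigD1 j)//= shermite_orthogonal ?mul0r// b_gt0.
Qed.

Lemma gram_hermite_gt0 q : 0 < gram (hermite_family q) (hermite_family q).
Proof. by apply: prodr_gt0 => j _; apply: shermite_norm_gt0; exact: b_gt0. Qed.

(** * The spaces U_p: invariance, orthogonality, completeness *)

Lemma rep_ubarG p l k :
  rep (component (ubarG T d p l) k) (fun t => (k == l)%:R * ubar_fun p l t).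
Proof.
rewrite (_ : component _ _ = T (fun t => (k == l)%:R * ubar_fun p l t)).
  by apply: rep_T; apply: L2CZ; exact: ubar_fun_L2.
by apply/funext => y; congr (T _ y); apply/funext => t; rewrite ubarE.
Qed.

Lemma rep_ubar_comb p c k :
  rep (fun y => \sum_(l : tidx m) c l * ubarG T d p l y k) (fun t => c k * ubar_fun p k t).
Proof.
rewrite (_ : (fun t => _) = fun t => \sum_(l : tidx m) c l * ((k == l)%:R * ubar_fun p l t)).
  by apply: rep_sum => l _; apply: repZ; exact: rep_ubarG.
apply/funext => t; rewrite (bigD1 k)//= big1 ?addr0 ?eqxx ?mul1r// => l lk.
by rewrite eq_sym (negbTE lk) mul0r mulr0.
Qed.

Local Notation Up := (Uspace h Z U V Gam eps T d).

Lemma UspaceP p (psi : spinor_field R m) : Up p psi <->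
  exists c, forall k, rep (component psi k) (fun t => c k * ubar_fun p k t).
Proof.
split=> [[Lpsi [c e]]|[c rpsi]].
  exists c => k; apply: rep_ae (rep_ubar_comb p c k) (Lpsi k) _.
  by apply: aeGS (e k) => y.
split; first by move=> k; have [/H_L2eps] := rpsi k.
by exists c => k; exact: rep_eq (rpsi k) (rep_ubar_comb p c k).
Qed.

Lemma Uspace_comb p c : Up p (fun y k => \sum_(l : tidx m) c l * ubarG T d p l y k).
Proof. by apply/UspaceP; exists c => k; exact: rep_ubar_comb. Qed.

Lemma Uspace_finite_dimensional p : finite_dimensional h Z U V Gam eps (Up p).
Proof.
exists #|tidx m|, (fun i => ubarG T d p (enum_val i)); split.
  by move=> i k; have [/H_L2eps] := rep_ubarG p (enum_val i) k.
have sumE (w : tidx m -> C) : \sum_l w l = \sum_(i < #|tidx m|) w (enum_val i).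
  by rewrite (reindex _ (onW_bij _ (enum_val_bij _))).
apply/seteqP; split => psi [Lpsi [c e]]; split=> //.
  by exists (fun i => c (enum_val i)) => k; apply: aeGS (e k) => y ->; rewrite sumE.
exists (fun l => c (enum_rank l)) => k; apply: aeGS (e k) => y ->.
by rewrite sumE; apply: eq_bigr => i _; rewrite enum_valK.
Qed.

Lemma Uspace_D_invariant p : D_invariant h Z U V Gam F eps (Up p).
Proof.
move=> psi /UspaceP[c rpsi]; exists (fun y k =>
  \sum_(l : tidx m) dirac_coef p c l * ubarG T d p l y k).
  exact: Uspace_comb.
by apply: dirac_ubar rpsi _ => k; exact: rep_ubar_comb.
Qed.

Lemma dirac_ubarG p l : spin_dirac h Z U V Gam F eps (ubarG T d p l) (fun y k =>
  - (\sum_(j < m) 2 * 'i%C * (Num.sqrt (pi * d j * (p j)%:R) * \prod_(a < m | (a <= j)%N) sign R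
    l a)%:C
       * ubarG T d p (flip j l) y k)
  + (dirac_scalar l)%:C * ubarG T d p l y k).
Proof.
pose c k : C := (k == l)%:R.
apply: (@dirac_ubar p c) => k.
  rewrite (_ : (fun t => _) = fun t => (k == l)%:R * ubar_fun p l t); first exact: rep_ubarG.
  by apply/funext => t; rewrite /c; case: eqP => [->//|_]; rewrite !mul0r.
set A : 'I_m -> C := fun j =>
  2 * 'i%C * (Num.sqrt (pi * d j * (p j)%:R) * \prod_(a < m | (a <= j)%N) sign R l a)%:C.
have rphi := repD (repZ (-1) (rep_sum (P := xpredT) (index_enum 'I_m) (fun j _ =>
  repZ (A j) (rep_ubarG p (flip j l) k))))
  (repZ (dirac_scalar l)%:C (rep_ubarG p l k)).
move: rphi; set Phi := (X in rep X _); set f0 := (X in rep _ X) => rphi.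
rewrite (_ : component _ _ = Phi); last by apply/funext => y; rewrite /Phi mulN1r.
rewrite (_ : (fun t => _) = f0)//; apply/funext => t; rewrite /f0 /dirac_coef mulrDl mulN1r.
congr (_ + _); last first.
  by rewrite /c; case: eqP => [->|_]; rewrite ?mulrA// !(mulr0, mul0r).
rewrite mulr_suml -sumrN; apply: eq_bigr => j _.
(* The flip is an involution, so the component [k] receives a term exactly when k = [flip j l]. *)
rewrite /c (can2_eq (flipK j) (flipK j)).
case: eqP => [->|_]; last by rewrite !(mulr0, mul0r) oppr0.
rewrite mul1r mulr1 -mulNr; congr (_ * _); rewrite /A -mulrN -rmorphN -mulrN;
  congr (_ * (_ * _)%:C).
rewrite (bigD1 j)//= [X in _ = - X](bigD1 j)//= sign_flip eqxx mulN1r mulNr; congr (- (_ * _)).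
by apply: eq_bigr => a /andP[_ aj]; rewrite sign_flip (negbTE aj) mul1r.
Qed.

(** In the component [k] both fields carry the same signs, hence the same shift E_k, so a variable
    with p_j != q_j has orthogonal factors. *)
Lemma Uspace_orthogonal p q (psi phi : spinor_field R m) : p != q -> Up p psi -> Up q phi ->
  dot_spin Z U V F psi phi = 0.
Proof.
move=> pq /UspaceP[c rpsi] /UspaceP[c' rphi]; apply: big1 => k _.
rewrite (rep_dot (rpsi k) (rphi k)).
have := dotL2_ptens [:: tt] (fun=> c k) (fun=> ubar_poly p k) (c' k) (ubar_poly q k).
rewrite big_seq1 gram_ubar0// mulr0 => <-; congr (dotL2 _ _ _ _).
by apply/funext => t; rewrite big_seq1.
Qed.

(* The index p such that p + E_k = q. *)
Definition ubar_index (q : {ffun 'I_m -> nat}) k : {ffun 'I_m -> nat} :=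
  [ffun j => (q j + (k j != 0%R))%N].

(** The product of the sqrt(2 p_j) over k_j = -1 at p = [ubar_index q k]; there p_j = q_j + 1, so it
    never vanishes. *)
Definition ubar_const q k : R :=
  \prod_(j < m) (if k j != 0 then Num.sqrt (2 * (q j).+1%:R) else 1).

Lemma hfun_ubar q k t :
  hfun b q t = (ubar_const q k)%:C^-1 * ubar_fun (ubar_index q k) k t.
Proof.
have K0 : (ubar_const q k)%:C != 0 :> C.
  rewrite fmorph_eq0; apply/prodf_neq0 => j _; case: ifP => _; last exact: oner_neq0.
  by rewrite sqrtr_eq0 -ltNge mulr_gt0.
apply: (mulfI K0); rewrite mulrA divff// mul1r.
rewrite /hfun /ubar_fun /ptens /tens rmorph_prod -big_split; apply: eq_bigr => j _.
rewrite /ubar_poly /hfactor ffunE /=; case: ifP => _; last by rewrite mul1r addn0.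
by rewrite -rmorphM addn1 /pgauss hornerZ mulrA.
Qed.

Lemma hilbert_sum_Uspace : hilbert_direct_sum Z U V F (tensor_spinors H) Up.
Proof.
split.
- by move=> p psi /UspaceP[c rpsi] k; have [] := rpsi k.
- by move=> p q psi phi; exact: Uspace_orthogonal.
move=> psi e Hpsi e0.
(* There are [N] components, so allowing e / (N + 1) for each keeps the total strictly below [e]. *)
pose N := #|tidx m|; have eN0 : 0 < e / N.+1%:R by rewrite divr_gt0.
have rx k : exists fs : (Rn R m -> C) * seq (C * {ffun 'I_m -> nat}),
    rep (component psi k) fs.1 /\ nrm2 lebm (fun t => fs.1 t - hcomb b fs.2 t) < e / N.+1%:R.
  have [f rf] := rep_exists (Hpsi k).
  by have [s hs] := rep_happrox rf eN0; exists (f, s).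
have [fs hfs] := choice rx.
pose idx (k : tidx m) (x : C * {ffun 'I_m -> nat}) := ubar_index x.2 k.
(* The Hermite terms approximating each component are regrouped by the space U_p to which they
   belong. *)
pose cc p k : C := \sum_(x <- (fs k).2 | idx k x == p) x.1 * (ubar_const x.2 k)%:C^-1.
pose s := undup (flatten [seq map (idx k) (fs k).2 | k : tidx m <- enum {: tidx m}]).
exists s, (fun p y k => \sum_(l : tidx m) cc p l * ubarG T d p l y k); split.
  by move=> p _; exact: Uspace_comb.
have rw k : rep (fun y => \sum_(p <- s) \sum_(l : tidx m) cc p l * ubarG T d p l y k) (hcomb b
  (fs k).2).
  rewrite (_ : hcomb _ _ = fun t => \sum_(p <- s) cc p k * ubar_fun p k t).
    by apply: rep_sum => p _; exact: rep_ubar_comb.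
  apply/funext => t.
  under [RHS]eq_bigr do rewrite mulr_suml.
  rewrite (exchange_big_dep xpredT)//= /hcomb [LHS]big_seq [RHS]big_seq; apply: eq_bigr => x xs.
  have xin : idx k x \in s.
    rewrite mem_undup; apply/flattenP; exists (map (idx k) (fs k).2).
      by apply/mapP; exists k => //; rewrite mem_enum.
    by apply/mapP; exists x.
  rewrite big_mkcond (bigD1_seq (idx k x) xin (undup_uniq _))/= eqxx big1 ?addr0 =>
    [|p /negbTE pk].
    by rewrite (hfun_ubar _ k) mulrA.
  by rewrite eq_sym pk.
have -> : sqnorm_spin Z U V F (fun y k =>
  psi y k - \sum_(p <- s) \sum_(l : tidx m) cc p l * ubarG T d p l y k)
    = \sum_(k : tidx m) nrm2 lebm (fun t => (fs k).1 t - hcomb b (fs k).2 t).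
  rewrite /sqnorm_spin /dot_spin (big_morph (@complex.Re R) (id1 := 0) (op1 := +%R))//;
    last first.
    by move=> [? ?] [? ?].
  apply: eq_bigr => k _; have [rf _] := hfs k.
  exact: (rep_sqnorm (repB rf (rw k))).
apply: (@le_lt_trans _ _ (\sum_(k : tidx m) e / N.+1%:R)).
  by apply: ler_sum => k _; have [_ /ltW] := hfs k.
have -> : \sum_(k : tidx m) e / N.+1%:R = e / N.+1%:R * N%:R by rewrite sumr_const mulr_natr.
rewrite mulrAC ltr_pdivrMr ?ltr0n//.
by rewrite ltr_pM2l// ltr_nat.
Qed.

Lemma half_dim_gt0 : (0 < m)%N.
Proof.
rewrite lt0n; apply/eqP => m0; have [x [y]] := br_nonabelian h; apply.
have [c ->] := chart_surj hZ1 hbasis x.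
rewrite /Defs.chart big1 ?addr0 => [|i _]; first by rewrite br_scalel hZ scaler0.
by exfalso; have := ltn_ord i; rewrite [X in (_ < X + X)%N]m0.
Qed.

(* Otherwise n + 1 orthogonal Hermite functions would be dependent. *)
Lemma tensor_spinors_infinite_dimensional :
  ~ finite_dimensional h Z U V Gam eps (tensor_spinors H).
Proof.
move=> [n [bb [Lbb eH]]]; pose i0 := Ordinal half_dim_gt0.
(* Constant multi-indices; they are distinct because m > 0. *)
pose q (i : 'I_n.+1) : {ffun 'I_m -> nat} := [ffun=> i : nat].
have qinj i j : i != j -> q i != q j.
  by apply: contra => /eqP/ffunP/(_ i0); rewrite !ffunE => /ord_inj ->.
pose k0 : tidx m := [ffun=> 0].
have lf i : L2C lebm (hfun b (q i)) by apply: hfun_L2; exact: b_gt0.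
pose psi i : spinor_field R m := fun y k => (k == k0)%:R * T (hfun b (q i)) y.
have Hpsi i : tensor_spinors H (psi i).
  by move=> k; have [] := repZ (k == k0)%:R (rep_T (lf i)).
have cx i : exists c : 'I_n -> C, aeG (fun y =>
  T (hfun b (q i)) y = \sum_(a < n) c a * bb a y k0).
  have := Hpsi i; rewrite eH => -[_ [c /(_ k0) e]]; exists c.
  by apply: aeGS e => y; rewrite /psi eqxx mul1r.
have [c hc] := choice cx.
pose M : 'M[C]_(n.+1, n) := \matrix_(i, a) c i a.
have [v v0 vM] : exists2 v : 'rV[C]_n.+1, v != 0 & v *m M = 0.
  have : kermx M != 0.
    by rewrite -mxrank_eq0 mxrank_ker -lt0n subn_gt0 ltnS rank_leq_col.
  by case/rowV0Pn => v /sub_kermxP vM v0; exists v.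
pose g t : C := \sum_(i < n.+1) v 0 i * hfun b (q i) t.
have rg : rep (fun y => \sum_(i < n.+1) v 0 i * T (hfun b (q i)) y) g.
  by apply: rep_sum => i _; apply/repZ/rep_T.
have g0 : aeG (fun y => \sum_(i < n.+1) v 0 i * T (hfun b (q i)) y = 0).
  have : aeG (fun y => forall i, T (hfun b (q i)) y = \sum_(a < n) c i a * bb a y k0).
    exact: filter_forall hc.
  apply: aeGS => y hy; under eq_bigr do rewrite hy mulr_sumr.
  rewrite exchange_big /= big1// => a _.
  under eq_bigr do rewrite mulrA.
  rewrite -mulr_suml.
  have := congr1 (fun A : 'rV_n => A 0 a) vM; rewrite !mxE => e.
  by rewrite (eq_bigr (fun i => v 0 i * M i a)) ?e ?mul0r// => i _; rewrite mxE.
have [_ _ H0] := hH; have [H00 _ _] := rep0.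
have r0 := rep_ae rg (H_L2eps H00) g0.
have [i vi] : exists i, v 0 i != 0.
  apply/existsP; rewrite -negb_forall; apply: contra v0 => /forallP e.
  by apply/eqP/rowP => i; rewrite mxE; apply/eqP.
(* Pairing the null combination with one of its Hermite functions leaves [v 0 i] times a positive
   number. *)
have := dotL2_ptens (index_enum 'I_n.+1) (fun i => v 0 i) (fun i =>
  hermite_family (q i)) 1 (hermite_family (q i)).
have -> : (fun t => 1 * ptens b (hermite_family (q i)) t) = hfun b (q i).
  by apply/funext => t; rewrite mul1r.
rewrite -(rep_dot r0 (rep_T (lf i))) (rep_dot rep0 (rep_T (lf i))).
have -> : dotL2 lebm setT (fun=> 0) (hfun b (q i)) = 0.
  rewrite /dotL2 (_ : (fun t => _) = fun=> 0); last by apply/funext => t; rewrite mul0r.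
  by rewrite /integralC !Rintegral_cst ?mul0r.
rewrite (bigD1 i)//= big1 ?addr0 => [/esym/eqP|j ji]; last by rewrite gram_hermite0 ?mulr0 ?qinj.
rewrite rmorph1 mulr1 mulf_eq0 (negbTE vi) /= fmorph_eq0 gt_eqF// gram_hermite_gt0.
by [].
Qed.

End identification.

Local Open Scope complex_scope.

Theorem proposition16 (R : realType) (m : nat) (h : heisenberg R m)
    (Gam : set (lie R m)) (eps : lie R m -> R[i]) (F : set (lie R m))
    (Z : lie R m) (alpha : {scalar lie R m})
    (U V : 'I_m -> lie R m) (d : 'I_m -> R)
    (H : set (lie R m -> R[i]))
    (T : (Rn R m -> R[i]) -> (lie R m -> R[i]))
    (hGam : cocompact_discrete_subgroup h Gam)
    (heps : spin_structure h Gam eps)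
    (hZ : lie_center h Z) (hZ1 : ip h Z Z = 1)
    (halpha : alpha Z != 0)
    (hbasis : adapted_basis h Z alpha U V d)
    (hF : fundamental_domain h Z U V Gam F)
    (hH : irreducible_subspace h Z U V Gam F eps H)
    (hT : unitary_identification h Z U V F alpha H T) :
  let Halpha : set (spinor_field R m) := tensor_spinors H in
  let D := spin_dirac h Z U V Gam F eps in
  let Up (p : {ffun 'I_m -> nat}) := Uspace h Z U V Gam eps T d p in
  [/\ ~ finite_dimensional h Z U V Gam eps Halpha,
      hilbert_direct_sum Z U V F Halpha Up,
      forall p, finite_dimensional h Z U V Gam eps (Up p),
      forall p, D_invariant h Z U V Gam F eps (Up p) &
      forall (p : {ffun 'I_m -> nat}) (l : tidx m),
        D (ubarG T d p l) (fun y k =>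
          - (\sum_(j < m)
               2 * 'i%C * (Num.sqrt (pi * d j * (p j)%:R)
                         * \prod_(a < m | (a <= j)%N) sign R l a)%:C
               * ubarG T d p (flip j l) y k)
          + (- (2 * pi * alpha Z * \prod_(a < m) sign R l a)
             - 4^-1 * \sum_(j < m) d j / alpha Z
                        * \prod_(a < m | a != j) sign R l a)%:C
            * ubarG T d p l y k)].
Proof.
move=> Halpha D Up; split.
- exact: (tensor_spinors_infinite_dimensional hZ hZ1 hbasis hF hH hT).
- exact: (hilbert_sum_Uspace hZ hZ1 hbasis hF hH hT).
- exact: (Uspace_finite_dimensional hbasis hH hT).
- move=> p; exact: (Uspace_D_invariant hZ hZ1 halpha hbasis hF hH hT).
- exact: (dirac_ubarG hZ hZ1 halpha hbasis hF hH hT).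
Qed.
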